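(* Let $n,k\ge1$ be integers, and consider the system $$\frac{\partial y_r}{\partial x_u}+\sum_{i_1,\dots,i_n\in\mathbb{Z}} f_{r i_1\dots i_n u}(x_1,\dots,x_k)\,y_1^{i_1}y_2^{i_2}\cdots y_n^{i_n}=0\qquad(1\le r\le n,\ 1\le u\le k)\qquad( * )$$ for unknown functions $y_1,\dots,y_n$ of $(x_1,\dots,x_k)$, where the $f_{r i_1\dots i_n u}$ are analytic functions, all regular in a common neighborhood $U$ of $(0,\dots,0)$, and let $W$ be such that the Laurent series in $( * )$ converge for $(y_1,\dots,y_n)\in W$ and $(x_1,\dots,x_k)\in U$. Let $h_{\alpha\beta u}$ and $R_{\alpha\beta uv}$ ($\alpha,\beta\in\mathbb{Z}^n$, $1\le u,v\le k$) be the functions associated with the $f_{r i_1\dots i_n u}$ as defined in the context. (i) The integrability conditions for the system $( * )$ for arbitrary initial conditions $y_i(0,\dots,0)=C_i$, $1\le i\le n$ (that is, the necessary and sufficient conditions for $( * )$ to be integrable for arbitrary initial conditions), are $$R_{\alpha\beta uv}\equiv0\quad\text{for all }\alpha,\beta\in\mathbb{Z}^n,\ 1\le u,v\le k,$$ i.e. $R_{\{r\}\beta uv}\equiv 0$ for all $1\le r\le n$, $\beta\in\mathbb{Z}^n$, $1\le u,v\le k$. (ii) If these integrability conditions are satisfied, then there exist functions $P^{\langle w_1,\dots,w_k\rangle}_{i_1\dots i_n j_1\dots j_n}(x_1,\dots,x_k)$, for $w_1,\dots,w_k\in\mathbb{N}_0$ and $i_1,\dots,i_n,j_1,\dots,j_n\in\mathbb{Z}$,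 in a neighborhood of $(0,\dots,0)$, such that $$P^{\langle0,\dots,0\rangle}_{i_1\dots i_n j_1\dots j_n}=\delta_{i_1j_1}\delta_{i_2j_2}\cdots\delta_{i_nj_n},$$ $$P^{\langle w_1,\dots,w_u+1,\dots,w_k\rangle}_{i_1\dots i_n j_1\dots j_n}=\frac{\partial}{\partial x_u}P^{\langle w_1,\dots,w_k\rangle}_{i_1\dots i_n j_1\dots j_n}+\sum_{t_1,\dots,t_n\in\mathbb{Z}}\Bigl(\sum_{s=1}^{n} i_s\,f_{s(t_1-i_1)\dots(t_s-i_s+1)\dots(t_n-i_n)u}\Bigr)P^{\langle w_1,\dots,w_k\rangle}_{t_1\dots t_n j_1\dots j_n}$$ for all $1\le u\le k$ and all values of the indices. If $(C_1,\dots,C_n)\in W$, then the solution of $( * )$ with $y_i(0,\dots,0)=C_i$ ($1\le i\le n$) in a neighborhood of $(0,\dots,0)$ is given, for $1\le r\le n$, by $$y_r=\sum_{w_1,\dots,w_k\in\mathbb{N}_0}\Bigl[\frac{(-x_1)^{w_1}}{w_1!}\cdots\frac{(-x_k)^{w_k}}{w_k!}\sum_{j_1,\dots,j_n\in\mathbb{Z}}P^{\langle w_1,\dots,w_k\rangle}_{\{r\}\,j_1\dots j_n}\,C_1^{j_1}C_2^{j_2}\cdots C_n^{j_n}\Bigr],$$ where $P^{\langle w_1,\dots,w_k\rangle}_{\{r\}\,j_1\dots j_n}$ is evaluated at $(x_1,\dots,x_k)$. This solution is unique with the given initial conditions in a neighborhood of $(0,\dots,0)$.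
   Context: $\mathbb{N}_0=\{0,1,2,\dots\}$; $\delta_{ij}$ is the Kronecker delta; ''regular'' means analytic (holomorphic, when the variables are complex). Greek indices $\alpha,\beta,\dots$ denote $n$-tuples of integers $i_1\dots i_n$, $j_1\dots j_n$, etc. (elements of $\mathbb{Z}^n$, added and subtracted componentwise), and $\{r\}$ denotes the $n$-tuple $0\dots010\dots0$ with $1$ in the $r$-th place. In $f_{s(j_1-i_1)\dots(j_s-i_s+1)\dots(j_n-i_n)u}$ the multi-index is $(j_1-i_1,\dots,j_n-i_n)$ with $1$ added to its $s$-th entry. Given the functions $f_{r i_1\dots i_n u}$, define $$h_{i_1\dots i_n j_1\dots j_n u}=\sum_{s=1}^{n} i_s\,f_{s(j_1-i_1)\dots(j_s-i_s+1)\dots(j_n-i_n)u},$$ and $$R_{i_1\dots i_n j_1\dots j_n uv}=\frac{\partial}{\partial x_u}h_{i_1\dots i_n j_1\dots j_n v}-\frac{\partial}{\partial x_v}h_{i_1\dots i_n j_1\dots j_n u}+\sum_{t_1,\dots,t_n\in\mathbb{Z}}h_{t_1\dots t_n j_1\dots j_n v}\,h_{i_1\dots i_n t_1\dots t_n u}-\sum_{t_1,\dots,t_n\in\mathbb{Z}}h_{t_1\dots t_n j_1\dots j_n u}\,h_{i_1\dots i_n t_1\dots t_n v}$$ for $i_1,\dots,i_n,j_1,\dots,j_n\in\mathbb{Z}$ and $1\le u,v\le k$ (the paper deduces the convergence of these series from that of products of the convergent Laurent series).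
   Formalization: U is taken open and connected, W open and nonempty, and convergence of the Laurent series is taken as normal convergence (power series in x on a common polydisc, absolutely summable at each point of U×W); with bare pointwise convergence, disconnected U or thin W the claim fails. *)

(* Defs.v *)
From HB Require Import structures.
From mathcomp Require Import all_boot all_order all_algebra finmap.
From mathcomp Require Import all_classical all_reals all_analysis.
From mathcomp.analysis.showcase Require Import summability.
From mathcomp Require Import complex.
Set Implicit Arguments.
Unset Strict Implicit.
Unset Printing Implicit Defensive.
Import Order.TTheory GRing.Theory Num.Theory.
Import numFieldNormedType.Exports.
Local Open Scope classical_set_scope.
Local Open Scope ring_scope.

(* [K] is the field of the variables, later taken to be the reals or the
   complex numbers.  Points and multi-indices are row vectors: ['rV[K]_k] for
   (x_1, ..., x_k), ['rV[int]_n] for Z^n, ['rV[nat]_k] for N_0^k. *)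

(* {r} in Z^n or N_0^k, and the r-th basis vector of K^k. *)
Definition unit_tuple (A : pzSemiRingType) (n : nat) (r : 'I_n) : 'rV[A]_n :=
  delta_mx 0 r.

(* The families summed here have no canonical order: convergence is along the
   finite subsets of the index type, ordered by inclusion.  Over the real or
   complex numbers this is absolute convergence. *)
Definition is_sum (K : numFieldType) (I : choiceType) (a : I -> K) (s : K) :
    Prop :=
  (partial_sum a : {fset I} -> K^o) @ totally --> (s : K^o).

Definition has_sum (K : numFieldType) (I : choiceType) (a : I -> K) : Prop :=
  exists s, is_sum a s.

(* The sum of [a]; meaningful only if [has_sum a]. *)
Definition sum_of (K : numFieldType) (I : choiceType) (a : I -> K) : K :=
  @sum I K K^o a.

(* y_1^{i_1} ... y_n^{i_n} with i in Z^n; here 0 ^ (-1) = 0. *)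
Definition lmonom (K : numFieldType) (n : nat) (y : 'rV[K]_n)
    (i : 'rV[int]_n) : K :=
  \prod_(s < n) y 0 s ^ i 0 s.

Definition monom (K : numFieldType) (k : nat) (x : 'rV[K]_k)
    (m : 'rV[nat]_k) : K :=
  \prod_(u < k) x 0 u ^+ m 0 u.

Definition pderiv (K : numFieldType) (k : nat) (u : 'I_k)
    (g : 'rV[K]_k -> K) (x : 'rV[K]_k) : K :=
  'D_(unit_tuple K u) (g : 'rV[K]_k -> K^o) x.

(* [a] is the family of coefficients of a power series centred at [x0] which
   converges to [g] on the open polydisc of radius [rho]. *)
Definition expansion (K : numFieldType) (k : nat) (g : 'rV[K]_k -> K)
    (x0 : 'rV[K]_k) (rho : K) (a : 'rV[nat]_k -> K) : Prop :=
  forall x, ball x0 rho x -> is_sum (fun m => a m * monom (x - x0) m) (g x).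

Definition regular_on (K : numFieldType) (k : nat) (U : set 'rV[K]_k)
    (g : 'rV[K]_k -> K) : Prop :=
  forall x0, U x0 -> exists rho a, 0 < rho /\ expansion g x0 rho a.

(* Convergence of the Laurent series \sum_i c_i(x) y^i at y = y0 and near
   x = x0, as a series of regular functions: for some rho > 0 all the c_i have
   power series on the polydisc of radius rho about x0, and
     \sum_i |c_i|_rho |y0^i| < oo   where  |\sum_m a_m (x-x0)^m|_rho
                                             = \sum_m |a_m| rho^{|m|}.
   Over the complex numbers, for (x0, y0) ranging over a product of open sets,
   Cauchy's estimates show that this is locally uniform absolute convergence.
   Convergence at each point separately would not make the sum continuous in
   x, and over the reals even uniform convergence would not make it analytic
   (\sum_i 2^-i cos(4^i x) y^i). *)
Definition laurent_cvg_at (K : numFieldType) (n k : nat)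
    (c : 'rV[int]_n -> 'rV[K]_k -> K) (x0 : 'rV[K]_k) (y0 : 'rV[K]_n) : Prop :=
  exists (rho : K) (a : 'rV[int]_n -> 'rV[nat]_k -> K),
    [/\ 0 < rho,
        forall i, expansion (c i) x0 rho (a i) &
        has_sum (fun im : 'rV[int]_n * 'rV[nat]_k =>
          `|a im.1 im.2| * rho ^+ (\sum_(u < k) im.2 0%R u)%N
            * `|lmonom y0 im.1|)].

(* The first clause says that every term c_i(x) y^i makes sense on U x W: no
   negative power of y_s occurs if y_s vanishes somewhere on W. *)
Definition laurent_cvg (K : numFieldType) (n k : nat)
    (U : set 'rV[K]_k) (W : set 'rV[K]_n)
    (c : 'rV[int]_n -> 'rV[K]_k -> K) : Prop :=
  (forall x y (i : 'rV[int]_n) (s : 'I_n),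
     U x -> W y -> y 0 s = 0 -> i 0 s < 0 -> c i x = 0) /\
  (forall x y, U x -> W y -> laurent_cvg_at c x y).

Section System.
Variables (K : numFieldType) (n k : nat).
(* [f r i u x] is f_{r i_1 ... i_n u}(x_1, ..., x_k). *)
Variable f : 'I_n -> 'rV[int]_n -> 'I_k -> 'rV[K]_k -> K.

Definition hfun (i j : 'rV[int]_n) (u : 'I_k) (x : 'rV[K]_k) : K :=
  \sum_(s < n) (i 0 s)%:~R * f s (j - i + unit_tuple int s) u x.

Definition Rfun (i j : 'rV[int]_n) (u v : 'I_k) (x : 'rV[K]_k) : K :=
  pderiv u (hfun i j v) x - pderiv v (hfun i j u) x
  + sum_of (fun t : 'rV[int]_n => hfun t j v x * hfun i t u x)
  - sum_of (fun t : 'rV[int]_n => hfun t j u x * hfun i t v x).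

(* [y] solves the system in a neighborhood of 0; [differentiable] is
   K-differentiability, i.e. holomorphy when K is the complex field. *)
Definition solution_near0 (U : set 'rV[K]_k) (W : set 'rV[K]_n)
    (y : 'rV[K]_k -> 'rV[K]_n) : Prop :=
  \forall x \near (0 : 'rV[K]_k),
    [/\ U x, W (y x), differentiable y x &
        forall (r : 'I_n) (u : 'I_k),
          pderiv u (fun z => y z 0 r) x
          + sum_of (fun i : 'rV[int]_n => f r i u x * lmonom (y x) i) = 0].

Definition integrable_for_all_initial (U : set 'rV[K]_k) (W : set 'rV[K]_n) :
    Prop :=
  forall C, W C -> exists y, solution_near0 U W y /\ y 0 = C.

(* [P w i j] is P^{<w_1, ..., w_k>}_{i_1 ... i_n j_1 ... j_n} on [V]. *)
Definition P_recurrence (V : set 'rV[K]_k)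
    (P : 'rV[nat]_k -> 'rV[int]_n -> 'rV[int]_n -> 'rV[K]_k -> K) : Prop :=
  forall (i j : 'rV[int]_n) (x : 'rV[K]_k), V x ->
    P 0 i j x = \prod_(s < n) (i 0 s == j 0 s)%:R /\
    forall (w : 'rV[nat]_k) (u : 'I_k),
      [/\ differentiable (P w i j : 'rV[K]_k -> K^o) x,
          has_sum (fun t : 'rV[int]_n => hfun i t u x * P w t j x) &
          P (w + unit_tuple nat u) i j x
          = pderiv u (P w i j) x
            + sum_of (fun t : 'rV[int]_n => hfun i t u x * P w t j x)].

(* (-x_1)^{w_1}/w_1! ... (-x_k)^{w_k}/w_k! *)
Definition taylor_factor (w : 'rV[nat]_k) (x : 'rV[K]_k) : K :=
  \prod_(u < k) ((- x 0 u) ^+ w 0 u / (w 0%R u)`!%:R).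

(* y_r(x) is the value of the (convergent) iterated series of P. *)
Definition given_by_series
    (P : 'rV[nat]_k -> 'rV[int]_n -> 'rV[int]_n -> 'rV[K]_k -> K)
    (C : 'rV[K]_n) (r : 'I_n) (x : 'rV[K]_k) (yr : K) : Prop :=
  (forall w, has_sum (fun j : 'rV[int]_n =>
     P w (unit_tuple int r) j x * lmonom C j)) /\
  is_sum (fun w : 'rV[nat]_k =>
     taylor_factor w x *
     sum_of (fun j : 'rV[int]_n => P w (unit_tuple int r) j x * lmonom C j)) yr.

End System.

(* Main.v *)
(* Let h_u be the infinite matrix (h_{i j u}) and D_u = d/dx_u + h_u, acting on
   matrices of analytic functions, so that R_{u v} = [D_u, D_v].  In norms with
   weights c^i q^|i|, products of l operators D_u cost at most (const l)^l, so
   Z = \sum_w (-x)^w / w! P^<w>, with P^<w> = D_1^{w_1} ... D_k^{w_k} I, converges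
   near 0.  Always D_u Z = 0 on {x_v = 0 for v < u}, and D_u Z = 0 near 0 if R = 0.
   Put Z_i = \sum_j Z_{i j} C^j.  As D_u is a derivation for the addition of
   indices, Z_{i + j} = Z_i Z_j, that is, Z_i = y^i for y_r = Z_{r}, and D_u Z = 0
   says that y solves the system.  Any solution with y(0) = C is this y, as one
   sees by going from 0 to x along the coordinate axes.  Conversely, if there are
   solutions for all C, then \sum_j (D_u Z)_{i j} C^j = 0 for all C in an open set,
   so D_u Z = 0 by uniqueness of Laurent coefficients, R Z = 0, and R = 0 near 0
   since Z = I + O(x); R = 0 on U by the identity theorem. *)
Require Import Defs.
From HB Require Import structures.
From mathcomp Require Import all_boot all_order all_algebra finmap.
From mathcomp Require Import all_classical all_reals all_analysis.
From mathcomp.analysis.showcase Require Import summability.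
From mathcomp Require Import complex ring lra zify.
Set Implicit Arguments.
Unset Strict Implicit.
Unset Printing Implicit Defensive.
Import Order.TTheory GRing.Theory Num.Theory.
Import numFieldNormedType.Exports.
Local Open Scope classical_set_scope.
Local Open Scope ring_scope.

(** * Real and complex scalars *)

(** The factor [i_s] in [h] makes [h_u] unbounded in any single norm, so [D_u] acts only from one
    norm into a weaker one. The loss is inversely proportional to the gap, as for a derivative on
    shrinking polydiscs, and both losses come from the one inequality [n a^(n-1) (b - a) <= b^n].
    Power series with majorants take the place of complex analysis, so that real and complex scalars
    are covered together; for the same reason Laurent coefficients are separated by exponential sums
    and not by contour integrals. [Z] is built from words in the [D_u] in a fixed order, before
    anything is known about commutation: it exists without integrability, and necessity can be
    tested on it. It does not depend on [C]; only the weights in which it converges do, and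
    uniqueness of power series identifies the expansions found for different [C]. *)

(* Treats K = R and K = R[i] at once: [rcr] embeds the reals, [nrm] is the
   modulus as a real number, [re] and [im] are the coordinates, and [unit_im]
   is 0 or i. *)
Record rcs (R : realType) (K : numFieldType) := Rcs {
  rcr : R -> K;
  nrm : K -> R;
  re : K -> R;
  im : K -> R;
  unit_im : K;
  rcr_add : forall x y, rcr (x + y) = rcr x + rcr y;
  rcr_mul : forall x y, rcr (x * y) = rcr x * rcr y;
  rcr_one : rcr 1 = 1;
  rcr_le : forall x y, (rcr x <= rcr y) = (x <= y);
  nrm_def : forall a, `|a| = rcr (nrm a);
  re_add : forall a b, re (a + b) = re a + re b;
  im_add : forall a b, im (a + b) = im a + im b;
  re_scale : forall r a, re (rcr r * a) = r * re a;
  im_scale : forall r a, im (rcr r * a) = r * im a;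
  re_nrm : forall a, `|re a| <= nrm a;
  im_nrm : forall a, `|im a| <= nrm a;
  nrm_unit_im : nrm unit_im <= 1;
  reim : forall a, a = rcr (re a) + rcr (im a) * unit_im }.

(** Transparent, so that [nrm] for real scalars reduces to the absolute value; the exponential sums
    below rely on it. *)
Lemma rcs_real (R : realType) : rcs R R.
Proof.
refine (@Rcs R R id Num.norm id (fun=> 0) 0 _ _ _ _ _ _ _ _ _ _ _ _ _) => //.
- by move=> a b; rewrite addr0.
- by move=> r a; rewrite mulr0.
- by move=> a; rewrite normr0.
- by rewrite normr0.
- by move=> a; rewrite mulr0 addr0.
Defined.

Lemma rcs_complex (R : realType) : rcs R (R[i]%C : numFieldType).
Proof.
exists (fun x : R => (x%:C)%C) (fun a : R[i]%C => Normc.normc a)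
  (@complex.Re R) (@complex.Im R) ('i%C).
- by move=> x y; rewrite rmorphD.
- by move=> x y; rewrite rmorphM.
- by [].
- by move=> x y; rewrite lecR.
- by case=> a b; rewrite normc_def.
- by case=> a b [c d].
- by case=> a b [c d].
- by move=> r [a b] /=; rewrite mul0r subr0.
- by move=> r [a b] /=; rewrite mul0r addr0.
- case=> a b /=; rewrite -sqrtr_sqr ler_wsqrtr // lerDl sqr_ge0 //.
- case=> a b /=; rewrite -sqrtr_sqr ler_wsqrtr // lerDr sqr_ge0 //.
- by rewrite /= expr0n /= add0r expr1n sqrtr1.
- by case=> a b; apply/eqP; rewrite eq_complex /=; simpc.
Qed.

Lemma rcs_exists (R : realType) (K : numFieldType) :
  K = (R : numFieldType) \/ K = (R[i]%C : numFieldType) -> inhabited (rcs R K).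
Proof. by case=> ->; constructor; [exact: rcs_real | exact: rcs_complex]. Qed.

Section RcsTheory.
Variables (R : realType) (K : numFieldType) (S : rcs R K).
Local Notation rcr := (rcr S).
Local Notation nrm := (nrm S).
Local Notation re := (re S).
Local Notation im := (im S).

Lemma rcr0 : rcr 0 = 0.
Proof. by apply: (addIr (rcr 0)); rewrite -rcr_add !add0r. Qed.

Lemma rcrN x : rcr (- x) = - rcr x.
Proof. by apply: (addIr (rcr x)); rewrite -rcr_add !addNr rcr0. Qed.

Lemma rcrB x y : rcr (x - y) = rcr x - rcr y.
Proof. by rewrite rcr_add rcrN. Qed.

Lemma rcr_inj : injective rcr.
Proof.
by move=> x y e; apply/eqP; rewrite eq_le -!(rcr_le S) e lexx.
Qed.

Lemma rcr_lt x y : (rcr x < rcr y) = (x < y).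
Proof. by rewrite !lt_neqAle rcr_le (inj_eq rcr_inj). Qed.

Lemma rcr_ge0 x : (0 <= rcr x) = (0 <= x).
Proof. by rewrite -rcr0 rcr_le. Qed.

Lemma rcr_gt0 x : (0 < rcr x) = (0 < x).
Proof. by rewrite -rcr0 rcr_lt. Qed.

Lemma rcrX x n : rcr (x ^+ n) = rcr x ^+ n.
Proof.
by elim: n => [|n IH]; rewrite ?expr0 ?rcr_one // !exprS rcr_mul IH.
Qed.

Lemma rcr_sum (I : Type) (r : seq I) (P : pred I) (F : I -> R) :
  rcr (\sum_(i <- r | P i) F i) = \sum_(i <- r | P i) rcr (F i).
Proof.
by elim/big_rec2: _ => [|i x y _ <-]; rewrite ?rcr0 ?rcr_add.
Qed.

Lemma rcr_nat n : rcr n%:R = n%:R.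
Proof. by elim: n => [|n IH]; rewrite ?rcr0 // -natr1 rcr_add IH rcr_one natr1. Qed.

Lemma rcrV x : rcr x^-1 = (rcr x)^-1.
Proof.
have [->|x0] := eqVneq x 0; first by rewrite rcr0 !invr0 rcr0.
have rx0 : rcr x != 0 by rewrite -rcr0 (inj_eq rcr_inj).
by apply: (mulfI rx0); rewrite -rcr_mul !divff // rcr_one.
Qed.

Lemma nrm_ge0 a : 0 <= nrm a.
Proof. by rewrite -rcr_ge0 -nrm_def. Qed.

Lemma nrm0 : nrm 0 = 0.
Proof. by apply: rcr_inj; rewrite -nrm_def normr0 rcr0. Qed.

Lemma nrm1 : nrm 1 = 1.
Proof. by apply: rcr_inj; rewrite -nrm_def normr1 rcr_one. Qed.

Lemma nrm_eq0 a : (nrm a == 0) = (a == 0).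
Proof. by rewrite -(inj_eq rcr_inj) -nrm_def rcr0 normr_eq0. Qed.

Lemma nrm_gt0 a : (0 < nrm a) = (a != 0).
Proof. by rewrite lt_neqAle nrm_ge0 andbT eq_sym nrm_eq0. Qed.

Lemma nrmM a b : nrm (a * b) = nrm a * nrm b.
Proof. by apply: rcr_inj; rewrite rcr_mul -!nrm_def normrM. Qed.

Lemma nrmN a : nrm (- a) = nrm a.
Proof. by apply: rcr_inj; rewrite -!nrm_def normrN. Qed.

Lemma nrmD a b : nrm (a + b) <= nrm a + nrm b.
Proof. by rewrite -(rcr_le S) rcr_add -!nrm_def ler_normD. Qed.

Lemma nrmB a b : nrm (a - b) <= nrm a + nrm b.
Proof. by rewrite (le_trans (nrmD _ _)) // nrmN. Qed.

Lemma nrmBC a b : nrm (a - b) = nrm (b - a).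
Proof. by rewrite -nrmN opprB. Qed.

Lemma nrm_rcr x : nrm (rcr x) = `|x|.
Proof.
apply: rcr_inj; rewrite -nrm_def.
case: (ger0P x) => hx; first by rewrite ger0_norm // rcr_ge0.
by rewrite rcrN ltr0_norm // -rcr0 rcr_lt.
Qed.

Lemma nrm_nat n : nrm n%:R = n%:R.
Proof. by rewrite -rcr_nat nrm_rcr ger0_norm. Qed.

Lemma nrm_int (z : int) : nrm z%:~R = `|z|%N%:R.
Proof. by case: z => n; rewrite ?NegzE ?mulrNz ?nrmN -pmulrn nrm_nat. Qed.

Lemma nrmX a n : nrm (a ^+ n) = nrm a ^+ n.
Proof. by elim: n => [|n IH]; rewrite ?expr0 ?nrm1 // !exprS nrmM IH. Qed.

Lemma nrmV a : nrm a^-1 = (nrm a)^-1.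
Proof. by apply: rcr_inj; rewrite rcrV -!nrm_def normfV. Qed.

Lemma nrmXz a (z : int) : nrm (a ^ z) = nrm a ^ z.
Proof. by case: z => n; rewrite ?NegzE -?exprnN -?exprnP ?nrmV nrmX. Qed.

Lemma nrm_sum (I : Type) (r : seq I) (P : pred I) (F : I -> K) :
  nrm (\sum_(i <- r | P i) F i) <= \sum_(i <- r | P i) nrm (F i).
Proof.
elim/big_rec2: _ => [|i x y _ h]; first by rewrite nrm0.
by rewrite (le_trans (nrmD _ _)) // lerD2l.
Qed.

Lemma nrm_prod (I : Type) (r : seq I) (P : pred I) (F : I -> K) :
  nrm (\prod_(i <- r | P i) F i) = \prod_(i <- r | P i) nrm (F i).
Proof. by elim/big_rec2: _ => [|i x y _ <-]; rewrite ?nrm1 ?nrmM. Qed.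

Lemma pos_rcr (x : K) : 0 < x -> x = rcr (nrm x).
Proof. by move=> x0; rewrite -nrm_def gtr0_norm. Qed.

Lemma re0 : re 0 = 0.
Proof. by apply: (addIr (re 0)); rewrite -re_add !add0r. Qed.

Lemma im0 : im 0 = 0.
Proof. by apply: (addIr (im 0)); rewrite -im_add !add0r. Qed.

Lemma re_sum (I : Type) (r : seq I) (P : pred I) (F : I -> K) :
  re (\sum_(i <- r | P i) F i) = \sum_(i <- r | P i) re (F i).
Proof. by elim/big_rec2: _ => [|i x y _ <-]; rewrite ?re0 ?re_add. Qed.

Lemma im_sum (I : Type) (r : seq I) (P : pred I) (F : I -> K) :
  im (\sum_(i <- r | P i) F i) = \sum_(i <- r | P i) im (F i).
Proof. by elim/big_rec2: _ => [|i x y _ <-]; rewrite ?im0 ?im_add. Qed.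

Lemma nrm_reim a : nrm a <= `|re a| + `|im a|.
Proof.
rewrite {1}(reim S a) (le_trans (nrmD _ _)) // nrmM !nrm_rcr lerD2l.
by rewrite ler_piMr // nrm_unit_im.
Qed.

End RcsTheory.

Lemma le_of_eq (R : realType) (x y : R) : x = y -> x <= y.
Proof. by move=> ->. Qed.

(** * Unconditional sums *)

Section Bounded.
Variable R : realType.
Implicit Types (I J : choiceType).

(** For [p >= 0] this is summability with sum at most [B]. Carrying the inequality instead of the
    limit lets bounds be composed without convergence arguments. *)
Definition bd (I : choiceType) (p : I -> R) (B : R) :=
  forall A : {fset I}, \sum_(i <- A) p i <= B.

Lemma bd_ge0 (I : choiceType) (p : I -> R) B : bd p B -> 0 <= B.
Proof. by move=> /(_ fset0); rewrite big_seq_fset0. Qed.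

Lemma bd_term (I : choiceType) (p : I -> R) B i : bd p B -> p i <= B.
Proof. by move=> /(_ [fset i]%fset); rewrite big_seq_fset1. Qed.

Lemma bd_le (I : choiceType) (p q : I -> R) B C :
  (forall i, p i <= q i) -> bd q B -> B <= C -> bd p C.
Proof.
move=> pq qB BC A; apply: le_trans BC; apply: le_trans (qB A).
by apply: ler_sum.
Qed.

Lemma bdW (I : choiceType) (p : I -> R) B C : bd p B -> B <= C -> bd p C.
Proof. by move=> h; exact: bd_le h. Qed.

Lemma sum_fset_sub (I : choiceType) (p : I -> R) (A B : {fset I}) :
  (forall i, 0 <= p i) -> (A `<=` B)%fset ->
  \sum_(i <- A) p i <= \sum_(i <- B) p i.
Proof.
move=> p0 AB; rewrite [leRHS](big_fsetID _ (mem A)) /=.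
have -> : [fset x in B | x \in A]%fset = A.
  by apply/fsetP => x; rewrite !inE; apply/andP/idP => [[]|xA] //;
     rewrite xA (fsubsetP AB).
by rewrite lerDl sumr_ge0.
Qed.

(** A finite sum within [e] of the supremum leaves less than [e] for the indices outside it. *)
Lemma bd_tail (I : choiceType) (p : I -> R) B : (forall i, 0 <= p i) -> bd p B ->
  forall e, 0 < e -> exists A : {fset I}, forall D : {fset I},
    [disjoint A & D]%fset -> \sum_(i <- D) p i < e.
Proof.
move=> p0 pB e e0.
pose E := [set \sum_(i <- A) p i | A in [set: {fset I}]].
have hE : has_sup E.
  split; first by exists (\sum_(i <- fset0) p i); exists fset0.
  by exists B => _ [A _ <-].
have [_ [A _ <-] hA] := sup_adherent e0 hE.
exists A => D AD; rewrite -(ltrD2l (\sum_(i <- A) p i)).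
have := ub_le_sup (proj2 hE) (imageT (fun A : {fset I} => \sum_(i <- A) p i) (A `|` D)%fset).
rewrite (big_fsetID _ (mem A)) /=.
have -> : [fset x in (A `|` D) | x \in A]%fset = A.
  by apply/fsetP => x; rewrite !inE; case: (x \in A); rewrite ?andbF.
have -> : [fset x in (A `|` D) | x \notin A]%fset = D.
  apply/fsetP => x; rewrite !inE; have [xA|xA] /= := boolP (x \in A).
    by rewrite (negbTE (fdisjointP AD _ xA)).
  by rewrite andbT.
by move=> h; apply: le_lt_trans h _; rewrite -ltrBlDr.
Qed.

Lemma bdD (I : choiceType) (p q : I -> R) B C :
  bd p B -> bd q C -> bd (fun i => p i + q i) (B + C).
Proof. by move=> pB qC A; rewrite big_split lerD. Qed.

Lemma bd_sum (I : choiceType) (T : finType) (p : T -> I -> R) (B : T -> R) :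
  (forall t, bd (p t) (B t)) -> bd (fun i => \sum_t p t i) (\sum_t B t).
Proof. by move=> h A; rewrite exchange_big /= ler_sum // => t _; exact: h. Qed.

Lemma bdZ (I : choiceType) (p : I -> R) B c :
  0 <= c -> bd p B -> bd (fun i => c * p i) (c * B).
Proof. by move=> c0 pB A; rewrite -mulr_sumr ler_wpM2l. Qed.

Lemma bd_inj (I J : choiceType) (f : J -> I) (p : I -> R) B :
  injective f -> bd p B -> bd (fun j => p (f j)) B.
Proof.
move=> fi pB A; have := pB (f @` A)%fset.
by rewrite big_imfset //= => x y _ _ /fi.
Qed.

Lemma bd_single (I : choiceType) (p : I -> R) i0 B :
  (forall i, i != i0 -> p i = 0) -> 0 <= p i0 -> p i0 <= B -> bd p B.
Proof.
move=> h p0 pB A.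
have [iA|iA] := boolP (i0 \in A).
  rewrite (big_fsetD1 i0) //= big_seq big1 ?addr0 // => i.
  by rewrite !inE => /andP[ii _]; rewrite h.
rewrite big_seq big1 ?(le_trans p0) // => i iA'.
by rewrite h //; apply: contraNneq iA => <-.
Qed.

(** Tonelli's inequality: a finite set of pairs is sorted by first coordinate, and each fibre is
    charged to its row. *)
Lemma bd_pair (I J : choiceType) (p : I -> J -> R) (P : I -> R) B :
  (forall i j, 0 <= p i j) ->
  (forall i, bd (p i) (P i)) -> bd P B -> bd (fun x : I * J => p x.1 x.2) B.
Proof.
move=> p0 pP PB A.
apply: le_trans (PB [fset x.1 | x in A]%fset).
rewrite (partition_big_imfset _ (@fst I J)) /=; apply: ler_sum => i _.
apply: le_trans (pP i [fset x.2 | x in [fset x in A | x.1 == i]]%fset).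
rewrite big_imfset /=; last first.
  by move=> [x1 x2] [y1 y2]; rewrite !inE /= => /andP[_ /eqP ->] /andP[_ /eqP ->] ->.
rewrite big_fset_condE le_eqVlt; apply/orP; left; apply/eqP.
rewrite [LHS]big_seq [RHS]big_seq; apply: eq_bigr => x.
by rewrite !inE => /andP[_ /eqP ->].
Qed.

Definition rsum (I : choiceType) (p : I -> R) :=
  sup [set \sum_(i <- A) p i | A in [set: {fset I}]].

Lemma bd_has_sup (I : choiceType) (p : I -> R) B : bd p B ->
  has_sup [set \sum_(i <- A) p i | A in [set: {fset I}]].
Proof.
move=> pB; split; first by exists (\sum_(i <- fset0) p i); exists fset0.
by exists B => _ [A _ <-].
Qed.

Lemma rsum_bd (I : choiceType) (p : I -> R) B : bd p B -> bd p (rsum p).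
Proof.
move=> /bd_has_sup [_ hp] A.
exact: (ub_le_sup hp (imageT (fun A : {fset I} => \sum_(i <- A) p i) A)).
Qed.

Lemma rsum_cvg (I : choiceType) (p : I -> R) B : (forall i, 0 <= p i) -> bd p B ->
  forall e, 0 < e -> exists A : {fset I}, forall D : {fset I},
    (A `<=` D)%fset -> `|rsum p - \sum_(i <- D) p i| < e.
Proof.
move=> p0 pB e e0.
have [_ [A _ <-] hA] := sup_adherent e0 (bd_has_sup pB).
exists A => D AD; rewrite ger0_norm ?subr_ge0; last exact: rsum_bd pB _.
rewrite ltrBlDr -ltrBlDl; apply: lt_le_trans hA _; exact: sum_fset_sub.
Qed.

Lemma bd_row (I J : choiceType) (p : I * J -> R) B :
  (forall x, 0 <= p x) -> bd p B ->
  (forall i, bd (fun j => p (i, j)) (rsum (fun j => p (i, j)))) /\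
  bd (fun i => rsum (fun j => p (i, j))) B.
Proof.
move=> p0 pB.
have rB i : bd (fun j => p (i, j)) B.
  by apply: (bd_inj (f := fun j => (i, j))) => // x y [].
split=> [i|A]; first exact: rsum_bd (rB i).
apply/ler_addgt0Pr => e e0.
(* The slack [e] is shared equally among the rows of [A]; the successor keeps the quotient
   meaningful when [A] is empty. *)
have [a ha] : exists a, a = e / (#|` A|.+1)%:R by eexists.
have a0 : 0 < a by rewrite ha divr_gt0.
have hD i : exists D : {fset J}, rsum (fun j => p (i, j)) <= \sum_(j <- D) p (i, j) + a.
  have [D hD] := rsum_cvg (p := fun j => p (i, j)) (fun j => p0 _) (rB i) a0.
  by exists D; have := hD _ (fsubset_refl D); rewrite ltr_norml; lra.
have [D hD'] := choice hD.
apply: (@le_trans _ _ (\sum_(i <- A) (\sum_(j <- D i) p (i, j) + a))).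
  exact: ler_sum.
rewrite big_split /=; apply: lerD.
  have := pair_big_dep_cond +%R A D xpredT (fun _ => xpredT) (fun i j => p (i, j)).
  by move=> /= ->; rewrite (eq_bigr p) //; case.
rewrite big_const_seq count_predT iter_addr_0 -[a *+ _]mulr_natr ha.
rewrite mulrAC ler_pdivrMr // ler_pM2l // ler_nat; exact: leqnSn.
Qed.

End Bounded.

(** * Absolutely summable families of scalars *)

Section Sums.
Variables (R : realType) (K : numFieldType) (S : rcs R K).
Local Notation rcr := (rcr S).
Local Notation nrm := (nrm S).
Implicit Types (I J : choiceType).
#[local] Existing Instance totally_filter.

Lemma is_sumP I (a : I -> K) s : is_sum a s <->
  forall e : R, 0 < e -> exists A : {fset I}, forall D : {fset I},
    (A `<=` D)%fset -> nrm (s - \sum_(i <- D) a i) < e.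
Proof.
rewrite /is_sum; split.
  move=> /cvgrPdist_lt h e e0.
  have [|A _ hA] := h (rcr e); first by rewrite rcr_gt0.
  exists A => D AD; rewrite -(rcr_lt S) -nrm_def; have := hA D AD.
  by rewrite /= /partial_sum -(big_seq_fsetE _ _ xpredT).
move=> h; apply/cvgrPdist_lt => e e0.
have [|A hA] := h (nrm e); first by rewrite -(rcr_gt0 S) -pos_rcr.
exists A => // D AD; rewrite /= /partial_sum -(big_seq_fsetE _ _ xpredT).
by rewrite (pos_rcr S e0) (nrm_def S) rcr_lt; exact: hA.
Qed.

Lemma is_sum_uniq I (a : I -> K) s t : is_sum a s -> is_sum a t -> s = t.
Proof.
move=> /is_sumP hs /is_sumP ht; apply/eqP; rewrite -subr_eq0 -(nrm_eq0 S).
rewrite eq_le nrm_ge0 andbT; apply/ler_addgt0Pr => e e0; rewrite add0r.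
have e20 : 0 < e / 2 by lra.
have [A hA] := hs _ e20; have [B hB] := ht _ e20.
have := hA _ (fsubsetUl A B); have := hB _ (fsubsetUr A B).
set c := \sum_(i <- _) _ => h1 h2.
have -> : s - t = (s - c) - (t - c) by ring.
by apply: le_trans (nrmB _ _ _) _; lra.
Qed.

Lemma is_sumE I (a : I -> K) s : is_sum a s -> sum_of a = s.
Proof.
move=> h; apply: is_sum_uniq (h); rewrite /is_sum /sum_of /sum.
exact: (cvgP (s : K^o) h).
Qed.

Lemma is_sum_ext I (a b : I -> K) s : a =1 b -> is_sum a s -> is_sum b s.
Proof. by move=> /funext ->. Qed.

Lemma sum_of_ext I (a b : I -> K) : a =1 b -> sum_of a = sum_of b.
Proof. by move=> /funext ->. Qed.

Lemma is_sumD I (a b : I -> K) s t :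
  is_sum a s -> is_sum b t -> is_sum (fun i => a i + b i) (s + t).
Proof.
move=> /is_sumP hs /is_sumP ht; apply/is_sumP => e e0.
have e20 : 0 < e / 2 by lra.
have [A hA] := hs _ e20; have [B hB] := ht _ e20.
exists (A `|` B)%fset => D; rewrite fsubUset => /andP[/hA h1 /hB h2].
rewrite big_split /= opprD addrACA; apply: le_lt_trans (nrmD _ _ _) _; lra.
Qed.

Lemma is_sumZ I (a : I -> K) s c : is_sum a s -> is_sum (fun i => c * a i) (c * s).
Proof.
move=> /is_sumP hs; apply/is_sumP => e e0.
have c0 := nrm_ge0 S c.
have [|A hA] := hs (e / (nrm c + 1)); first by rewrite divr_gt0 //; lra.
exists A => D /hA h; rewrite -mulr_sumr -mulrBr nrmM.
apply: (@le_lt_trans _ _ ((nrm c + 1) * nrm (s - \sum_(i <- D) a i))).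
  by rewrite ler_wpM2r ?nrm_ge0 //; lra.
by rewrite mulrC -ltr_pdivlMr //; lra.
Qed.

Lemma is_sum_fin I (a : I -> K) (A : {fset I}) :
  (forall i, i \notin A -> a i = 0) -> is_sum a (\sum_(i <- A) a i).
Proof.
move=> h; apply/is_sumP => e e0; exists A => D AD.
rewrite (big_fset_incl _ AD) ?subrr ?nrm0 // => x _; exact: h.
Qed.

Lemma is_sum_single I (a : I -> K) i0 : (forall i, i != i0 -> a i = 0) -> is_sum a (a i0).
Proof.
move=> h; have := @is_sum_fin I a [fset i0]%fset; rewrite big_seq_fset1; apply.
by move=> i; rewrite inE; exact: h.
Qed.

Lemma sum_of_single I (a : I -> K) i0 : (forall i, i != i0 -> a i = 0) -> sum_of a = a i0.
Proof. by move=> /is_sum_single /is_sumE. Qed.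

Lemma is_sum0 I : is_sum (fun _ : I => 0 : K) 0.
Proof.
by have := @is_sum_fin I (fun=> 0) fset0 (fun _ _ => erefl); rewrite big_seq_fset0.
Qed.

Lemma is_sum_nrm I (a : I -> K) s B :
  is_sum a s -> bd (fun i => nrm (a i)) B -> nrm s <= B.
Proof.
move=> /is_sumP h aB; apply/ler_addgt0Pr => e e0.
have [A hA] := h _ e0; have := hA _ (fsubset_refl A).
set c := \sum_(i <- _) _ => h1.
have : nrm c <= B by apply: le_trans (nrm_sum _ _ _ _) _; exact: aB.
have -> : s = (s - c) + c by ring.
by move=> h2; apply: le_trans (nrmD _ _ _) _; lra.
Qed.

(** [b] is the difference of the nonnegative families [|b| + b] and [|b|], whose sums are
    suprema. *)
Lemma real_sum I (b : I -> R) B : bd (fun i => `|b i|) B -> exists s, 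
  forall e : R, 0 < e -> exists A : {fset I}, forall D : {fset I},
    (A `<=` D)%fset -> `|s - \sum_(i <- D) b i| < e.
Proof.
move=> bB.
have b2 : bd (fun i => `|b i| + b i) (2 * B).
  apply: (bd_le (q := fun i => 2 * `|b i|) _ (bdZ _ bB) (lexx _)) => // i.
  by have := ler_norm (b i); lra.
have p2 i : 0 <= `|b i| + b i by have := ler_norm (- b i); rewrite normrN; lra.
exists (rsum (fun i => `|b i| + b i) - rsum (fun i => `|b i|)) => e e0.
have e20 : 0 < e / 2 by lra.
have [A hA] := rsum_cvg p2 b2 e20.
have [C hC] := rsum_cvg (fun i => normr_ge0 (b i)) bB e20.
exists (A `|` C)%fset => D; rewrite fsubUset => /andP[/hA h1 /hC h2].
move: h1 h2; rewrite big_split /=.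
set x := rsum _; set y := rsum _; set u := \sum_(i <- D) _; set v := \sum_(i <- D) _.
rewrite !ltr_norml => h1 h2; apply/andP; split; lra.
Qed.

Definition summ I (a : I -> K) := exists B, bd (fun i => nrm (a i)) B.

Lemma summ_ext I (a b : I -> K) : a =1 b -> summ a -> summ b.
Proof. by move=> /funext ->. Qed.

(** [sum_of] is the limit as soon as one exists; the sums of the real and imaginary parts supply
    one. *)
Lemma summ_is_sum I (a : I -> K) : summ a -> is_sum a (sum_of a).
Proof.
move=> [B aB].
suff [s hs] : exists s, is_sum a s by rewrite (is_sumE hs).
have [s hs] : exists s, forall e : R, 0 < e -> exists A : {fset I}, forall D : {fset I},
    (A `<=` D)%fset -> `|s - \sum_(i <- D) re S (a i)| < e.
  by apply: real_sum; apply: bd_le aB (lexx _) => i; exact: re_nrm.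
have [t ht] : exists s, forall e : R, 0 < e -> exists A : {fset I}, forall D : {fset I},
    (A `<=` D)%fset -> `|s - \sum_(i <- D) im S (a i)| < e.
  by apply: real_sum; apply: bd_le aB (lexx _) => i; exact: im_nrm.
exists (rcr s + rcr t * unit_im S); apply/is_sumP => e e0.
have e20 : 0 < e / 2 by lra.
have [A hA] := hs _ e20; have [C hC] := ht _ e20.
exists (A `|` C)%fset => D; rewrite fsubUset => /andP[/hA h1 /hC h2].
rewrite [X in _ - X](reim S) re_sum im_sum opprD addrACA -rcrB -mulrBl -rcrB.
apply: le_lt_trans (nrmD _ _ _) _; rewrite nrmM !nrm_rcr.
have := ler_piMr (normr_ge0 (t - \sum_(i <- D) im S (a i))) (nrm_unit_im S).
lra.
Qed.

Lemma summ_has_sum I (a : I -> K) : summ a -> has_sum a.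
Proof. by move=> /summ_is_sum; exists (sum_of a). Qed.

Lemma has_sum_bd I (a : I -> K) : (forall i, 0 <= a i) -> has_sum a -> summ a.
Proof.
move=> a0 [s /is_sumP hs]; have [A hA] := hs _ ltr01.
exists (nrm s + 1) => D.
have E (C : {fset I}) : \sum_(i <- C) nrm (a i) = nrm (\sum_(i <- C) a i).
  apply: (@rcr_inj _ _ S); rewrite rcr_sum -nrm_def ger0_norm ?sumr_ge0 //.
  by apply: eq_bigr => i _; rewrite -nrm_def ger0_norm.
apply: le_trans (sum_fset_sub _ (fsubsetUr A D)) _; first by move=> i; exact: nrm_ge0.
rewrite E.
have := hA _ (fsubsetUl A D); set c := \sum_(i <- _) _ => h.
have -> : c = s - (s - c) by ring.
by apply: le_trans (nrmB _ _ _) _; lra.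
Qed.

End Sums.

(** * Fubini's theorem and reindexing of sums *)

Section Fubini.
Variables (R : realType) (K : numFieldType) (S : rcs R K).
Local Notation nrm := (nrm S).
Local Notation summ := (summ S).
Implicit Types (I J : choiceType).

(** Each row is truncated to a finite set good up to [d] which also contains the second coordinates
    of a set [C1] good for the double sum; the truncated rows together then contain [C1]. *)
Lemma is_sum_rows I J (a : I -> J -> K) (s : I -> K) T :
  (forall i, is_sum (a i) (s i)) -> is_sum (fun x => a x.1 x.2) T -> is_sum s T.
Proof.
move=> hs /(is_sumP S) hT; apply/(is_sumP S) => e e0.
have e20 : 0 < e / 2 by lra.
have [C1 hC1] := hT _ e20.
exists [fset x.1 | x in C1]%fset => D CD.
have [d hd] : exists d, d = e / 2 / (#|` D|.+1)%:R by eexists.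
have d0 : 0 < d by rewrite hd divr_gt0.
have [C2 hC2] := choice (fun i => (is_sumP S _ _).1 (hs i) d d0).
pose F i := (C2 i `|` [fset x.2 | x in C1])%fset.
have h : nrm (T - \sum_(i <- D) \sum_(j <- F i) a i j) < e / 2.
  rewrite (pair_big_dep_cond +%R D F xpredT (fun _ => xpredT) a) /=.
  apply: hC1; apply/fsubsetP => -[x y] xy; apply: in_imfset2; rewrite /= !inE andbT.
    by apply: (fsubsetP CD); apply/imfsetP; exists (x, y).
  by apply/orP; right; apply/imfsetP; exists (x, y).
have -> : T - \sum_(i <- D) s i = (T - \sum_(i <- D) \sum_(j <- F i) a i j)
    - \sum_(i <- D) (s i - \sum_(j <- F i) a i j).
  by rewrite sumrB; ring.
apply: le_lt_trans (nrmB _ _ _) _.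
suff : nrm (\sum_(i <- D) (s i - \sum_(j <- F i) a i j)) <= e / 2 by lra.
apply: le_trans (nrm_sum _ _ _ _) _.
apply: (@le_trans _ _ (\sum_(i <- D) d)).
  apply: ler_sum => i _; apply: ltW; apply: hC2; exact: fsubsetUl.
rewrite big_const_seq count_predT iter_addr_0 -[d *+ _]mulr_natr hd.
by rewrite mulrAC ler_pdivrMr // ler_pM2l // ler_nat leqnSn.
Qed.

Lemma is_sum_bij I J (f : J -> I) (g : I -> J) (a : I -> K) s :
  cancel f g -> cancel g f -> is_sum a s -> is_sum (fun j => a (f j)) s.
Proof.
move=> fg gf /(is_sumP S) hs; apply/(is_sumP S) => e e0.
have [A hA] := hs _ e0; exists (g @` A)%fset => D AD.
have := hA (f @` D)%fset; rewrite big_imfset /=; last first.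
  by move=> x y _ _; exact: (can_inj fg).
apply; apply/fsubsetP => x xA; apply/imfsetP; exists (g x); last by rewrite gf.
by apply: (fsubsetP AD); rewrite /= in_imfset.
Qed.

Lemma summD I (a b : I -> K) : summ a -> summ b -> summ (fun i => a i + b i).
Proof.
move=> [B aB] [C bC]; exists (B + C).
by apply: bd_le (bdD aB bC) (lexx _) => i; exact: nrmD.
Qed.

Lemma summZ I (a : I -> K) c : summ a -> summ (fun i => c * a i).
Proof.
move=> [B aB]; exists (nrm c * B).
by apply: bd_le (bdZ (nrm_ge0 S c) aB) (lexx _) => i; rewrite nrmM.
Qed.

Lemma summN I (a : I -> K) : summ a -> summ (fun i => - a i).
Proof. by move=> [B aB]; exists B; apply: bd_le aB (lexx _) => i; rewrite nrmN. Qed.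

Lemma sum_ofD I (a b : I -> K) : summ a -> summ b ->
  sum_of (fun i => a i + b i) = sum_of a + sum_of b.
Proof. by move=> ha hb; apply: (is_sumE S); apply: (is_sumD S); exact: (@summ_is_sum _ _ S). Qed.

Lemma sum_ofZ I (a : I -> K) c : summ a -> sum_of (fun i => c * a i) = c * sum_of a.
Proof. by move=> ha; apply: (is_sumE S); apply: (is_sumZ S); exact: (@summ_is_sum _ _ S). Qed.

Lemma sum_ofN I (a : I -> K) : summ a -> sum_of (fun i => - a i) = - sum_of a.
Proof.
move=> ha; rewrite -mulN1r -sum_ofZ //; apply: sum_of_ext => i.
by rewrite mulN1r.
Qed.

Lemma sum_ofB I (a b : I -> K) : summ a -> summ b ->
  sum_of (fun i => a i - b i) = sum_of a - sum_of b.
Proof. by move=> ha hb; rewrite sum_ofD ?sum_ofN //; exact: summN. Qed.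

Lemma sum_of_sum I (T : finType) (P : pred T) (a : T -> I -> K) :
  (forall t, summ (a t)) ->
  summ (fun i => \sum_(t | P t) a t i) /\
  sum_of (fun i => \sum_(t | P t) a t i) = \sum_(t | P t) sum_of (a t).
Proof.
move=> ha; rewrite -!(big_filter _ P).
have -> : (fun i => \sum_(t | P t) a t i)
   = (fun i => \sum_(t <- [seq t <- index_enum T | P t]) a t i).
  by apply/funext => i; rewrite big_filter.
elim: [seq _ <- _ | _] => [|t l [IH1 IH2]].
  split; last first.
    rewrite big_nil -[RHS](is_sumE S (is_sum0 S I)); apply: sum_of_ext => i.
    by rewrite big_nil.
  exists 0 => A; rewrite big1 // => i _; by rewrite big_nil nrm0.
have E : (fun i => \sum_(t <- t :: l) a t i) = (fun i => a t i + \sum_(t <- l) a t i).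
  by apply/funext => i; rewrite big_cons.
rewrite E; split; first exact: summD.
by rewrite sum_ofD // IH2 big_cons.
Qed.

Lemma sum_of_nrm I (a : I -> K) B : bd (fun i => nrm (a i)) B -> nrm (sum_of a) <= B.
Proof. by move=> aB; apply: is_sum_nrm (aB); apply: summ_is_sum; exists B. Qed.

Lemma summ_le I (a : I -> K) (p : I -> R) B :
  (forall i, nrm (a i) <= p i) -> bd p B -> summ a.
Proof. by move=> h pB; exists B; apply: bd_le pB (lexx _). Qed.

Variant fubini_spec I J (a : I -> J -> K) : Prop := FubiniSpec of
  summ (fun x => a x.1 x.2) & (forall i, summ (a i)) & (forall j, summ (a^~ j))
  & summ (fun i => sum_of (a i)) & summ (fun j => sum_of (a^~ j))
  & sum_of (fun i => sum_of (a i)) = sum_of (fun x => a x.1 x.2)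
  & sum_of (fun j => sum_of (a^~ j)) = sum_of (fun x => a x.1 x.2).

Lemma fubini_pair I J (a : I -> J -> K) : summ (fun x => a x.1 x.2) -> fubini_spec a.
Proof.
move=> sa; have [B aB] := sa.
have n0 := nrm_ge0 S.
have [r1 r2] := bd_row (p := fun x => nrm (a x.1 x.2)) (fun x => n0 _) aB.
have aB' : bd (fun x : J * I => nrm (a x.2 x.1)) B.
  by apply: (bd_inj (f := fun x : J * I => (x.2, x.1)) _ aB) => -[x y] [z t] [-> ->].
have [c1 c2] := bd_row (p := fun x : J * I => nrm (a x.2 x.1)) (fun x => n0 _) aB'.
have h1 i : summ (a i) by eexists; exact: r1.
have h2 j : summ (a^~ j) by eexists; exact: c1.
have h3 : summ (fun i => sum_of (a i)).
  by apply: summ_le r2 => i; apply: sum_of_nrm; exact: r1.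
have h4 : summ (fun j => sum_of (a^~ j)).
  by apply: summ_le c2 => i; apply: sum_of_nrm; exact: c1.
split => //.
  apply: (is_sumE S); apply: (is_sum_rows (a := a)); last exact: (summ_is_sum sa).
  by move=> i; exact: summ_is_sum.
apply: (is_sumE S); apply: (is_sum_rows (a := fun j i => a i j)).
  by move=> j; exact: summ_is_sum.
apply: (@is_sum_bij _ _ (fun x : J * I => (x.2, x.1)) (fun x => (x.2, x.1))
   (fun x => a x.1 x.2)) => [[]//|[]//|].
exact: (summ_is_sum sa).
Qed.

Lemma fubini I J (a : I -> J -> K) (P : I -> R) B :
  (forall i, bd (fun j => nrm (a i j)) (P i)) -> bd P B -> fubini_spec a.
Proof.
move=> h PB; apply: fubini_pair; exists B.
by apply: (bd_pair (p := fun i j => nrm (a i j)) _ h PB) => i j; exact: nrm_ge0.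
Qed.

(** Fubini for the array whose row [i] has the single entry [a i], in column [phi i]. *)
Lemma is_sum_fib I J (phi : I -> J) (a : I -> K) : summ a ->
  summ (fun j => sum_of (fun i => if phi i == j then a i else 0)) /\
  sum_of (fun j => sum_of (fun i => if phi i == j then a i else 0)) = sum_of a.
Proof.
move=> [B aB].
have [] := @fubini I J (fun i j => if phi i == j then a i else 0) (fun i => nrm (a i)) B _ aB.
  move=> i; apply: (bd_single (i0 := phi i)); rewrite ?eqxx ?nrm_ge0 //.
  by move=> j; rewrite eq_sym => /negbTE ->; rewrite nrm0.
move=> _ _ _ _ h1 h2 h3; split=> //; rewrite h3 -h2; apply: sum_of_ext => i.
rewrite (sum_of_single S (i0 := phi i)) ?eqxx // => j.
by rewrite eq_sym => /negbTE ->.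
Qed.

Lemma sum_of_inj I J (f : J -> I) (a : I -> K) : injective f ->
  (forall i, (forall j, f j != i) -> a i = 0) -> summ a ->
  summ (fun j => a (f j)) /\ sum_of (fun j => a (f j)) = sum_of a.
Proof.
move=> fi h0 [B aB].
have saf : bd (fun j => nrm (a (f j))) B by apply: (bd_inj fi aB).
have sf : summ (fun j => a (f j)) by exists B.
split=> //; have [_ <-] := is_sum_fib f sf; apply: sum_of_ext => i.
have [[j <-]|nj] := pselect (exists j, f j = i).
  rewrite (sum_of_single S (i0 := j)) ?eqxx // => j' jj'.
  by rewrite (inj_eq fi) (negbTE jj').
have fj j : f j != i by apply/eqP => e; apply: nj; exists j.
rewrite (h0 _ fj); apply: (is_sumE S); apply: (is_sum_ext _ (is_sum0 S _)) => j.
by rewrite (negbTE (fj j)).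
Qed.

Lemma sum_of_bij I J (f : J -> I) (g : I -> J) (a : I -> K) :
  cancel f g -> cancel g f -> summ a ->
  summ (fun j => a (f j)) /\ sum_of (fun j => a (f j)) = sum_of a.
Proof.
move=> fg gf; apply: sum_of_inj; first exact: can_inj fg.
by move=> i /(_ (g i)); rewrite gf eqxx.
Qed.

Lemma summ_prod I J (a : I -> K) (b : J -> K) A B :
  bd (fun i => nrm (a i)) A -> bd (fun j => nrm (b j)) B ->
  bd (fun x : I * J => nrm (a x.1 * b x.2)) (A * B) /\
  sum_of (fun x : I * J => a x.1 * b x.2) = sum_of a * sum_of b.
Proof.
move=> aA bB; have B0 := bd_ge0 bB.
have h i : bd (fun j => nrm (a i * b j)) (nrm (a i) * B).
  by apply: bd_le (bdZ (nrm_ge0 S _) bB) (lexx _) => j; rewrite nrmM.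
have hP : bd (fun i => nrm (a i) * B) (A * B).
  rewrite mulrC; apply: bd_le (bdZ B0 aA) (lexx _) => i; by rewrite mulrC.
split.
  by apply: (bd_pair (p := fun i j => nrm (a i * b j)) _ h hP) => i j; exact: nrm_ge0.
case: (fubini h hP) => _ _ _ _ _ <- _; rewrite mulrC -sum_ofZ; last by exists A.
apply: sum_of_ext => i; rewrite mulrC -sum_ofZ //; by exists B.
Qed.

End Fubini.

(** * Differentiation in several variables *)

Section Norm.
Variables (R : realType) (K : numFieldType) (S : rcs R K) (k : nat).
Local Notation rcr := (rcr S).
Local Notation nrm := (nrm S).
Implicit Types (x v : 'rV[K]_k).

Definition nv (v : 'rV[K]_k) : R := nrm `|v|.

Lemma nv_def v : `|v| = rcr (nv v).
Proof. by rewrite -nrm_def normr_id. Qed.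

Lemma nv0 : nv 0 = 0. Proof. by rewrite /nv normr0 nrm0. Qed.
Lemma nv_ge0 v : 0 <= nv v. Proof. exact: nrm_ge0. Qed.

Lemma ball_nv x y (d : R) : ball x (rcr d) y <-> nv (x - y) < d.
Proof. by rewrite mx_norm_ball /ball_ /= nv_def rcr_lt. Qed.

Lemma nv_ltP v d : 0 < d -> nv v < d <-> forall u, nrm (v 0 u) < d.
Proof.
move=> d0; rewrite -[v in nv v]subr0 -ball_nv.
rewrite /ball /= /mx_ball; split.
  move=> [_ h] u; have := h 0 u; rewrite -ball_normE /ball_ /= !mxE subr0.
  by rewrite (nrm_def S) rcr_lt.
move=> h; split; first by rewrite rcr_gt0.
move=> i u; rewrite -ball_normE /ball_ /= !mxE subr0 (nrm_def S) rcr_lt ord1; exact: h.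
Qed.

Lemma nv_coord v u : nrm (v 0 u) <= nv v.
Proof.
apply/ler_addgt0Pr => e e0; apply/ltW; apply: (nv_ltP _ _).1; last by rewrite ltrDl.
by rewrite ltr_pwDr ?nv_ge0.
Qed.

Lemma nv_le v d : 0 <= d -> (forall u, nrm (v 0 u) <= d) -> nv v <= d.
Proof.
move=> d0 h; apply/ler_addgt0Pr => e e0; apply/ltW/nv_ltP => [|u].
  by rewrite ltr_pwDr.
by rewrite ltr_pwDr.
Qed.

Lemma nvZ a v : nv (a *: v) = nrm a * nv v.
Proof. apply: (@rcr_inj _ _ S); rewrite rcr_mul -nv_def -nrm_def normrZ nv_def //. Qed.

Lemma nvN v : nv (- v) = nv v.
Proof. by rewrite /nv normrN. Qed.

Lemma nvD v w : nv (v + w) <= nv v + nv w.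
Proof. by rewrite -(rcr_le S) rcr_add -!nv_def ler_normD. Qed.

Lemma near_nv (x : 'rV[K]_k) (P : 'rV[K]_k -> Prop) :
  (\forall y \near x, P y) <-> exists2 d : R, 0 < d & forall y, nv (y - x) < d -> P y.
Proof.
split.
  move=> /nbhs_ballP [d /= d0 h]; exists (nrm d); first by rewrite -(rcr_gt0 S) -pos_rcr.
  by move=> y hy; apply: h; rewrite (pos_rcr S d0) ball_nv -nvN opprB.
move=> [d d0 h]; apply/nbhs_ballP; exists (rcr d) => /=; first by rewrite rcr_gt0.
by move=> y /ball_nv; rewrite -nvN opprB; exact: h.
Qed.

Definition lin_form (l : 'I_k -> K) (v : 'rV[K]_k) : K^o := \sum_u l u * v 0 u.

Lemma lin_form_linear l : linear (lin_form l).
Proof.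
move=> a v w; rewrite /lin_form scaler_sumr -big_split; apply: eq_bigr => u _ /=.
by rewrite !mxE mulrDr; congr (_ + _); rewrite mulrCA.
Qed.
HB.instance Definition _ l := GRing.isLinear.Build K 'rV[K]_k K^o _ (lin_form l)
  (lin_form_linear l).

Lemma lin_formZ l a v : lin_form l (a *: v) = a * lin_form l v.
Proof. by rewrite linearZ. Qed.

Lemma lin_form_le l M v : (forall u, nrm (l u) <= M) ->
  nrm (lin_form l v) <= k%:R * M * nv v.
Proof.
move=> h; apply: le_trans (nrm_sum _ _ _ _) _.
apply: (@le_trans _ _ (\sum_(u < k) M * nv v)).
  by apply: ler_sum => u _; rewrite nrmM ler_pM ?nrm_ge0 ?nv_coord.
by rewrite sumr_const card_ord -[X in X <= _]mulr_natl mulrA.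
Qed.

Lemma lin_form_continuous l : continuous (lin_form l).
Proof.
move=> v; apply/(@cvgrPdist_lt _ K^o _ (nbhs v)) => e e0.
pose M := \sum_u nrm (l u).
have M0 : 0 <= M by apply: sumr_ge0 => u _; exact: nrm_ge0.
have hM u : nrm (l u) <= M.
  by rewrite /M (bigD1 u) //= lerDl sumr_ge0 // => w _; exact: nrm_ge0.
have C0 : 0 <= k%:R * M by rewrite mulr_ge0.
apply/near_nv; exists (nrm e / (k%:R * M + 1)).
  by rewrite divr_gt0 ?nrm_gt0 ?gt_eqF // ltr_pwDr.
move=> w hw; rewrite -linearB (nrm_def S) [ltRHS](pos_rcr S e0) rcr_lt.
apply: le_lt_trans (lin_form_le _ hM) _; rewrite -nvN opprB.
apply: (@le_lt_trans _ _ ((k%:R * M + 1) * nv (w - v))).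
  by rewrite ler_wpM2r ?nv_ge0 // lerDl.
by rewrite mulrC -ltr_pdivlMr // ltr_pwDr.
Qed.

(** Fréchet differentiability with real radii and errors, which spares the estimates the partial
    order of [K]. *)
Definition isdiff (g : 'rV[K]_k -> K) x (l : 'I_k -> K) :=
  forall e : R, 0 < e -> exists2 d : R, 0 < d & forall h, nv h < d ->
    nrm (g (x + h) - g x - lin_form l h) <= e * nv h.

Lemma lin_form_unit l u : lin_form l (unit_tuple K u) = l u.
Proof.
rewrite /lin_form (bigD1 u) //= big1 => [|w wu]; rewrite !mxE ?eqxx ?mulr1 ?addr0 //.
by rewrite (negbTE wu) andbF mulr0.
Qed.

Lemma isdiffP g x l : isdiff g x l ->
  differentiable (g : 'rV[K]_k -> K^o) x /\ (forall u, pderiv u g x = l u).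
Proof.
move=> h.
have E : (g : 'rV[K]_k -> K^o) \o shift x = cst (g x) + (lin_form l : 'rV[K]_k -> K^o) +o_ (0 : 'rV[K]_k) id.
  apply/(@eqaddoP K _ K^o 'rV[K]_k) => e e0; apply/near_nv.
  have [|d d0 hd] := h (nrm e); first by rewrite -(rcr_gt0 S) -pos_rcr.
  exists d => // v; rewrite subr0 => /hd; rewrite -(rcr_le S) rcr_mul -nv_def.
  rewrite -(pos_rcr S e0) -nrm_def /= => H.
  rewrite [X in `|X|](_ : _ = g (x + v) - g x - lin_form l v) //.
  by rewrite /= !fctE opprD addrA [v + x]addrC.
have D := diff_unique (@lin_form_continuous l) E.
have dg : differentiable (g : 'rV[K]_k -> K^o) x.
  apply/diff_locallyP; rewrite D; split=> //; exact: lin_form_continuous.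
split=> // u; rewrite /pderiv deriveE // -lin_form_unit.
exact: (congr1 (fun F => F (unit_tuple K u)) D).
Qed.

Lemma differentiable_isdiff g x : differentiable (g : 'rV[K]_k -> K^o) x ->
  isdiff g x (fun u => pderiv u g x).
Proof.
move=> dg; have h := (@eqaddoP K _ K^o 'rV[K]_k _ _ _ _).1 (diff_locally dg).
have D v : 'd (g : 'rV[K]_k -> K^o) x v = lin_form (fun u => pderiv u g x) v.
  rewrite [v in LHS]row_sum_delta linear_sum; apply: eq_bigr => u _.
  rewrite linearZ /= /pderiv deriveE // /unit_tuple; exact: mulrC.
move=> e e0; have e0' : 0 < rcr e by rewrite rcr_gt0.
have /near_nv [d d0 hd] := h _ e0'.
exists d => // v hv; have := hd v; rewrite subr0 => /(_ hv).
rewrite nv_def -rcr_mul (nrm_def S) rcr_le; congr (nrm _ <= _).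
by rewrite /= !fctE opprD addrA [v + x]addrC -D.
Qed.

End Norm.

(** * Mean value inequality and termwise differentiation *)

Section MeanValue.
Variables (R : realType) (K : numFieldType) (S : rcs R K) (k : nat).
Local Notation rcr := (rcr S).
Local Notation nrm := (nrm S).
Local Notation nv := (@nv R K S k).
Local Notation summ := (summ S).

(** Complex-valued functions have no mean value theorem, so it is applied to [phi \o g] along the
    segment; [phi] is real-linear and bounded by the modulus, and will be the real or the imaginary
    part. *)
Lemma mvt_real_part (phi : K -> R) (g : 'rV[K]_k -> K) (x h : 'rV[K]_k) M :
  (forall a b, phi (a + b) = phi a + phi b) ->
  (forall r a, phi (rcr r * a) = r * phi a) ->
  (forall a, `|phi a| <= nrm a) ->
  (forall t : R, 0 <= t <= 1 ->
    differentiable (g : 'rV[K]_k -> K^o) (x + rcr t *: h) /\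
    nrm (lin_form (fun u => pderiv u g (x + rcr t *: h)) h) <= M) ->
  `|phi (g (x + h) - g x)| <= M.
Proof.
move=> phiD phiZ phin H.
pose p t := x + rcr t *: h.
pose G t := phi (g (p t)).
pose G' t := phi (lin_form (fun u => pderiv u g (p t)) h).
have phi0 : phi 0 = 0 by apply: (addIr (phi 0)); rewrite -phiD !add0r.
have phiN a : phi (- a) = - phi a.
  by apply: (addIr (phi a)); rewrite -phiD !addNr phi0.
have dG (t : R) : 0 <= t <= 1 -> is_derive t (1 : R) G (G' t).
  move=> /H [/(differentiable_isdiff S) dg _].
  have c : (fun s => s^-1 *: ((G \o shift t) (s *: (1 : R)) - G t)) @ 0^' --> G' t.
    apply/cvgrPdist_le => e e0.
    have n0 : 0 < nv h + 1 by rewrite ltr_pwDr ?nv_ge0.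
    have [|d d0 hd] := dg (e / (nv h + 1)); first by rewrite divr_gt0.
    near=> s.
    have s0 : s != 0 by near: s; exact: nbhs_dnbhs_neq.
    have sd : `|s| < d / (nv h + 1) by near: s; apply: dnbhs0_lt; rewrite divr_gt0.
    change (`|G' t - s^-1 * (G (s * 1 + t) - G t)| <= e).
    rewrite mulr1 /G /G' [p (s + t)]/p.
    have -> : x + rcr (s + t) *: h = p t + rcr s *: h.
      by rewrite /p rcr_add scalerDl addrA addrAC.
    have /hd : nv (rcr s *: h) < d.
      rewrite nvZ nrm_rcr; move: sd; rewrite ltr_pdivlMr //; apply: le_lt_trans.
      by rewrite ler_wpM2l // lerDl.
    rewrite -/(p t); set L := lin_form _ => hL.
    have LE : L (rcr s *: h) = rcr s * L h by exact: lin_formZ.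
    rewrite LE nvZ nrm_rcr in hL.
    have -> : phi (L h) - s^-1 * (phi (g (p t + rcr s *: h)) - phi (g (p t))) =
        - s^-1 * phi (g (p t + rcr s *: h) - g (p t) - rcr s * L h).
      by rewrite !phiD !phiN phiZ; field.
    rewrite normrM normrN normfV ler_pdivrMl ?normr_gt0 //.
    apply: le_trans (phin _) _; apply: le_trans hL _.
    rewrite mulrCA ler_wpM2l // mulrAC ler_pdivrMr // ler_wpM2l ?(ltW e0) //.
    by rewrite lerDl.
  by split; [exact: (cvgP (G' t) c)|exact: (cvg_lim _ c)].
have [||c hc] := @MVT_segment R G G' 0 1 ler01.
- by move=> t; rewrite in_itv /= => /andP[t0 t1]; apply: dG; rewrite !ltW.
- apply: derivable_within_continuous => t; rewrite in_itv /= => /dG h1.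
  exact: ex_derive.
move: hc; rewrite in_itv /= => /H [_ hc].
rewrite subr0 mulr1 /G /p rcr0 rcr_one scale0r scale1r addr0.
rewrite phiD phiN => ->; exact: le_trans (phin _) hc.
Unshelve. all: by end_near.
Qed.

(* The factor 2 comes from treating real and imaginary parts separately. *)
Lemma mean_value (g : 'rV[K]_k -> K) (x h : 'rV[K]_k) M :
  (forall t : R, 0 <= t <= 1 ->
    differentiable (g : 'rV[K]_k -> K^o) (x + rcr t *: h) /\
    nrm (lin_form (fun u => pderiv u g (x + rcr t *: h)) h) <= M) ->
  nrm (g (x + h) - g x) <= 2 * M.
Proof.
move=> H; apply: le_trans (nrm_reim S _) _.
have := mvt_real_part (re_add S) (re_scale S) (re_nrm S) H.
have := mvt_real_part (im_add S) (im_scale S) (im_nrm S) H.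
lra.
Qed.

Lemma min_pos (I : eqType) (s : seq I) (f : I -> R) : (forall i, 0 < f i) ->
  exists2 d : R, 0 < d & forall i, i \in s -> d <= f i.
Proof.
move=> f0; elim: s => [|j s [d d0 hd]]; first by exists 1.
exists (Num.min d (f j)); first by rewrite lt_min d0 f0.
move=> i; rewrite inE => /orP[/eqP ->|/hd]; first by rewrite ge_min lexx orbT.
by move=> h; rewrite ge_min h.
Qed.

Lemma seg_ball (x0 x h : 'rV[K]_k) (d t : R) : 0 <= t <= 1 ->
  nv h < d - nv (x - x0) -> nv (x + rcr t *: h - x0) < d.
Proof.
move=> /andP[t0 t1] hd.
rewrite -addrA [_ - x0]addrC addrA; apply: le_lt_trans (nvD _ _ _) _.
rewrite nvZ nrm_rcr ger0_norm //.
have := ler_piMl (nv_ge0 S h) t1; lra.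
Qed.

(** Weierstrass' test for derivatives: finitely many terms are differentiated one by one, and for
    the others the mean value inequality bounds the increment by the majorant [M] of the partial
    derivatives. *)
Lemma termwise_diff (I : choiceType) (g : I -> 'rV[K]_k -> K) (x0 : 'rV[K]_k) d M B :
  bd M B -> (forall i, 0 <= M i) ->
  (forall i (x : 'rV[K]_k), nv (x - x0) < d -> differentiable (g i : 'rV[K]_k -> K^o) x /\
     forall u, nrm (pderiv u (g i) x) <= M i) ->
  (forall x : 'rV[K]_k, nv (x - x0) < d -> summ (g^~ x)) ->
  forall x : 'rV[K]_k, nv (x - x0) < d ->
  isdiff S (fun y => sum_of (g^~ y)) x (fun u => sum_of (fun i => pderiv u (g i) x)).
Proof.
move=> MB M0 hg hs x hx e e0.
have k0 : (0 : R) < k%:R + 1 by rewrite ltr_pwDr.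
(* The remainder of one term is at most [3 * (k + 1) * M i * nv h]: the mean value inequality
   contributes [2 * k], the linear part one more [k]. *)
have e10 : 0 < e / 2 / (3 * (k%:R + 1)) by rewrite !divr_gt0 ?mulr_gt0.
have [A hA] := bd_tail M0 MB e10.
pose l i u := pderiv u (g i) x.
have e20 : 0 < e / 2 / (#|` A|%:R + 1) by rewrite !divr_gt0 // ltr_pwDr.
have hD0 i : exists d, 0 < d /\ forall h, nv h < d ->
    nrm (g i (x + h) - g i x - lin_form (l i) h) <= e / 2 / (#|` A|%:R + 1) * nv h.
  have [d' d'0 hd'] := differentiable_isdiff S (hg i x hx).1 e20.
  by exists d'.
have [D hD'] := choice hD0.
have D0 i : 0 < D i by case: (hD' i).
have hD i := (hD' i).2.
have [d1 d10 hd1] := min_pos A D0.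
have r0 : 0 < d - nv (x - x0) by rewrite subr_gt0.
exists (Num.min d1 (d - nv (x - x0))); first by rewrite lt_min d10.
move=> h; rewrite lt_min => /andP[h1 h2].
pose rr i := g i (x + h) - g i x - lin_form (l i) h.
have nh := nv_ge0 S h.
have rr3 i : nrm (rr i) <= 3 * (k%:R + 1) * M i * nv h.
  have a1 : nrm (lin_form (l i) h) <= k%:R * M i * nv h.
    by apply: lin_form_le => u; exact: (hg i x hx).2.
  have a2 : nrm (g i (x + h) - g i x) <= 2 * (k%:R * M i * nv h).
    apply: mean_value => t ht; have hb := seg_ball ht h2.
    split; first exact: (hg i _ hb).1.
    by apply: lin_form_le => u; exact: (hg i _ hb).2.
  apply: le_trans (nrmB _ _ _) _.
  have := mulr_ge0 (M0 i) nh; lra.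
have bl : bd (fun i => nrm (lin_form (l i) h)) (k%:R * nv h * B).
  have kn : 0 <= k%:R * nv h by rewrite mulr_ge0.
  apply: bd_le (bdZ kn MB) (lexx _) => i.
  by rewrite mulrAC; apply: lin_form_le => u; exact: (hg i x hx).2.
have sl u : summ (fun i => l i u).
  by apply: summ_le MB => i; exact: (hg i x hx).2.
have xh : nv (x + h - x0) < d.
  by have := @seg_ball x0 x h d 1; rewrite rcr_one scale1r; apply=> //; rewrite ler01 lexx.
have sll u : summ (fun i => l i u * h 0 u).
  by have := summZ (h 0 u) (sl u); apply: summ_ext => i; rewrite mulrC.
have -> : sum_of (g^~ (x + h)) - sum_of (g^~ x)
    - lin_form (fun u => sum_of (fun i => pderiv u (g i) x)) h = sum_of rr.
  have -> : lin_form (fun u => sum_of (fun i => pderiv u (g i) x)) h =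
      sum_of (fun i => lin_form (l i) h).
    rewrite /lin_form; have [_ ->] := sum_of_sum xpredT sll.
    apply: eq_bigr => u _; rewrite mulrC -(sum_ofZ _ (sl u)).
    by apply: sum_of_ext => i; rewrite mulrC.
  rewrite -(sum_ofB (hs _ xh) (hs _ hx)) -(@sum_ofB _ _ S) //; last by eexists; exact: bl.
  by apply: summD; [exact: hs|apply: summN; exact: hs].
apply: sum_of_nrm => E.
rewrite (big_fsetID _ (mem A)) /=.
have -> : e * nv h = e / 2 * nv h + e / 2 * nv h by field.
apply: lerD.
  apply: (@le_trans _ _ (\sum_(i <- A) e / 2 / (#|` A|%:R + 1) * nv h)).
    apply: (@le_trans _ _ (\sum_(i <- [fset x0 in E | x0 \in A]%fset)
        e / 2 / (#|` A|%:R + 1) * nv h)).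
      rewrite big_seq [leRHS]big_seq; apply: ler_sum => i; rewrite !inE => /andP[_ iA].
      by apply: hD; apply: lt_le_trans h1 _; exact: hd1.
    apply: sum_fset_sub; first by move=> i; rewrite mulr_ge0 // ltW.
    by apply/fsubsetP => i; rewrite !inE => /andP[].
  rewrite big_const_seq count_predT iter_addr_0 -[_ *+ _]mulr_natr.
  rewrite mulrAC ler_wpM2r // mulrAC ler_pdivrMr ?ltr_pwDr // ler_wpM2l ?lerDl //.
  by rewrite divr_ge0 // ltW.
apply: (@le_trans _ _ (\sum_(i <- [fset x0 in E | x0 \notin A]%fset) 3 * (k%:R + 1) * nv h * M i)).
  by apply: ler_sum => i _; rewrite mulrAC; exact: rr3.
rewrite -mulr_sumr.
have /ltW : \sum_(i <- [fset x0 in E | x0 \notin A]%fset) M i < e / 2 / (3 * (k%:R + 1)).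
  by apply: hA; apply/fdisjointP => i iA; rewrite !inE iA andbF.
rewrite ler_pdivlMr ?mulr_gt0 // => hM.
rewrite mulrAC; apply: ler_wpM2r => //; by rewrite mulrC.
Qed.

End MeanValue.

(** * Power series *)

Section PowerSeries.
Variables (R : realType) (K : numFieldType) (S : rcs R K) (k : nat).
Local Notation nrm := (nrm S).
Local Notation nv := (@nv R K S k).
Implicit Types (m : 'rV[nat]_k) (x : 'rV[K]_k) (N : nat) (g : 'rV[K]_k -> K).

Definition mdeg (m : 'rV[nat]_k) : nat := (\sum_(u < k) m 0%R u)%N.

Lemma mdegD m m' : mdeg (m + m') = (mdeg m + mdeg m')%N.
Proof. by rewrite /mdeg -big_split; apply: eq_bigr => u _; rewrite mxE. Qed.

Lemma mdeg0 : mdeg 0 = 0%N.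
Proof. by rewrite /mdeg big1 // => u _; rewrite mxE. Qed.

Lemma mdeg_eq0 m : mdeg m = 0%N -> m = 0.
Proof.
move=> /eqP; rewrite sum_nat_eq0 => /forallP h; apply/rowP => u.
by rewrite mxE; apply/eqP; have := h u.
Qed.

Lemma mdeg_unit u : mdeg (unit_tuple nat u) = 1%N.
Proof.
rewrite /mdeg (bigD1 u) //= big1 => [|w wu]; rewrite !mxE ?eqxx //.
by rewrite (negbTE wu) andbF.
Qed.

Lemma unit_tupleE (A : pzSemiRingType) n (u w : 'I_n) : unit_tuple A u 0 w = (w == u)%:R.
Proof. by rewrite mxE eqxx. Qed.

Lemma mdeg_pos m : (0 < mdeg m)%N -> exists u, (0 < m 0%R u)%N.
Proof.
move=> m0; apply/existsP; apply: contraTT m0; rewrite negb_exists => /forallP h.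
rewrite -leqNgt leqn0 sum_nat_eq0; apply/forallP => u.
by have := h u; rewrite -leqNgt leqn0.
Qed.

Lemma rV_pos m u : (0 < m 0%R u)%N -> exists m', m = m' + unit_tuple nat u.
Proof.
move=> mu; exists (\row_w (m 0%R w - (w == u)))%N; apply/rowP => w.
rewrite mxE unit_tupleE mxE /=; have [->|wu] := eqVneq w u.
  by rewrite -[RHS]/((_ - 1 + 1)%N) subnK.
by rewrite subn0 addr0.
Qed.

Lemma monomD x m m' : monom x (m + m') = monom x m * monom x m'.
Proof. by rewrite /monom -big_split; apply: eq_bigr => u _; rewrite mxE exprD. Qed.

Lemma monom0 x : monom x 0 = 1.
Proof. by rewrite /monom big1 // => u _; rewrite mxE expr0. Qed.

Lemma monom_unit x u : monom x (unit_tuple nat u) = x 0 u.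
Proof.
rewrite /monom (bigD1 u) //= unit_tupleE eqxx expr1 big1 ?mulr1 // => w wu.
by rewrite unit_tupleE (negbTE wu) expr0.
Qed.

Lemma monom_0 m : m != 0 -> monom (0 : 'rV[K]_k) m = 0.
Proof.
move=> m0; have [|u mu] := @mdeg_pos m.
  by rewrite lt0n; apply: contra_neq m0 => /mdeg_eq0.
have [m' ->] := rV_pos mu.
by rewrite monomD monom_unit mxE mulr0.
Qed.

Lemma nrm_monom x m r : nv x <= r -> nrm (monom x m) <= r ^+ mdeg m.
Proof.
move=> xr; rewrite /monom nrm_prod /mdeg.
rewrite (_ : r ^+ _ = \prod_(u < k) r ^+ m 0 u); last first.
  by rewrite expr_sum.
apply: ler_prod => u _; rewrite nrmX exprn_ge0 ?nrm_ge0 //=.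
by rewrite lerXn2r ?nnegrE ?nrm_ge0 ?(le_trans (nv_coord _ _ _) xr) ?(le_trans (nv_ge0 S x)).
Qed.

(** The difference [b^n - a^n] is [b - a] times a sum of [n] terms, each at least [a^(n-1)]. This
    replaces Cauchy's estimates: a factor [n] is paid for by enlarging [a] to [b], for derivatives
    as well as for the factor [i_s] in [h]. *)
Lemma pow_deriv_bound (a b : R) n : 0 <= a -> a <= b ->
  n%:R * a ^+ n.-1 * (b - a) <= b ^+ n.
Proof.
move=> a0 ab; case: n => [|n]; first by rewrite mul0r mul0r expr0.
have b0 := le_trans a0 ab.
apply: (@le_trans _ _ (b ^+ n.+1 - a ^+ n.+1)); last by rewrite gerBl exprn_ge0.
rewrite subrXX mulrC ler_wpM2l ?subr_ge0 //=.
have -> : n.+1%:R * a ^+ n = \sum_(i < n.+1) a ^+ n.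
  by rewrite sumr_const card_ord mulr_natl.
apply: ler_sum => i _ /=.
have -> : a ^+ n = a ^+ (n - i) * a ^+ i by rewrite -exprD subnK // -ltnS.
by apply: ler_pM; rewrite ?exprn_ge0 // ?lerXn2r ?nnegrE.
Qed.

Lemma isdiff_near g g' x l : isdiff S g x l -> (\forall y \near x, g y = g' y) ->
  isdiff S g' x l.
Proof.
move=> h /(near_nv S) [d d0 hd] e e0; have [d1 d10 hd1] := h e e0.
exists (Num.min d d1); first by rewrite lt_min d0.
move=> v; rewrite lt_min => /andP[v1 v2].
rewrite -!hd ?subrr ?(addrC x) ?addrK //; first by rewrite addrC; exact: hd1.
by rewrite nv0.
Qed.

Lemma pderivM g g' u x :
  differentiable (g : 'rV[K]_k -> K^o) x -> differentiable (g' : 'rV[K]_k -> K^o) x ->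
  differentiable ((fun y => g y * g' y) : 'rV[K]_k -> K^o) x /\
  pderiv u (fun y => g y * g' y) x = g x * pderiv u g' x + pderiv u g x * g' x.
Proof.
move=> h h'; split.
  exact: (differentiableM (f := g : _ -> K^o) (g := g' : _ -> K^o) h h').
rewrite /pderiv (deriveM (f := g : _ -> K^o) (g := g' : _ -> K^o)) //; last 2 first.
- exact: diff_derivable.
- exact: diff_derivable.
by congr (_ + _); rewrite mulrC.
Qed.

Lemma isdiff_coord (x0 : 'rV[K]_k) x w : isdiff S (fun y => (y - x0) 0 w) x (fun u => (u == w)%:R).
Proof.
move=> e e0; exists 1 => // h _; rewrite /lin_form (bigD1 w) //= eqxx mul1r big1.
  rewrite addr0 !mxE (_ : _ - _ = 0) ?nrm0 ?mulr_ge0 ?nv_ge0 ?(ltW e0) //; ring.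
by move=> u /negbTE ->; rewrite mul0r.
Qed.

Lemma pderiv_coordX (x0 : 'rV[K]_k) x w u n :
  differentiable ((fun y => (y - x0) 0 w ^+ n) : 'rV[K]_k -> K^o) x /\
  pderiv u (fun y => (y - x0) 0 w ^+ n) x = (u == w)%:R * n%:R * (x - x0) 0 w ^+ n.-1.
Proof.
have [d1 d2] := isdiffP (isdiff_coord x0 x w).
elim: n => [|n [IH1 IH2]].
  rewrite mulr0 mul0r; split; first exact: differentiable_cst.
  exact: derive_cst.
have -> : (fun y => (y - x0) 0 w ^+ n.+1) = (fun y => (y - x0) 0 w * (y - x0) 0 w ^+ n).
  by apply/funext => y; rewrite exprS.
have [h1 h2] := pderivM u d1 IH1; split=> //.
rewrite h2 IH2 d2 -natr1 /=; case: n {IH1 IH2 h1 h2} => [|n] /=; first by rewrite !expr0; ring.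
by rewrite exprS; ring.
Qed.

Lemma pderiv_prod (F : 'I_k -> 'rV[K]_k -> K) u x (P : pred 'I_k) :
  (forall w, P w -> differentiable (F w : 'rV[K]_k -> K^o) x /\ pderiv u (F w) x = 0) ->
  differentiable ((fun y => \prod_(w | P w) F w y) : 'rV[K]_k -> K^o) x /\
  pderiv u (fun y => \prod_(w | P w) F w y) x = 0.
Proof.
move=> h.
have E : (fun y => \prod_(w | P w) F w y) =
    (fun y => \prod_(w <- [seq w <- index_enum 'I_k | P w]) F w y).
  by apply/funext => y; rewrite big_filter.
rewrite E; have : all P [seq w <- index_enum 'I_k | P w] by apply: filter_all.
elim: [seq _ <- _ | _] => [_|w l IH /= /andP[/h [h1 h2] /IH [h3 h4]]].
  have -> : (fun y => \prod_(w <- [::]) F w y) = fun=> 1.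
    by apply/funext => y; rewrite big_nil.
  by split; [exact: differentiable_cst|exact: derive_cst].
have -> : (fun y => \prod_(w <- w :: l) F w y) = (fun y => F w y * \prod_(w <- l) F w y).
  by apply/funext => y; rewrite big_cons.
have [h5 h6] := pderivM u h1 h3; split=> //.
by rewrite h6 h2 h4 mul0r mulr0 addr0.
Qed.

Lemma pderiv_monom (x0 : 'rV[K]_k) x u m :
  differentiable ((fun y => monom (y - x0) m) : 'rV[K]_k -> K^o) x /\
  pderiv u (fun y => monom (y - x0) m) x =
    (m 0 u)%:R * (x - x0) 0 u ^+ (m 0 u).-1 * \prod_(w < k | w != u) (x - x0) 0 w ^+ m 0 w.
Proof.
have E : (fun y => monom (y - x0) m) = (fun y => (y - x0) 0 u ^+ m 0 u *
    \prod_(w < k | w != u) (y - x0) 0 w ^+ m 0 w).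
  by apply/funext => y; rewrite /monom (bigD1 u).
have [h1 h2] := pderiv_coordX x0 x u u (m 0 u).
have [|h3 h4] := @pderiv_prod (fun w y => (y - x0) 0 w ^+ m 0 w) u x (fun w => w != u).
  move=> w wu; have [h5 h6] := pderiv_coordX x0 x w u (m 0 w); split=> //.
  by rewrite h6 eq_sym (negbTE wu) !mul0r.
rewrite E; have [h5 h6] := pderivM u h1 h3; split=> //.
by rewrite h6 h4 mulr0 add0r h2 eqxx mul1r.
Qed.

Lemma nrm_pderiv_monom (x0 : 'rV[K]_k) x u m r :
  nv (x - x0) <= r ->
  nrm (pderiv u (fun y => monom (y - x0) m) x) <= (m 0 u)%:R * r ^+ (mdeg m).-1.
Proof.
move=> xr; rewrite (pderiv_monom x0 x u m).2 -mulrA nrmM nrm_nat.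
have r0 := le_trans (nv_ge0 S _) xr.
have [->|m0] := posnP (m 0%R u); first by rewrite !mul0r.
apply: ler_wpM2l => //.
have -> : (mdeg m).-1 = ((m 0%R u).-1 + \sum_(w < k | w != u) m 0%R w)%N.
  by rewrite /mdeg (bigD1 u) //= -subn1 -addnBAC // subn1.
have hc w : nrm ((x - x0) 0 w) <= r by apply: le_trans (nv_coord _ _ _) xr.
rewrite nrmM exprD nrmX; apply: ler_pM; rewrite ?exprn_ge0 ?nrm_ge0 //.
  by rewrite lerXn2r ?nnegrE ?nrm_ge0.
rewrite nrm_prod expr_sum; apply: ler_prod => w _.
by rewrite nrmX exprn_ge0 ?nrm_ge0 // lerXn2r ?nnegrE ?nrm_ge0 /=.
Qed.

Lemma pderiv_monomS (x0 : 'rV[K]_k) x u m :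
  pderiv u (fun y => monom (y - x0) (m + unit_tuple nat u)) x =
    ((m 0 u).+1)%:R * monom (x - x0) m.
Proof.
have Eu : (m + unit_tuple nat u) 0 u = (m 0 u).+1.
  by rewrite mxE unit_tupleE eqxx -[(_ + _)%R]/(_ + 1)%N addn1.
rewrite (pderiv_monom x0 x u _).2 /monom [in RHS](bigD1 u) //= Eu mulrA.
congr (_ * _ * _); apply: eq_bigr => w wu.
by rewrite [(m + _) _ _]mxE unit_tupleE (negbTE wu) addr0.
Qed.

(** [B] bounds the norm [\sum_m |a_m| rho^|m|], which is submultiplicative and dominates the
    function on the polydisc. *)
Definition powser (x0 : 'rV[K]_k) (rho : R) (g : 'rV[K]_k -> K) (a : 'rV[nat]_k -> K) (B : R) :=
  [/\ 0 < rho, bd (fun m => nrm (a m) * rho ^+ mdeg m) B &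
   forall x : 'rV[K]_k, nv (x - x0) < rho -> is_sum (fun m => a m * monom (x - x0) m) (g x)].

(** [N] is an order of vanishing at [x0]; identities between analytic functions are proved by
    induction on it. *)
Definition nbound (N : nat) (x0 : 'rV[K]_k) (rho : R) (g : 'rV[K]_k -> K) (B : R) :=
  exists2 a, powser x0 rho g a B & forall m, (mdeg m < N)%N -> a m = 0.

Definition dpowser (u : 'I_k) (a : 'rV[nat]_k -> K) m := ((m 0 u).+1)%:R * a (m + unit_tuple nat u).

Lemma powser_mono x0 rho rho' g a B B' : powser x0 rho g a B -> 0 < rho' -> rho' <= rho -> B <= B' ->
  powser x0 rho' g a B'.
Proof.
move=> [r0 h1 h2] r'0 rr BB; split=> //.
  apply: bd_le h1 BB => m; rewrite ler_wpM2l ?nrm_ge0 //.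
  by rewrite lerXn2r ?nnegrE ?(ltW r0) ?(ltW r'0).
by move=> x hx; apply: h2; apply: lt_le_trans rr.
Qed.

Lemma powser_bd x0 rho g a B x : powser x0 rho g a B -> nv (x - x0) <= rho ->
  bd (fun m => nrm (a m * monom (x - x0) m)) B.
Proof.
move=> [r0 h1 h2] hx; apply: bd_le h1 (lexx _) => m.
by rewrite nrmM ler_wpM2l ?nrm_ge0 // nrm_monom.
Qed.

Lemma powser_bound x0 rho g a B x : powser x0 rho g a B -> nv (x - x0) < rho -> nrm (g x) <= B.
Proof.
move=> h hx; have [_ _ h2] := h.
by apply: is_sum_nrm (h2 x hx) _; apply: powser_bd h (ltW hx).
Qed.

Lemma powser_deriv x0 rho rho' g a B u : powser x0 rho g a B -> 0 < rho' -> rho' < rho ->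
  [/\ forall x, nv (x - x0) < rho -> differentiable (g : 'rV[K]_k -> K^o) x,
      powser x0 rho' (pderiv u g) (dpowser u a) (B / (rho - rho')) &
      forall x, nv (x - x0) < rho -> is_sum (fun m => dpowser u a m * monom (x - x0) m) (pderiv u g x)].
Proof.
move=> harr r'0 rr; have [r0 h1 h2] := harr.
(* This is [pow_deriv_bound] with [a = r] and [b = rho], for the total degree, which dominates the
   exponent of [x_u]. *)
have M1 r : 0 <= r -> r < rho ->
  bd (fun m => nrm (a m) * ((mdeg m)%:R * r ^+ (mdeg m).-1)) (B / (rho - r)).
  move=> rp rlt; rewrite mulrC; have d0 : 0 < rho - r by rewrite subr_gt0.
  apply: bd_le (bdZ _ h1) (lexx _); last by rewrite invr_ge0 ltW.
  move=> m; rewrite mulrC mulrC [leRHS]mulrC ler_pdivlMr // -mulrA ler_wpM2l ?nrm_ge0 //.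
  by apply: pow_deriv_bound => //; exact: ltW.
have main x : nv (x - x0) < rho ->
    isdiff S g x (fun u => sum_of (fun m => a m * pderiv u (fun y => monom (y - x0) m) x)).
  (* A radius strictly between [nv (x - x0)] and [rho]: on that polydisc the majorant [M1]
     applies. *)
  move=> hx; pose r := (nv (x - x0) + rho) / 2.
  have hr1 : nv (x - x0) < r by rewrite /r; lra.
  have hr2 : r < rho by rewrite /r; lra.
  have rp : 0 <= r by apply: le_trans (ltW hr1); exact: nv_ge0.
  have pd m y v : differentiable ((fun y => a m * monom (y - x0) m) : 'rV[K]_k -> K^o) y /\
      pderiv v (fun y => a m * monom (y - x0) m) y = a m * pderiv v (fun y => monom (y - x0) m) y.
    have [p1 _] := pderiv_monom x0 y v m.
    have c1 : differentiable ((fun=> a m) : 'rV[K]_k -> K^o) y by exact: differentiable_cst.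
    have [p3 p4] := pderivM v c1 p1; split=> //; rewrite p4.
    by rewrite [X in _ + X * _](_ : _ = 0) ?mul0r ?addr0 //; exact: derive_cst.
  have := @termwise_diff R K S k _ (fun m y => a m * monom (y - x0) m) x0 r
     (fun m => nrm (a m) * ((mdeg m)%:R * r ^+ (mdeg m).-1)) _ (M1 r rp hr2).
  move=> /(_ _ _ _ x hr1) T.
  have {}T : isdiff S (fun y => sum_of (fun m => a m * monom (y - x0) m)) x
      (fun u => sum_of (fun m => pderiv u (fun y => a m * monom (y - x0) m) x)).
    apply: T.
    - by move=> m; rewrite !mulr_ge0 ?nrm_ge0 ?exprn_ge0.
    - move=> m y hy; split=> [|v]; first exact: (pd m y u).1.
      rewrite (pd m y v).2 nrmM ler_wpM2l ?nrm_ge0 //.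
      apply: le_trans (nrm_pderiv_monom _ _ (ltW hy)) _.
      rewrite ler_wpM2r ?exprn_ge0 // ler_nat /mdeg (bigD1 v) //=; exact: leq_addr.
    - move=> y hy; exists B; apply: powser_bd harr _; apply: ltW; exact: lt_trans hr2.
  apply: (isdiff_near (g := fun y => sum_of (fun m => a m * monom (y - x0) m))).
    move: T; congr (isdiff S _ x _); apply/funext => v; apply: sum_of_ext => m.
    exact: (pd m x v).2.
  apply/(near_nv S); exists (rho - nv (x - x0)); first by rewrite subr_gt0.
  move=> y hy; apply/(is_sumE S); apply: h2.
  rewrite -(subrK x y) -addrA; apply: le_lt_trans (nvD _ _ _) _; lra.
have main2 x : nv (x - x0) < rho ->
    is_sum (fun m => dpowser u a m * monom (x - x0) m) (pderiv u g x) /\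
    bd (fun m => nrm (dpowser u a m) * nv (x - x0) ^+ mdeg m) (B / (rho - nv (x - x0))).
  move=> hx; have [_ /(_ u) ->] := isdiffP (main x hx).
  have inj : injective (fun m => m + unit_tuple nat u).
    move=> m m' /rowP e; apply/rowP => w; have := e w; rewrite !mxE.
    by move=> /eqP; rewrite eqn_add2r => /eqP.
  have b1 := M1 _ (nv_ge0 S _) hx.
  split.
    (* Monomials free of [x_u] have derivative zero; all others have the form [m + {u}], and the sum
       is reindexed by [m]. *)
    have [||s1 s2] := @sum_of_inj R K S _ _ (fun m => m + unit_tuple nat u)
      (fun m => a m * pderiv u (fun y => monom (y - x0) m) x) inj.
    - move=> m hm; have [mu|mu] := posnP (m 0%R u).
        by rewrite (pderiv_monom x0 x u m).2 mu !mul0r mulr0.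
      by have [m' hm'] := rV_pos mu; move: (hm m'); rewrite hm' eqxx.
    - eexists; apply: bd_le b1 (lexx _) => m; rewrite nrmM ler_wpM2l ?nrm_ge0 //.
      apply: le_trans (nrm_pderiv_monom _ _ (lexx _)) _.
      rewrite ler_wpM2r ?exprn_ge0 ?nv_ge0 // ler_nat /mdeg (bigD1 u) //=; exact: leq_addr.
    rewrite -s2; have := summ_is_sum s1; apply: is_sum_ext => m.
    by rewrite pderiv_monomS /dpowser; ring.
  apply: bd_le (bd_inj inj b1) (lexx _) => m.
  rewrite /dpowser nrmM nrm_nat mdegD mdeg_unit addn1 /= -mulrA mulrCA ler_wpM2l ?nrm_ge0 //.
  rewrite ler_wpM2r ?exprn_ge0 ?nv_ge0 // ler_nat ltnS /mdeg (bigD1 u) //=; exact: leq_addr.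
split; first by move=> x hx; have [] := isdiffP (main x hx).
- split=> //.
    have inj : injective (fun m => m + unit_tuple nat u).
      move=> m m' /rowP e; apply/rowP => w; have := e w; rewrite !mxE.
      by move=> /eqP; rewrite eqn_add2r => /eqP.
    apply: bd_le (bd_inj inj (M1 _ (ltW r'0) rr)) (lexx _) => m.
    rewrite /dpowser nrmM nrm_nat mdegD mdeg_unit addn1 /= -mulrA mulrCA ler_wpM2l ?nrm_ge0 //.
    rewrite ler_wpM2r ?exprn_ge0 ?(ltW r'0) // ler_nat ltnS /mdeg (bigD1 u) //=; exact: leq_addr.
  by move=> x hx; have [] := main2 x (lt_trans hx rr).
- by move=> x /main2 [].
Qed.

End PowerSeries.

(** * Analytic functions with majorant and order of vanishing *)

Section Analytic.
Variables (R : realType) (K : numFieldType) (S : rcs R K) (k : nat).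
Local Notation rcr := (rcr S).
Local Notation nrm := (nrm S).
Local Notation nv := (@nv R K S k).
Local Notation summ := (summ S).
Local Notation nbound := (@nbound R K S k).
Local Notation powser := (@powser R K S k).
Implicit Types (m : 'rV[nat]_k) (x : 'rV[K]_k) (N : nat) (g : 'rV[K]_k -> K).

(** Tonelli for bounds: the column sums serve as [Q]. *)
Lemma bd_swap (I J : choiceType) (p : I -> J -> R) (P : I -> R) B :
  (forall i j, 0 <= p i j) -> (forall i, bd (p i) (P i)) -> bd P B ->
  exists2 Q, (forall j, bd (p^~ j) (Q j)) & bd Q B.
Proof.
move=> p0 h PB; have h2 := bd_pair p0 h PB.
have h3 : bd (fun x : J * I => p x.2 x.1) B.
  by apply: (bd_inj (f := fun x : J * I => (x.2, x.1)) _ h2) => -[x y] [z t] [-> ->].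
have [c1 c2] := bd_row (p := fun x : J * I => p x.2 x.1) (fun x : J * I => p0 _ _) h3.
by exists (fun j => rsum (p^~ j)).
Qed.

Lemma bd_prod (I J : choiceType) (p : I -> R) (q : J -> R) B C :
  (forall i, 0 <= p i) -> (forall i, 0 <= q i) -> bd p B -> bd q C ->
  bd (fun x : I * J => p x.1 * q x.2) (B * C).
Proof.
move=> p0 q0 pB qC; apply: (bd_pair (p := fun i j => p i * q j) (P := fun i => p i * C)).
- by move=> i j; rewrite mulr_ge0.
- by move=> i; exact: bdZ.
- by rewrite mulrC; apply: bd_le (bdZ (bd_ge0 qC) pB) (lexx _) => i; rewrite mulrC.
Qed.

Lemma pderiv_near u g g' x : (\forall y \near x, g y = g' y) -> pderiv u g x = pderiv u g' x.
Proof.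
move=> h; rewrite /pderiv.
exact: (near_eq_derive (f := g : _ -> K^o) (g := g' : _ -> K^o) (unit_tuple K u) h).
Qed.

Lemma near_ball (x0 x : 'rV[K]_k) d (P : 'rV[K]_k -> Prop) : nv (x - x0) < d ->
  (forall y : 'rV[K]_k, nv (y - x0) < d -> P y) -> \forall y \near x, P y.
Proof.
move=> hx h; apply/(near_nv S); exists (d - nv (x - x0)); first by rewrite subr_gt0.
move=> y hy; apply: h; rewrite -(subrK x y) -addrA.
apply: le_lt_trans (nvD _ _ _) _; lra.
Qed.

Lemma powser_ext x0 rho g g' a B : (forall x, nv (x - x0) < rho -> g x = g' x) ->
  powser x0 rho g a B -> powser x0 rho g' a B.
Proof. by move=> e [r0 h1 h2]; split=> // x hx; rewrite -e //; exact: h2. Qed.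

Lemma powser_at0 x0 rho g a B : powser x0 rho g a B -> a 0 = g x0.
Proof.
move=> [r0 _ /(_ x0)]; rewrite subrr nv0 => /(_ r0) h.
rewrite -[LHS]mulr1 -(monom0 (0 : 'rV[K]_k)); apply: (is_sum_uniq S _ h).
apply: (@is_sum_single _ _ S _ (fun m => a m * monom (0 : 'rV[K]_k) m) 0).
by move=> i i0; rewrite monom_0 // mulr0.
Qed.

Lemma nb_at0 x0 rho g B : nbound 0 x0 rho g B -> g x0 = 0 -> nbound 1 x0 rho g B.
Proof.
move=> [a ha _] g0; exists a => // m; rewrite ltnS leqn0 => /eqP/mdeg_eq0 ->.
by rewrite (powser_at0 ha).
Qed.

(** Induction on the degree of [m]: the constant term is the value at [x0], and a coefficient of
    higher degree appears, up to a nonzero factor, in a partial derivative. *)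
Lemma powser_uniq x0 rho rho' g g' a b B B' :
  powser x0 rho g a B -> powser x0 rho' g' b B' -> (\forall y \near x0, g y = g' y) -> a = b.
Proof.
move=> ha hb e; apply/funext => m; move en : (mdeg m) => n.
elim: n m en rho rho' g g' a b B B' ha hb e => [|n IH] m en rho rho' g g' a b B B' ha hb e.
  have -> := mdeg_eq0 en.
  rewrite (powser_at0 ha) (powser_at0 hb).
  exact: (nbhs_singleton e).
have [|u mu] := @mdeg_pos k m; first by rewrite en.
have [m' hm'] := rV_pos mu.
have en' : mdeg m' = n by move: en; rewrite hm' mdegD mdeg_unit addn1 => -[].
have [r0 _ _] := ha; have [r'0 _ _] := hb.
have rr1 : 0 < rho / 2 by lra.
have rr2 : rho / 2 < rho by lra.
have rr3 : 0 < rho' / 2 by lra.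
have rr4 : rho' / 2 < rho' by lra.
have [_ da _] := powser_deriv u ha rr1 rr2.
have [_ db _] := powser_deriv u hb rr3 rr4.
have := IH m' en' _ _ _ _ _ _ _ _ da db; rewrite /dpowser -hm' => h.
have n0 : ((m' 0 u).+1)%:R != 0 :> K by rewrite pnatr_eq0.
apply: (mulfI n0); apply: h.
move: e => /(near_nv S) [d d0 hd].
apply/(near_nv S); exists d => // y hy; apply: pderiv_near.
exact: near_ball hy hd.
Qed.

Lemma nb_mono N N' x0 rho rho' g B B' : nbound N x0 rho g B -> (N' <= N)%N -> 0 < rho' ->
  rho' <= rho -> B <= B' -> nbound N' x0 rho' g B'.
Proof.
move=> [a ha hN] NN r0 rr BB; exists a; first exact: powser_mono ha r0 rr BB.
by move=> m mN; apply: hN; exact: leq_trans NN.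
Qed.

Lemma nb_le N x0 rho g B B' : nbound N x0 rho g B -> B <= B' -> nbound N x0 rho g B'.
Proof. by move=> h; have [a [r0 _ _] _] := h; apply: nb_mono h _ r0 _. Qed.

Lemma nb_ge0 N x0 rho g B : nbound N x0 rho g B -> 0 <= B.
Proof. by move=> [a [_ /bd_ge0]]. Qed.

Lemma nb_ext N x0 rho g g' B : (forall x, nv (x - x0) < rho -> g x = g' x) ->
  nbound N x0 rho g B -> nbound N x0 rho g' B.
Proof. by move=> e [a ha hN]; exists a => //; exact: powser_ext ha. Qed.

Lemma nb_bound N x0 rho g B x : nbound N x0 rho g B -> nv (x - x0) < rho -> nrm (g x) <= B.
Proof. by move=> [a ha _]; exact: powser_bound ha. Qed.

(* By uniqueness of the coefficients, the order of vanishing may be read off on a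
   smaller polydisc. *)
Lemma nb_raise N x0 rho rho1 g B B1 :
  nbound 0 x0 rho g B -> nbound N x0 rho1 g B1 -> nbound N x0 rho g B.
Proof.
move=> [a ha _] [b hb hN]; exists a => // m mN.
by rewrite (powser_uniq ha hb) ?hN //; exact: filterE.
Qed.

Lemma nb_cst x0 rho c : 0 < rho -> nbound 0 x0 rho (fun=> c) (nrm c).
Proof.
move=> r0; exists (fun m => if m == 0 then c else 0) => //; split=> //.
  apply: (bd_single (i0 := 0)); rewrite ?eqxx ?mdeg0 ?expr0 ?mulr1 ?nrm_ge0 //.
  by move=> m /negbTE ->; rewrite nrm0 mul0r.
move=> x _; rewrite -[X in is_sum _ X]mulr1 -[X in is_sum _ (_ * X)](monom0 (x - x0)).
have := @is_sum_single R K S _ (fun m => (if m == 0 then c else 0) * monom (x - x0) m) 0.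
by rewrite eqxx; apply=> m /negbTE ->; rewrite mul0r.
Qed.

Lemma nb_zero N x0 rho : 0 < rho -> nbound N x0 rho (fun=> 0) 0.
Proof.
move=> r0; have [a ha _] := nb_cst x0 0 r0; rewrite nrm0 in ha.
exists (fun=> 0) => //; split=> //.
  by move=> A; rewrite big1 // => m _; rewrite nrm0 mul0r.
move=> x _; apply: is_sum_ext (is_sum0 S _) => m; by rewrite mul0r.
Qed.

Lemma nbD N x0 rho g g' B B' : nbound N x0 rho g B -> nbound N x0 rho g' B' ->
  nbound N x0 rho (fun x => g x + g' x) (B + B').
Proof.
move=> [a [r0 a1 a2] aN] [b [_ b1 b2] bN]; exists (fun m => a m + b m); last first.
  by move=> m mN; rewrite aN // bN // addr0.
split=> //.
  apply: bd_le (bdD a1 b1) (lexx _) => m.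
  by rewrite -mulrDl ler_wpM2r ?exprn_ge0 ?nrmD ?(ltW r0).
move=> x hx; apply: is_sum_ext (is_sumD S (a2 x hx) (b2 x hx)) => m.
by rewrite mulrDl.
Qed.

Lemma nb_fsum N x0 rho (T : finType) (g : T -> 'rV[K]_k -> K) (B : T -> R) : 0 < rho ->
  (forall t, nbound N x0 rho (g t) (B t)) ->
  nbound N x0 rho (fun x => \sum_t g t x) (\sum_t B t).
Proof.
move=> r0 h; elim: (index_enum T) => [|t l IH].
  rewrite big_nil; apply: nb_ext (nb_zero _ _ r0) => x _; by rewrite big_nil.
rewrite big_cons; apply: nb_ext (nbD (h t) IH) => x _; by rewrite big_cons.
Qed.

Lemma nbZ N x0 rho g B c : nbound N x0 rho g B -> nbound N x0 rho (fun x => c * g x) (nrm c * B).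
Proof.
move=> [a [r0 a1 a2] aN]; exists (fun m => c * a m); last first.
  by move=> m mN; rewrite aN // mulr0.
split=> //.
  by apply: bd_le (bdZ (nrm_ge0 S c) a1) (lexx _) => m; rewrite nrmM mulrA.
move=> x hx; have h := is_sumZ S (c := c) (a2 x hx).
apply: is_sum_ext h => m; by rewrite mulrA.
Qed.

Lemma nbN N x0 rho g B : nbound N x0 rho g B -> nbound N x0 rho (fun x => - g x) B.
Proof.
move=> /(nbZ (-1)); rewrite nrmN nrm1 mul1r; apply: nb_ext => x _; by rewrite mulN1r.
Qed.

Lemma nbB N x0 rho g g' B B' : nbound N x0 rho g B -> nbound N x0 rho g' B' ->
  nbound N x0 rho (fun x => g x - g' x) (B + B').
Proof. by move=> h /nbN; exact: nbD. Qed.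

Lemma powser_tsum (T : choiceType) x0 rho (g : T -> 'rV[K]_k -> K) a (B : T -> R) B0 :
  0 < rho -> (forall t, powser x0 rho (g t) (a t) (B t)) -> bd B B0 ->
  (forall m, summ (a^~ m)) /\ powser x0 rho (fun x => sum_of (g^~ x)) (fun m => sum_of (a^~ m)) B0.
Proof.
move=> r0 ha BB.
have p0 (t : T) m : 0 <= nrm (a t m) * rho ^+ mdeg m.
  by rewrite mulr_ge0 ?nrm_ge0 ?exprn_ge0 ?ltW.
have h1 t : bd (fun m => nrm (a t m) * rho ^+ mdeg m) (B t) by case: (ha t).
have [Q Q1 Q2] := bd_swap p0 h1 BB.
have sa m : summ (a^~ m).
  exists (Q m / rho ^+ mdeg m); have rn : 0 < rho ^+ mdeg m by rewrite exprn_gt0.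
  rewrite mulrC; apply: bd_le (bdZ _ (Q1 m)) (lexx _); last by rewrite invr_ge0 ltW.
  by move=> t; rewrite mulrC mulfK // gt_eqF.
split=> //; split=> //.
  apply: bd_le Q2 (lexx _) => m.
  have -> : rho ^+ mdeg m = nrm (rcr (rho ^+ mdeg m)).
    by rewrite nrm_rcr ger0_norm // exprn_ge0 // ltW.
  rewrite mulrC -nrmM -(@sum_ofZ _ _ S) //; apply: sum_of_nrm.
  apply: bd_le (Q1 m) (lexx _) => t; rewrite nrmM nrm_rcr ger0_norm ?exprn_ge0 ?(ltW r0) //.
  by rewrite mulrC.
move=> x hx.
have rowb t : bd (fun m => nrm (a t m * monom (x - x0) m)) (B t).
  by apply: powser_bd (ha t) (ltW hx).
case: (fubini rowb BB) => f1 f2 f3 f4 f5 f6 f7.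
have sg t : g t x = sum_of (fun m => a t m * monom (x - x0) m).
  by apply/esym/(is_sumE S); case: (ha t) => _ _; apply.
have -> : sum_of (g^~ x) = sum_of (fun t => sum_of (fun m => a t m * monom (x - x0) m)).
  by apply: sum_of_ext.
rewrite f6 -f7; apply: is_sum_ext (summ_is_sum f5) => m.
rewrite mulrC -(@sum_ofZ _ _ S) //; by apply: sum_of_ext => t; rewrite mulrC.
Qed.

Lemma nb_tsum (T : choiceType) N x0 rho (g : T -> 'rV[K]_k -> K) (B : T -> R) B0 :
  0 < rho -> (forall t, nbound N x0 rho (g t) (B t)) -> bd B B0 ->
  (forall x, nv (x - x0) < rho -> summ (g^~ x)) /\
  nbound N x0 rho (fun x => sum_of (g^~ x)) B0.
Proof.
move=> r0 h BB; split.
  by move=> x hx; apply: summ_le BB => t; exact: nb_bound (h t) hx.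
have ha0 t : exists a, powser x0 rho (g t) a (B t) /\ forall m, (mdeg m < N)%N -> a m = 0.
  by case: (h t) => a; exists a.
have [a ha] := choice ha0.
have [_ hs] := powser_tsum r0 (fun t => (ha t).1) BB.
exists (fun m => sum_of (a^~ m)) => // m mN.
apply: (is_sumE S); apply: is_sum_ext (is_sum0 S _) => t.
by case: (ha t) => _ ->.
Qed.

Lemma nbM N N' x0 rho g g' B B' : nbound N x0 rho g B -> nbound N' x0 rho g' B' ->
  nbound (N + N') x0 rho (fun x => g x * g' x) (B * B').
Proof.
move=> [a ha aN] [b hb bN]; have [r0 a1 a2] := ha; have [_ b1 b2] := hb.
pose M := 'rV[nat]_k.
(* The coefficient of the Cauchy product at [m] is the sum of [c p m] over all pairs [p]; the case
   distinction replaces a sum over the fibre above [m]. *)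
pose c (p : M * M) m := if p.1 + p.2 == m then a p.1 * b p.2 else 0.
exists (fun m => sum_of (c^~ m)); last first.
  move=> m mN; apply: (is_sumE S); apply: is_sum_ext (is_sum0 S _) => p.
  rewrite /c; case: eqP => // e; move: mN; rewrite -e mdegD.
  have [/aN ->|h1] := ltnP (mdeg p.1) N; first by rewrite mul0r.
  have [/bN ->|h2] := ltnP (mdeg p.2) N'; first by rewrite mulr0.
  by rewrite ltnNge leq_add.
have rp n : 0 <= rho ^+ n by rewrite exprn_ge0 // ltW.
split=> //.
  have hp : bd (fun p : M * M => (nrm (a p.1) * rho ^+ mdeg p.1) * (nrm (b p.2) * rho ^+ mdeg p.2)) (B * B').
    by apply: (bd_prod (p := fun m => nrm (a m) * rho ^+ mdeg m)
      (q := fun m => nrm (b m) * rho ^+ mdeg m)) => // m; rewrite mulr_ge0 ?nrm_ge0.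
  have [||Q Q1 Q2] := bd_swap (p := fun p m => nrm (c p m) * rho ^+ mdeg m) _ _ hp.
  - by move=> p m; rewrite mulr_ge0 ?nrm_ge0.
  - move=> p; apply: (bd_single (i0 := p.1 + p.2)).
    + by move=> m; rewrite /c eq_sym => /negbTE ->; rewrite nrm0 mul0r.
    + by rewrite mulr_ge0 ?nrm_ge0.
    + by rewrite /c eqxx nrmM mdegD exprD mulrACA.
  apply: bd_le Q2 (lexx _) => m; have rn : 0 < rho ^+ mdeg m by rewrite exprn_gt0.
  rewrite -ler_pdivlMr //; apply: sum_of_nrm; rewrite mulrC.
  apply: bd_le (bdZ _ (Q1 m)) (lexx _); last by rewrite invr_ge0 ltW.
  by move=> p; rewrite mulrC mulfK // gt_eqF.
move=> x hx; have hx' := ltW hx.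
have [p1 p2] := summ_prod (powser_bd ha hx') (powser_bd hb hx').
have sp : summ (fun p : M * M => a p.1 * monom (x - x0) p.1 * (b p.2 * monom (x - x0) p.2)).
  by exists (B * B').
have [q1 q2] := is_sum_fib (fun p : M * M => p.1 + p.2) sp.
rewrite -(is_sumE S (a2 x hx)) -(is_sumE S (b2 x hx)) -p2 -q2.
have := summ_is_sum q1; apply: is_sum_ext => m.
have E : (fun i : M * M => if i.1 + i.2 == m then a i.1 * monom (x - x0) i.1 *
      (b i.2 * monom (x - x0) i.2) else 0) = (fun p => monom (x - x0) m * c p m).
  apply/funext => p; rewrite /c; case: eqP => [<-|]; last by rewrite mulr0.
  by rewrite monomD; ring.
(* Where the monomial vanishes at [x], summability cannot be recovered by dividing by it, but both
   sides are zero. *)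
rewrite E; have [m0|m0] := eqVneq (monom (x - x0) m) 0.
  rewrite m0 mulr0; apply: (is_sumE S); apply: is_sum_ext (is_sum0 S _) => t.
  by rewrite mul0r.
rewrite [RHS]mulrC -(@sum_ofZ _ _ S) //.
have [C hC] := sp; have sE : summ (fun p => monom (x - x0) m * c p m).
  rewrite -E; exists C; apply: bd_le hC (lexx _) => p; case: ifP => // _.
  by rewrite nrm0 nrm_ge0.
have := summZ (monom (x - x0) m)^-1 sE; apply: summ_ext => t.
by rewrite mulKf.
Qed.

Lemma nb_deriv N x0 rho rho' g B u : nbound N x0 rho g B -> 0 < rho' -> rho' < rho ->
  (forall x, nv (x - x0) < rho -> differentiable (g : 'rV[K]_k -> K^o) x) /\
  nbound N.-1 x0 rho' (pderiv u g) (B / (rho - rho')).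
Proof.
move=> [a ha aN] r'0 rr; have [h1 h2 _] := powser_deriv u ha r'0 rr.
split=> //; exists (dpowser u a) => // m mN; rewrite /dpowser aN ?mulr0 //.
by rewrite mdegD mdeg_unit addn1; case: N mN {aN}.
Qed.

Lemma nb_diff N x0 rho g B x : nbound N x0 rho g B -> nv (x - x0) < rho ->
  differentiable (g : 'rV[K]_k -> K^o) x.
Proof.
(* For [k = 0] there is no index to feed to [powser_deriv]; the space is a point and every function
   on it is differentiable. *)
move=> [a ha _]; have [r0 _ _] := ha; have [k0|/lt0n_neq0 k0] := posnP k.
  move=> _; have /isdiffP [] // : isdiff S g x (fun=> 0).
  move=> e e0; exists 1 => // h _.
  have -> : h = 0 by apply/rowP => i; have := ltn_ord i; rewrite {2}k0.
  by rewrite addr0 subrr /lin_form big1 ?subrr ?nrm0 ?mulr_ge0 ?nv_ge0 ?(ltW e0) // => *; rewrite mul0r.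
have u : 'I_k by case: k k0 => // n _; exact: ord0.
have rr1 : 0 < rho / 2 by lra.
have rr2 : rho / 2 < rho by lra.
by have [h _ _] := powser_deriv u ha rr1 rr2; exact: h.
Qed.

(** Both orders of differentiation give the same coefficients after two applications of
    [dpowser]. *)
Lemma nb_schwarz N x0 rho g B u v x : nbound N x0 rho g B -> nv (x - x0) < rho ->
  pderiv u (pderiv v g) x = pderiv v (pderiv u g) x.
Proof.
move=> [a ha _] hx; have [r0 _ _] := ha.
pose r1 := (nv (x - x0) + rho) / 2.
have n0 := nv_ge0 S (x - x0).
have hr1 : nv (x - x0) < r1 by rewrite /r1; lra.
have hr2 : r1 < rho by rewrite /r1; lra.
have r10 : 0 < r1 by apply: le_lt_trans hr1.
have hr3 : r1 / 2 < r1 by lra.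
have r20 : 0 < r1 / 2 by lra.
have [_ hu _] := powser_deriv u ha r10 hr2; have [_ hv _] := powser_deriv v ha r10 hr2.
have [_ _ huv] := powser_deriv u hv r20 hr3; have [_ _ hvu] := powser_deriv v hu r20 hr3.
apply: (is_sum_uniq S (huv x hr1)); move: (hvu x hr1); apply: is_sum_ext => m.
congr (_ * _); rewrite /dpowser ![(m + _) _ _]mxE !unit_tupleE.
have [->//|uv] := eqVneq u v.
rewrite !addr0 -!addrA [unit_tuple nat u + _]addrC; ring.
Qed.

Lemma nb_tsum_deriv (T : choiceType) x0 rho (g : T -> 'rV[K]_k -> K) (B : T -> R) B0 u x :
  (forall t, nbound 0 x0 rho (g t) (B t)) -> bd B B0 -> nv (x - x0) < rho ->
  summ (fun t => pderiv u (g t) x) /\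
  pderiv u (fun y => sum_of (g^~ y)) x = sum_of (fun t => pderiv u (g t) x).
Proof.
move=> h BB hx.
pose r1 := (nv (x - x0) + rho) / 2.
have n0 := nv_ge0 S (x - x0).
have hr1 : nv (x - x0) < r1 by rewrite /r1; lra.
have hr2 : r1 < rho by rewrite /r1; lra.
have r10 : 0 < r1 by apply: le_lt_trans hr1.
have d0 : 0 <= (rho - r1)^-1 by rewrite invr_ge0 subr_ge0 ltW.
have hM : bd (fun t => B t / (rho - r1)) (B0 / (rho - r1)).
  by rewrite mulrC; apply: bd_le (bdZ d0 BB) (lexx _) => t; rewrite mulrC.
have hd t y v : nv (y - x0) < r1 -> differentiable (g t : 'rV[K]_k -> K^o) y /\
    nrm (pderiv v (g t) y) <= B t / (rho - r1).
  move=> hy; have [p1 p2] := nb_deriv v (h t) r10 hr2; split.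
    by apply: p1; exact: lt_trans hr2.
  exact: nb_bound p2 hy.
split; first by apply: summ_le hM => t; case: (hd t x u hr1).
have TW := @termwise_diff R K S k _ g x0 r1 (fun t => B t / (rho - r1)) _ hM.
have /isdiffP [] // : isdiff S (fun y => sum_of (g^~ y)) x
    (fun u => sum_of (fun t => pderiv u (g t) x)).
apply: TW => //.
- by move=> t; rewrite mulr_ge0 // (nb_ge0 (h t)).
- by move=> t y hy; split=> [|v]; [have [] := hd t y u hy|have [] := hd t y v hy].
- move=> y hy; apply: summ_le BB => t; apply: nb_bound (h t) _; exact: lt_trans hr2.
Qed.

(** Each coefficient is killed by an order of vanishing beyond its degree. The radius may depend on
    [N], since the coefficients do not depend on it. *)
Lemma nb_eq0 x0 rho g B : nbound 0 x0 rho g B -> (forall N, exists r b, nbound N x0 r g b) ->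
  forall x, nv (x - x0) < rho -> g x = 0.
Proof.
move=> [a ha _] h x hx.
have a0 m : a m = 0.
  have [r [b [c hc hN]]] := h (mdeg m).+1.
  by rewrite (powser_uniq ha hc) ?hN //; exact: filterE.
have [_ _ /(_ x hx) h2] := ha.
apply: (is_sum_uniq S h2); apply: is_sum_ext (is_sum0 S _) => m.
by rewrite a0 mul0r.
Qed.

End Analytic.

(** * The operators D_u *)

Section Weights.
Variables (R : realType) (n : nat).
Implicit Types (i j t : 'rV[int]_n) (c : 'I_n -> R).

(* The bound c^i q^|i| with |i| = \sum_s |i_s| replaces y^i; the factors q leave
   room on both sides of |y_s| = c_s. *)
Definition wt (c : 'I_n -> R) (i : 'rV[int]_n) : R := \prod_s c s ^ i 0 s.
Definition la (i : 'rV[int]_n) : nat := (\sum_s `|i 0%R s|)%N.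

Lemma wt_gt0 c i : (forall s, 0 < c s) -> 0 < wt c i.
Proof. by move=> c0; apply: prodr_gt0 => s _; rewrite exprz_gt0. Qed.

Lemma wtD c i j : (forall s, 0 < c s) -> wt c (i + j) = wt c i * wt c j.
Proof.
move=> c0; rewrite /wt -big_split; apply: eq_bigr => s _ /=.
by rewrite mxE expfzDr // gt_eqF.
Qed.

Lemma wt_unit c s : wt c (unit_tuple int s) = c s.
Proof.
rewrite /wt (bigD1 s) //= unit_tupleE eqxx expr1z big1 ?mulr1 // => w ws.
by rewrite unit_tupleE (negbTE ws) expr0z.
Qed.

Lemma laD i j : (la (i + j) <= la i + la j)%N.
Proof.
rewrite /la -big_split; apply: leq_sum => s _; rewrite mxE.
by rewrite -lez_nat PoszD !abszE ler_normD.
Qed.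

Lemma laN i : la (- i) = la i.
Proof. by apply: eq_bigr => s _; rewrite mxE abszN. Qed.

Lemma la_unit s : la (unit_tuple int s) = 1%N.
Proof.
rewrite /la (bigD1 s) //= unit_tupleE eqxx big1 // => w ws.
by rewrite unit_tupleE (negbTE ws).
Qed.

Lemma la_shift i m s (q : R) : 1 <= q ->
  q ^+ la (m + i - unit_tuple int s) <= q ^+ la m * q ^+ la i * q.
Proof.
move=> q1; rewrite -exprD -exprSr; apply: ler_weXn2l => //.
by have := laD (m + i) (- unit_tuple int s); rewrite laN la_unit; have := laD m i; lia.
Qed.

Lemma wt_shift c i m s : (forall s, 0 < c s) ->
  wt c (m + i - unit_tuple int s) = wt c m * wt c i / c s.
Proof.
move=> c0; have cs : c s != 0 by rewrite gt_eqF.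
by apply: (mulIf cs); rewrite divfK // -[X in _ * X](wt_unit c s) -!wtD // subrK.
Qed.
End Weights.

Section Operators.
Variables (R : realType) (K : numFieldType) (S : rcs R K) (n k : nat).
Local Notation nv := (@nv R K S k).
Local Notation summ := (summ S).
Local Notation nbound := (@nbound R K S k).
Local Notation J := ('rV[int]_n).
Variable f : 'I_n -> J -> 'I_k -> 'rV[K]_k -> K.
Local Notation h := (hfun f).

(** The Laurent series of [f] in normed form: the majorant over the annuli
    [c_s / q0 <= |y_s| <= c_s q0] is at most [K0]. *)
Definition fbound (x0 : 'rV[K]_k) (rho0 : R) (c : 'I_n -> R) (q0 K0 : R) :=
  [/\ 0 < rho0, forall s, 0 < c s, 1 < q0 &
   forall s u, exists2 b : J -> R, forall m, nbound 0 x0 rho0 (f s m u) (b m) &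
     bd (fun m => b m * wt c m * q0 ^+ la m) K0].

Definition hmul (I' : Type) (u : 'I_k) (A : J -> I' -> 'rV[K]_k -> K) :
    J -> I' -> 'rV[K]_k -> K :=
  fun i j x => sum_of (fun t => h i t u x * A t j x).

Definition Dop (I' : Type) (u : 'I_k) (A : J -> I' -> 'rV[K]_k -> K) :
    J -> I' -> 'rV[K]_k -> K :=
  fun i j x => pderiv u (A i j) x + hmul u A i j x.

Variables (x0 : 'rV[K]_k) (rho0 : R) (c : 'I_n -> R) (q0 K0 : R).
Hypothesis HF : fbound x0 rho0 c q0 K0.

(** [h_bound] costs [K0 * q0 * \sum_s 1 / c_s] times [|i|]; the outer [q0] comes from trading
    [|i| q^|i|] for [q0 q'^|i| / (q' - q)] in [K1_bound]. *)
Definition K1 : R := q0 * (K0 * q0 * \sum_s (c s)^-1).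

Let c0 : forall s, 0 < c s. Proof. by case: HF. Qed.
Let w0 i : 0 < wt c i. Proof. exact: wt_gt0. Qed.
Let q01 : 1 < q0. Proof. by case: HF. Qed.
Let q00 : 0 < q0. Proof. exact: lt_trans q01. Qed.
Let r00 : 0 < rho0. Proof. by case: HF. Qed.

Lemma K0_ge0 (s : 'I_n) (u : 'I_k) : 0 <= K0.
Proof. by case: HF => _ _ _ /(_ s u) [b _ /bd_ge0]. Qed.

Lemma K1_ge0 (u : 'I_k) : 0 <= K0 * q0 * \sum_s (c s)^-1.
Proof.
rewrite mulrAC mulr_ge0 ?(ltW q00) // mulr_sumr sumr_ge0 // => s _.
by rewrite mulr_ge0 ?(K0_ge0 s u) // invr_ge0 ltW.
Qed.

Lemma K1_bound (u : 'I_k) i q q' : 1 <= q -> q <= q0 -> q < q' ->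
  K0 * q0 * (\sum_s (c s)^-1) * (la i)%:R * wt c i * q ^+ la i <=
  K1 / (q' - q) * wt c i * q' ^+ la i.
Proof.
move=> q1 qq qq'; rewrite /K1; set X := K0 * q0 * _.
have X0 : 0 <= X by exact: K1_ge0.
have d0 : 0 < q' - q by rewrite subr_gt0.
have qp : 0 <= q by apply: le_trans q1.
have Y : (la i)%:R * q ^+ la i <= q0 * q' ^+ la i / (q' - q).
  rewrite ler_pdivlMr //; apply: (@le_trans _ _ (q * q' ^+ la i)); last first.
    by rewrite ler_wpM2r // exprn_ge0 // (le_trans qp) // ltW.
  have := pow_deriv_bound (la i) qp (ltW qq') => /(ler_wpM2l qp); apply: le_trans.
  case: (la i) => [|m]; first by rewrite !mul0r mulr0.
  by rewrite /= exprS le_eqVlt; apply/orP; left; apply/eqP; ring.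
have XW : 0 <= X * wt c i by rewrite mulr_ge0 // ltW.
have -> : X * (la i)%:R * wt c i * q ^+ la i = X * wt c i * ((la i)%:R * q ^+ la i) by ring.
apply: le_trans (ler_wpM2l XW Y) _; apply: le_of_eq; ring.
Qed.

(** With [m = t - i + {s}] the weight of [t] splits into those of [m] and [i], up to [1 / c_s] and
    one factor [q]. The coefficient [i_s] remains as [la i]: it is the reason why [h] is
    unbounded. *)
Lemma h_bound u i : exists2 b : J -> R, forall t, nbound 0 x0 rho0 (h i t u) (b t) &
  forall q, 1 <= q -> q <= q0 ->
    bd (fun t => b t * wt c t * q ^+ la t) (K0 * q0 * (\sum_s (c s)^-1) * ((la i)%:R * wt c i * q ^+ la i)).
Proof.
have hb0 s : exists b : J -> R, (forall m, nbound 0 x0 rho0 (f s m u) (b m)) /\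
     bd (fun m => b m * wt c m * q0 ^+ la m) K0.
  by case: HF => _ _ _ /(_ s u) [b h1 h2]; exists b.
have [b hb] := choice hb0.
exists (fun t => \sum_s (`|i 0%R s|%N)%:R * b s (t - i + unit_tuple int s)).
  move=> t; apply: nb_fsum => // s; rewrite -(nrm_int S); apply: nbZ.
  exact: (hb s).1.
move=> q q1 qq; pose D s := (c s)^-1 * q0 * (wt c i * q ^+ la i) * K0.
have bs s : bd (fun t => b s (t - i + unit_tuple int s) * wt c t * q ^+ la t) (D s).
  have cs0 : 0 < (c s)^-1 by rewrite invr_gt0.
  have qi : 0 <= q ^+ la i by rewrite exprn_ge0 // (le_trans ler01).
  have sh_inj : injective (fun t : J => t - i + unit_tuple int s).
    by move=> t t' /addIr /addIr.
  have D0 : 0 <= (c s)^-1 * q0 * (wt c i * q ^+ la i).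
    by rewrite !mulr_ge0 ?(ltW cs0) ?(ltW q00) ?(ltW (w0 i)).
  apply: bd_le (bdZ D0 (bd_inj sh_inj (hb s).2)) (lexx _) => t.
  set m := t - i + _; have -> : t = m + i - unit_tuple int s.
    by rewrite /m addrAC addrK subrK.
  rewrite wt_shift //.
  have b0 := nb_ge0 ((hb s).1 m).
  have := la_shift i m s q1 => hq.
  have hq2 : q ^+ la (m + i - unit_tuple int s) <= q0 ^+ la m * q ^+ la i * q0.
    apply: le_trans hq _; apply: ler_pM; rewrite ?mulr_ge0 ?exprn_ge0 ?(le_trans ler01) //.
    by rewrite ler_wpM2r // lerXn2r ?nnegrE ?(ltW q00) // (le_trans ler01).
  have X : 0 <= b s m * (wt c m * wt c i / c s).
    by rewrite !mulr_ge0 ?(ltW (w0 _)) ?(ltW cs0).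
  apply: le_trans (ler_wpM2l X hq2) _; apply: le_of_eq.
  by move: (b s m) (wt c m) (wt c i) (c s)^-1 (q0 ^+ la m) (q ^+ la i) => *; ring.
have hs := bd_sum (fun s => bdZ (ler0n R (`|i 0%R s|%N)) (bs s)).
apply: bd_le hs _ => [t|].
  rewrite -mulrA mulr_suml; apply: ler_sum => s _; by rewrite !mulrA.
rewrite [leRHS](_ : _ = \sum_s (la i)%:R * D s); last first.
  rewrite -mulr_sumr /D -!mulr_suml; ring.
apply: ler_sum => s _; apply: ler_wpM2r.
  rewrite /D !mulr_ge0 ?invr_ge0 ?(ltW (c0 _)) ?(ltW q00) ?(ltW (w0 i)) ?(K0_ge0 s u) //.
  by rewrite exprn_ge0 // (le_trans ler01).
by rewrite ler_nat /la (bigD1 s) //= leq_addr.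
Qed.

(** A weighted operator norm. The rows sum the majorants [b] instead of values at a point, so that
    products and series of such matrices are again analytic. *)
Definition mcb N rho q (I' : choiceType) (om : I' -> R) (A : J -> I' -> 'rV[K]_k -> K) M :=
  exists2 b : J -> I' -> R, forall i j, nbound N x0 rho (A i j) (b i j) &
    forall i, bd (fun j => b i j * om j) (M * wt c i * q ^+ la i).

Section Mcb.
Variables (I' : choiceType) (om : I' -> R).
Hypothesis om0 : forall j, 0 < om j.
Implicit Types (A : J -> I' -> 'rV[K]_k -> K).

Lemma mcb_mono N N' rho rho' q q' A M M' : mcb N rho q om A M ->
  (N' <= N)%N -> 0 < rho' -> rho' <= rho -> 0 <= q -> q <= q' -> 0 <= M -> M <= M' ->
  mcb N' rho' q' om A M'.
Proof.
move=> [b b1 b2] NN r0 rr qq0 qq M0 MM; exists b.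
  by move=> i j; exact: nb_mono (b1 i j) NN r0 rr _.
move=> i; apply: bdW (b2 i) _.
apply: ler_pM; rewrite ?mulr_ge0 ?exprn_ge0 ?(ltW (w0 i)) //.
  by rewrite ler_wpM2r // ltW.
by rewrite lerXn2r ?nnegrE ?(le_trans qq0).
Qed.

Lemma mcbD N rho q A A' M M' : mcb N rho q om A M -> mcb N rho q om A' M' ->
  mcb N rho q om (fun i j x => A i j x + A' i j x) (M + M').
Proof.
move=> [b b1 b2] [b' b1' b2']; exists (fun i j => b i j + b' i j).
  by move=> i j; exact: nbD.
move=> i; rewrite !mulrDl; apply: bd_le (bdD (b2 i) (b2' i)) (lexx _) => j.
by rewrite mulrDl.
Qed.

Lemma mcb_pderiv N rho rho' q A M u : mcb N rho q om A M -> 0 < rho' -> rho' < rho ->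
  mcb N.-1 rho' q om (fun i j => pderiv u (A i j)) (M / (rho - rho')).
Proof.
move=> [b b1 b2] r0 rr; exists (fun i j => b i j / (rho - rho')).
  by move=> i j; case: (nb_deriv u (b1 i j) r0 rr).
have d0 : 0 <= (rho - rho')^-1 by rewrite invr_ge0 subr_ge0 ltW.
move=> i; apply: bd_le (bdZ d0 (b2 i)) _ => [j|].
  by rewrite -mulrA mulrCA lexx.
by rewrite -!mulrA mulrCA !mulrA.
Qed.

(** The factor [|i|] of [h_bound] is absorbed by raising [q] to [q']. Bounds for the entries of the
    product come from exchanging the sums over [t] and [j], which is where the positivity of [om]
    enters. *)
Lemma mcb_hmul N rho q q' A M u : mcb N rho q om A M -> 0 <= M -> 0 < rho -> rho <= rho0 ->
  1 <= q -> q <= q0 -> q < q' ->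
  (forall i j x, nv (x - x0) < rho -> summ (fun t => h i t u x * A t j x)) /\
  mcb N rho q' om (hmul u A) (M * (K1 / (q' - q))).
Proof.
move=> [b b1 b2] M0 r0 rr q1 qq qq'.
have hh i : exists bh : J -> R, (forall t, nbound 0 x0 rho (h i t u) (bh t)) /\
   bd (fun t => bh t * (M * wt c t * q ^+ la t)) (M * (K0 * q0 * (\sum_s (c s)^-1) * ((la i)%:R * wt c i * q ^+ la i))).
  have [bh h1 h2] := h_bound u i; exists bh; split.
    by move=> t; exact: nb_mono (h1 t) (leqnn _) r0 rr (lexx _).
  by apply: bd_le (bdZ M0 (h2 q q1 qq)) (lexx _) => t; rewrite -!mulrA mulrCA.
have [bh hbh] := choice hh.
pose p i t j := bh i t * (b t j * om j).
have bh0 i t : 0 <= bh i t by exact: nb_ge0 ((hbh i).1 t).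
have bp0 t j : 0 <= b t j by exact: nb_ge0 (b1 t j).
have hQ i : exists Q : I' -> R, (forall j, bd (fun t => bh i t * b t j) (Q j)) /\
   bd (fun j => Q j * om j) (M * (K0 * q0 * (\sum_s (c s)^-1) * ((la i)%:R * wt c i * q ^+ la i))).
  have [|t|Q Q1 Q2] := bd_swap (p := p i) _ _ (hbh i).2.
  - by move=> t j; rewrite /p !mulr_ge0 // ltW.
  - exact: bdZ (b2 t).
  have oi j : 0 <= (om j)^-1 by rewrite invr_ge0 ltW.
  exists (fun j => Q j / om j); split; last first.
    by apply: bd_le Q2 (lexx _) => j; rewrite divfK // gt_eqF.
  move=> j; rewrite mulrC; apply: bd_le (bdZ (oi j) (Q1 j)) (lexx _) => t.
  by rewrite /p mulrA mulrCA mulVf ?mulr1 // gt_eqF.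
have [Q hQ'] := choice hQ.
have main i j := nb_tsum r0 (fun t => nbM ((hbh i).1 t) (b1 t j)) ((hQ' i).1 j).
split; first by move=> i j x hx; exact: (main i j).1.
exists Q; first by move=> i j; exact: (main i j).2.
move=> i; apply: bdW (hQ' i).2 _; rewrite -!mulrA; apply: ler_wpM2l => //.
by have := K1_bound u i q1 qq qq'; rewrite -!mulrA.
Qed.
End Mcb.
End Operators.

(** * The scale of norms and the commutator of two operators *)

Section Scale.
Variables (R : realType) (K : numFieldType) (S : rcs R K) (n k : nat).
Local Notation rcr := (rcr S).
Local Notation nrm := (nrm S).
Local Notation nv := (@nv R K S k).
Local Notation summ := (summ S).
Local Notation nbound := (@nbound R K S k).
Local Notation J := ('rV[int]_n).
Variable f : 'I_n -> J -> 'I_k -> 'rV[K]_k -> K.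
Local Notation h := (hfun f).
Variables (x0 : 'rV[K]_k) (rho0 : R) (c : 'I_n -> R) (q0 K0 : R).
Hypothesis HF : fbound S f x0 rho0 c q0 K0.
Local Notation mcb := (mcb S x0 c).
Local Notation K1 := (K1 c q0 K0).

Let c0 : forall s, 0 < c s. Proof. by case: HF. Qed.
Let w0 i : 0 < wt c i. Proof. exact: wt_gt0. Qed.
Let q01 : 1 < q0. Proof. by case: HF. Qed.
Let q00 : 0 < q0. Proof. exact: lt_trans q01. Qed.
Let r00 : 0 < rho0. Proof. by case: HF. Qed.

(* The levels 0 <= s <= 1 interpolate between (rho0, 1) and (rho0 / 2, q0).
   Raising the level from s to s' costs a factor [Dcost / (s' - s)] for each D_u,
   so l operators, spread evenly, cost (l Dcost / (s' - s))^l. *)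
Definition rs (s : R) := rho0 * (1 - s / 2).
Definition qs (s : R) := 1 + s * (q0 - 1).
Definition scb N s (I' : choiceType) (om : I' -> R) A M := mcb N (rs s) (qs s) om A M.
Definition Dcost := 2 / rho0 + K1 / (q0 - 1).

Lemma rs_gt0 s : s <= 1 -> 0 < rs s.
Proof. by move=> s1; rewrite /rs mulr_gt0 //; lra. Qed.

Lemma rs_anti s s' : s <= s' -> rs s' <= rs s.
Proof. by move=> ss; rewrite /rs ler_pM2l //; lra. Qed.

Lemma rs_lt s s' : s < s' -> rs s' < rs s.
Proof. by move=> ss; rewrite /rs ltr_pM2l //; lra. Qed.

Lemma qs_mono s s' : s <= s' -> qs s <= qs s'.
Proof. by move=> ss; rewrite /qs lerD2l ler_wpM2r // subr_ge0 ltW. Qed.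

Lemma qs_ge1 s : 0 <= s -> 1 <= qs s.
Proof. by move=> s0; rewrite /qs lerDl mulr_ge0 // subr_ge0 ltW. Qed.

Lemma qs1 : qs 1 = q0.
Proof. by rewrite /qs; ring. Qed.

Lemma rs0 : rs 0 = rho0.
Proof. by rewrite /rs; ring. Qed.

Lemma Dcost_ge0 (u : 'I_k) : 0 <= Dcost.
Proof.
rewrite /Dcost addr_ge0 ?divr_ge0 ?(ltW r00) // ?subr_ge0 ?(ltW q01) //.
by rewrite /K1 mulr_ge0 ?(ltW q00) // (K1_ge0 HF u).
Qed.

Section Om.
Variables (I' : choiceType) (om : I' -> R).
Hypothesis om0 : forall j, 0 < om j.
Implicit Types (A : J -> I' -> 'rV[K]_k -> K).

Lemma scb_mono N s s' A M M' : scb N s om A M -> 0 <= s -> s <= s' -> s' <= 1 ->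
  0 <= M -> M <= M' -> scb N s' om A M'.
Proof.
move=> h s0 ss s1 M0 MM; apply: (mcb_mono HF h) => //.
- exact: rs_gt0.
- exact: rs_anti.
- by apply: le_trans (qs_ge1 s0).
- exact: qs_mono.
Qed.

Lemma Dop_scb N s s' A M u : scb N s om A M -> 0 <= s -> s < s' -> s' <= 1 -> 0 <= M ->
  scb N.-1 s' om (Dop f u A) (M * (Dcost / (s' - s))).
Proof.
move=> hA s0 ss s1 M0.
have ss' := ltW ss; have sl1 : s <= 1 by apply: le_trans s1.
have h1 := mcb_pderiv u hA (rs_gt0 s1) (rs_lt ss).
have qq : qs s <= q0 by rewrite -qs1 qs_mono.
have qq' : qs s < qs s' by rewrite /qs ltrD2l ltr_pM2r // subr_gt0.
have rr : rs s <= rho0 by rewrite -[leRHS]rs0 rs_anti.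
have [_ h2] := mcb_hmul HF om0 u hA M0 (rs_gt0 sl1) rr (qs_ge1 s0) qq qq'.
(* The gaps of [rs] and [qs] are linear in [s' - s], so the loss from the derivative and the loss
   from [h] are exactly the two terms of [Dcost]. *)
have L1 : M / (rs s - rs s') = M * (2 / rho0 / (s' - s)).
  have -> : rs s - rs s' = rho0 * (s' - s) / 2 by rewrite /rs; field.
  by field; rewrite !gt_eqF // subr_gt0.
have L2 : M * (K1 / (qs s' - qs s)) = M * (K1 / (q0 - 1) / (s' - s)).
  have -> : qs s' - qs s = (q0 - 1) * (s' - s) by rewrite /qs; ring.
  by field; rewrite !gt_eqF // ?subr_gt0 //.
have -> : M * (Dcost / (s' - s)) = M / (rs s - rs s') + M * (K1 / (qs s' - qs s)).
  by rewrite L1 L2 -mulrDr -mulrDl.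
apply: mcbD.
  apply: (mcb_mono HF h1) => //; rewrite ?rs_gt0 ?qs_mono //.
    by apply: le_trans (qs_ge1 s0).
  by rewrite divr_ge0 // subr_ge0 ltW // rs_lt.
apply: (mcb_mono HF h2); rewrite ?rs_gt0 ?rs_anti ?leq_pred //.
- by apply: le_trans (qs_ge1 (le_trans s0 ss')).
- rewrite mulr_ge0 // divr_ge0 ?subr_ge0 ?(ltW qq') //.
  by rewrite /K1 mulr_ge0 ?(ltW q00) // (K1_ge0 HF u).
Qed.

Definition Dword (l : seq 'I_k) (A : J -> I' -> 'rV[K]_k -> K) := foldr (fun u B => Dop f u B) A l.

Lemma Dword_scb s s' A M l : scb 0 s om A M -> 0 <= s -> s < s' -> s' <= 1 -> 0 <= M ->
  scb 0 s' om (Dword l A) (M * ((size l)%:R * (Dcost / (s' - s))) ^+ size l).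
Proof.
move=> hA s0 ss s1 M0; have d0 : 0 < s' - s by rewrite subr_gt0.
(* The step [d] below divides by the length of the word. *)
have [->|] := eqVneq l [::].
  by rewrite expr0 mulr1; apply: scb_mono hA _ (ltW ss) _ _ _.
case: l => // u0 l0 _; set l := u0 :: l0; set N := size l.
have N0 : (0 : R) < N%:R by rewrite ltr0n.
pose d := (s' - s) / N%:R.
have dp : 0 < d by rewrite divr_gt0.
have claim l' : (size l' <= N)%N ->
    scb 0 (s + (size l')%:R * d) om (Dword l' A) (M * (Dcost / d) ^+ size l').
  elim: l' => [|u l' IH] sl; first by rewrite mul0r addr0 expr0 mulr1.
  have {}IH := IH (ltnW sl).
  have LL : 0 <= Dcost / d by rewrite divr_ge0 ?(Dcost_ge0 u) // ltW.
  have a1 : 0 <= s + (size l')%:R * d by rewrite addr_ge0 // mulr_ge0 // ltW.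
  have a2 : s + (size l')%:R * d < s + (size (u :: l'))%:R * d.
    by rewrite ltrD2l ltr_pM2r // ltr_nat.
  have a3 : s + (size (u :: l'))%:R * d <= 1.
    apply: (@le_trans _ _ (s + N%:R * d)); first by rewrite lerD2l ler_pM2r // ler_nat.
    by rewrite /d mulrC divfK ?gt_eqF //; lra.
  have a4 : 0 <= M * (Dcost / d) ^+ size l' by rewrite mulr_ge0 // exprn_ge0.
  have := Dop_scb u IH a1 a2 a3 a4.
  have -> : s + (size (u :: l'))%:R * d - (s + (size l')%:R * d) = d.
    by rewrite /= -natr1; ring.
  have -> : M * (Dcost / d) ^+ size (u :: l') = M * (Dcost / d) ^+ size l' * (Dcost / d).
    by rewrite -[size (u :: l')]/(size l').+1 exprSr -!mulrA.
  by [].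
have := claim l (leqnn _); rewrite -/N.
have -> : s + N%:R * d = s' by rewrite /d mulrC divfK ?gt_eqF //; ring.
by have -> : Dcost / d = N%:R * (Dcost / (s' - s)) by rewrite /d; field; rewrite !gt_eqF.
Qed.

Lemma mcb_entry N rho q A M i j : mcb N rho q om A M ->
  nbound N x0 rho (A i j) (M * wt c i * q ^+ la i / om j).
Proof.
move=> [b b1 b2]; apply: nb_le (b1 i j) _.
by rewrite ler_pdivlMr //; exact: (bd_term j (b2 i)).
Qed.

End Om.

Lemma h_num u i x (a : J -> K) q q' M : nv (x - x0) < rho0 -> 1 <= q -> q <= q0 -> q < q' ->
  0 <= M -> (forall t, nrm (a t) <= M * wt c t * q ^+ la t) ->
  bd (fun t => nrm (h i t u x * a t)) (M * (K1 / (q' - q)) * wt c i * q' ^+ la i).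
Proof.
move=> hx q1 qq qq' M0 ha; have [b h1 h2] := h_bound HF u i.
apply: bd_le (bdZ M0 (h2 q q1 qq)) _ => [t|].
  rewrite nrmM (_ : M * _ = b t * (M * wt c t * q ^+ la t)); last by ring.
  by apply: ler_pM; rewrite ?nrm_ge0 //; exact: nb_bound (h1 t) hx.
rewrite -!mulrA; apply: ler_wpM2l => //.
by have := K1_bound HF u i q1 qq qq'; rewrite -!mulrA.
Qed.

Lemma h_mul_nb N rho q u i (a : J -> 'rV[K]_k -> K) M : 0 < rho -> rho <= rho0 ->
  1 <= q -> q <= q0 -> 0 <= M ->
  (forall t, nbound N x0 rho (a t) (M * wt c t * q ^+ la t)) ->
  exists B B0, (forall t, nbound N x0 rho (fun x => h i t u x * a t x) (B t)) /\ bd B B0.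
Proof.
move=> r0 rr q1 qq M0 ha; have [b h1 h2] := h_bound HF u i.
exists (fun t => b t * (M * wt c t * q ^+ la t)); eexists; split.
  move=> t; rewrite -[N]add0n; apply: nbM (ha t).
  exact: nb_mono (h1 t) _ r0 rr _.
apply: bd_le (bdZ M0 (h2 q q1 qq)) (lexx _) => t.
by apply: le_of_eq; ring.
Qed.

Lemma pderivD_nb N N' rho g g' B B' u x : nbound N x0 rho g B -> nbound N' x0 rho g' B' -> nv (x - x0) < rho ->
  pderiv u (fun y => g y + g' y) x = pderiv u g x + pderiv u g' x.
Proof.
move=> h1 h2 hx; rewrite /pderiv.
have d1 := diff_derivable (v := unit_tuple K u) (nb_diff h1 hx).
have d2 := diff_derivable (v := unit_tuple K u) (nb_diff h2 hx).
exact: (deriveD (f := g : _ -> K^o) (g := g' : _ -> K^o) d1 d2).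
Qed.

(* All the series in D_u D_v a may be rearranged because a loses only a little of
   its bound with each operator. *)
Lemma Dop_Dop rho q u v i (a : J -> 'rV[K]_k -> K) M x : 0 < rho -> rho <= rho0 ->
  1 <= q -> q < q0 -> 0 <= M -> (forall t, nbound 0 x0 rho (a t) (M * wt c t * q ^+ la t)) ->
  nv (x - x0) < rho ->
  let D w b := fun i x => pderiv w (b i) x + sum_of (fun t => h i t w x * b t x) in
  [/\ summ (fun t => pderiv u (h i t v) x * a t x),
      summ (fun t => h i t v x * pderiv u (a t) x) /\
      summ (fun t => h i t u x * pderiv v (a t) x),
      (forall t', summ (fun t => h t t' v x * h i t u x)),
      summ (fun t' => sum_of (fun t => h t t' v x * h i t u x) * a t' x) &
  D u (D v a) i x = pderiv u (pderiv v (a i)) x +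
    sum_of (fun t => pderiv u (h i t v) x * a t x) +
    (sum_of (fun t => h i t v x * pderiv u (a t) x) + sum_of (fun t => h i t u x * pderiv v (a t) x)) +
    sum_of (fun t' => sum_of (fun t => h t t' v x * h i t u x) * a t' x)].
Proof.
move=> r0 rr q1 qq M0 ha hx D.
pose r1 := (nv (x - x0) + rho) / 2.
have n0 := nv_ge0 S (x - x0).
have hr1 : nv (x - x0) < r1 by rewrite /r1; lra.
have hr2 : r1 < rho by rewrite /r1; lra.
have r10 : 0 < r1 by apply: le_lt_trans hr1.
have hx0 : nv (x - x0) < rho0 by apply: lt_le_trans rr.
have [B [B0 [hB hB0]]] := h_mul_nb v i r0 rr q1 (ltW qq) M0 ha.
have [s1 e1] := nb_tsum_deriv u hB hB0 hx.
have [ss0 nbs] := nb_tsum r0 hB hB0.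
have dh t w : differentiable (h i t w : 'rV[K]_k -> K^o) x.
  by have [b h1 _] := h_bound HF w i; exact: nb_diff (h1 t) hx0.
have da t : differentiable (a t : 'rV[K]_k -> K^o) x by exact: nb_diff (ha t) hx.
have e2 t : pderiv u (fun y => h i t v y * a t y) x =
    h i t v x * pderiv u (a t) x + pderiv u (h i t v) x * a t x.
  by case: (pderivM u (dh t v) (da t)).
pose M1 := M / (rho - r1).
have M10 : 0 <= M1 by rewrite divr_ge0 // subr_ge0 ltW.
have dan t w : nrm (pderiv w (a t) x) <= M1 * wt c t * q ^+ la t.
  have [_ p] := nb_deriv w (ha t) r10 hr2.
  by apply: le_trans (nb_bound p hr1) _; rewrite le_eqVlt /M1; apply/orP; left; apply/eqP; ring.
have sd w w' : summ (fun t => h i t w x * pderiv w' (a t) x).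
  eexists; exact: (h_num w i hx0 q1 (ltW qq) qq M10 (fun t => dan t w')).
have s2 : summ (fun t => pderiv u (h i t v) x * a t x).
  have := summD s1 (summN (sd v u)); apply: summ_ext => t.
  by rewrite e2; ring.
have e3 : pderiv u (fun y => sum_of (fun t => h i t v y * a t y)) x =
   sum_of (fun t => h i t v x * pderiv u (a t) x) + sum_of (fun t => pderiv u (h i t v) x * a t x).
  rewrite e1 -(@sum_ofD _ _ S) //; apply: sum_of_ext => t; exact: e2.
have an t : nrm (a t x) <= M * wt c t * q ^+ la t by exact: nb_bound (ha t) hx.
(* Two products with [h] are nested: the inner one raises [q] to [q2], the outer one [q2] to
   [q0]. *)
pose q2 := (q + q0) / 2.
have q21 : q < q2 by rewrite /q2; lra.
have q22 : q2 < q0 by rewrite /q2; lra.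
have q23 : 1 <= q2 by lra.
pose M2 := M * (K1 / (q2 - q)).
have M20 : 0 <= M2.
  rewrite /M2 mulr_ge0 // divr_ge0 ?subr_ge0 ?(ltW q21) //.
  by rewrite /K1 mulr_ge0 ?(ltW q00) // (K1_ge0 HF u).
have row t : bd (fun t' => nrm (h t t' v x * a t' x)) (M2 * wt c t * q2 ^+ la t).
  exact: (h_num v t hx0 q1 (ltW qq) q21 M0 an).
pose P t := nrm (h i t u x) * (M2 * wt c t * q2 ^+ la t).
have row2 t : bd (fun t' => nrm (h i t u x * (h t t' v x * a t' x))) (P t).
  by apply: bd_le (bdZ (nrm_ge0 S (h i t u x)) (row t)) (lexx _) => t'; rewrite nrmM.
have [PB hP] : exists PB, bd P PB.
  have W t : 0 <= M2 * wt c t * q2 ^+ la t.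
    exact: mulr_ge0 (mulr_ge0 M20 (ltW (w0 t))) (exprn_ge0 _ (le_trans ler01 q23)).
  (* Applied to the weights themselves, [h_num] bounds row [i] of [h] against the bounds of the
     inner sums. *)
  have H := @h_num u i x (fun t => rcr (M2 * wt c t * q2 ^+ la t)) q2 q0 M2 hx0 q23 (ltW q22) q22 M20.
  eexists; apply: bd_le (H _) (lexx _) => t; last by rewrite nrm_rcr ger0_norm.
  by rewrite nrmM nrm_rcr ger0_norm.
case: (fubini row2 hP) => f1 f2 f3 f4 f5 f6 f7.
have srow t : summ (fun t' => h t t' v x * a t' x) by eexists; exact: row.
have bh0 t' : summ (fun t => h t t' v x * h i t u x).
  (* [e] is a column of the identity matrix; [h_num] for it bounds column [t'] of [h]. *)
  pose e s : K := if s == t' then 1 else 0.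
  have W' : 0 <= (wt c t')^-1 by rewrite invr_ge0 ltW.
  have he s : nrm (e s) <= (wt c t')^-1 * wt c s * 1 ^+ la s.
    rewrite /e expr1n mulr1; case: eqP => [->|_]; first by rewrite nrm1 mulVf ?gt_eqF.
    by rewrite nrm0 mulr_ge0 // ltW.
  have q24 : 1 < q2 by lra.
  have r t := h_num v t hx0 (lexx 1) (ltW q01) q24 W' he.
  pose M3 := (wt c t')^-1 * (K1 / (q2 - 1)).
  have M30 : 0 <= M3.
    rewrite /M3 mulr_ge0 // divr_ge0 ?subr_ge0 ?(ltW q24) //.
    by rewrite /K1 mulr_ge0 ?(ltW q00) // (K1_ge0 HF u).
  have hb t : nrm (h t t' v x) <= M3 * wt c t * q2 ^+ la t.
    by have := bd_term t' (r t); rewrite /e eqxx mulr1.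
  eexists; apply: bd_le (h_num u i hx0 q23 (ltW q22) q22 M30 hb) (lexx _) => t.
  by rewrite mulrC.
have sH t' : sum_of (fun t => h i t u x * (h t t' v x * a t' x)) =
   sum_of (fun t => h t t' v x * h i t u x) * a t' x.
  rewrite mulrC -(@sum_ofZ _ _ S) //; apply: sum_of_ext => t; ring.
have sHs : summ (fun t' => sum_of (fun t => h t t' v x * h i t u x) * a t' x).
  by move: f5; apply: summ_ext => t'; rewrite sH.
split=> //.
rewrite /D.
have [_ nbp] := nb_deriv v (ha i) r10 hr2.
have nbs' := nb_mono nbs (leqnn _) r10 (ltW hr2) (lexx _).
rewrite (pderivD_nb u nbp nbs' hr1) e3.
have -> : sum_of (fun t => h i t u x * (pderiv v (a t) x + sum_of (fun t' => h t t' v x * a t' x))) =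
   sum_of (fun t => h i t u x * pderiv v (a t) x) +
   sum_of (fun t => sum_of (fun t' => h i t u x * (h t t' v x * a t' x))).
  rewrite -(@sum_ofD _ _ S) //; apply: sum_of_ext => t.
  by rewrite mulrDr -(@sum_ofZ _ _ S).
rewrite f6 -f7 (sum_of_ext sH).
by move: (pderiv u _ x) (sum_of _) (sum_of _) (sum_of _) (sum_of _) => *; ring.
Qed.

(** In the expansion of [Dop_Dop] the second derivatives commute and the terms with one derivative
    on [a] are symmetric in [u] and [v]; the rest is the curvature applied to [a]. *)
Lemma commutator rho q u v i (a : J -> 'rV[K]_k -> K) M x : 0 < rho -> rho <= rho0 ->
  1 <= q -> q < q0 -> 0 <= M -> (forall t, nbound 0 x0 rho (a t) (M * wt c t * q ^+ la t)) ->
  nv (x - x0) < rho ->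
  let D w b := fun i x => pderiv w (b i) x + sum_of (fun t => h i t w x * b t x) in
  summ (fun t => Rfun f i t u v x * a t x) /\
  D u (D v a) i x - D v (D u a) i x = sum_of (fun t => Rfun f i t u v x * a t x).
Proof.
move=> r0 rr q1 qq M0 ha hx D.
have [s1 [s2 s3] s4 s5 E1] := Dop_Dop u v i r0 rr q1 qq M0 ha hx.
have [t1 [t2 t3] t4 t5 E2] := Dop_Dop v u i r0 rr q1 qq M0 ha hx.
have RE : (fun t => Rfun f i t u v x * a t x) = (fun t =>
    (pderiv u (h i t v) x * a t x - pderiv v (h i t u) x * a t x) +
    (sum_of (fun t' => h t' t v x * h i t' u x) * a t x -
     sum_of (fun t' => h t' t u x * h i t' v x) * a t x)).
  by apply/funext => t; rewrite /Rfun; ring.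
have S1 := summD s1 (summN t1); have S2 := summD s5 (summN t5).
rewrite RE; split; first exact: summD.
rewrite (sum_ofD S1 S2) !(@sum_ofB _ _ S) //.
have sw : pderiv u (pderiv v (a i)) x = pderiv v (pderiv u (a i)) x.
  exact: nb_schwarz (ha i) hx.
rewrite /D in E1 E2 *; rewrite E1 E2 sw.
by move: (pderiv v _ x) (sum_of _) (sum_of _) (sum_of _) (sum_of _) (sum_of _) (sum_of _) => *; ring.
Qed.

End Scale.

(** * The matrix Z *)

Section Counting.
Variables (R : realType) (k : nat).
Implicit Types (w : 'rV[nat]_k).

(** [m^m] is at most the falling factorial of [2m] of length [m], which is [C(2m, m) m!], and
    [C(2m, m) <= 2^(2m)]. *)
Lemma pow_fact m : (m ^ m <= 4 ^ m * m`!)%N.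
Proof.
apply: (@leq_trans ('C(m.*2, m) * m`!)%N).
  rewrite bin_ffact; suff H r : (r <= m)%N -> (m ^ r <= (m.*2) ^_ r)%N by exact: H.
  elim: r => [|r IH] rm; first by rewrite expn0 ffactn0.
  rewrite expnSr ffactnSr leq_mul ?IH ?(ltnW rm) //; lia.
rewrite leq_mul2r; apply/orP; right; rewrite (_ : 4 = 2 ^ 2)%N // -expnM mul2n.
have : (\sum_(i < m.*2.+1) 'C(m.*2, i) = 2 ^ m.*2)%N.
  have := Pascal 1 1 m.*2; rewrite addn1 => ->.
  by apply: eq_bigr => i _; rewrite !exp1n !muln1.
move=> <-; have hm : (m < m.*2.+1)%N by lia.
by rewrite (bigD1 (Ordinal hm)) //= leq_addr.
Qed.

Definition wfact w : nat := (\prod_(u < k) (w 0%R u)`!)%N.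

Lemma wfact_gt0 w : (0 < wfact w)%N.
Proof. by apply: prodn_gt0 => u; exact: fact_gt0. Qed.

(* With [pow_fact], this turns |w|^|w| into a geometric multiple of w!, which the
   factors 1 / w! of the Taylor series absorb. *)
Lemma fact_multi w : ((mdeg w)`! <= k ^ mdeg w * wfact w)%N.
Proof.
move en : (mdeg w) => N; elim: N w en => [|N IH] w en.
  by rewrite fact0 expn0 mul1n wfact_gt0.
(* Pigeonhole: some coordinate is at least [|w| / k]. Removing a unit from it divides [|w|!] by
   [|w|] and the right side by [k w_u >= |w|]. *)
have [u hu] : exists u, (N.+1 <= k * w 0%R u)%N.
  apply/existsP; apply: contraT; rewrite negb_exists => /forallP hu.
  have [u0 _] : exists u, (0 < w 0%R u)%N by apply: mdeg_pos; rewrite en.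
  have k0 : (0 < k)%N by case: k u0 {hu} => [[]|].
  have : (\sum_(u < k) k * w 0%R u < \sum_(u < k) N.+1)%N.
    rewrite (bigD1 u0) //= [in leqRHS](bigD1 u0) //= -addSn leq_add //.
      by rewrite ltnNge hu.
    by apply: leq_sum => u _; apply: ltnW; rewrite ltnNge hu.
  by rewrite -big_distrr /= -/(mdeg w) en sum_nat_const card_ord ltnn.
have wu : (0 < w 0%R u)%N by move: hu; case: (w 0 u) => //; rewrite muln0.
have [w' hw'] := rV_pos wu.
have en' : mdeg w' = N by move: en; rewrite hw' mdegD mdeg_unit addn1 => -[].
have wf : wfact w = (w 0%R u * wfact w')%N.
  rewrite /wfact (bigD1 u) //= [in RHS](bigD1 u) //= mulnA.
  have -> : w 0 u = (w' 0 u).+1.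
    by rewrite hw' mxE unit_tupleE eqxx -[(_ + _)%R]/(_ + 1)%N addn1.
  rewrite factS; congr (_ * _)%N; apply: eq_bigr => v vu.
  by rewrite hw' mxE unit_tupleE (negbTE vu) addr0.
rewrite factS wf expnS mulnACA; apply: leq_mul => //; exact: IH.
Qed.

(** A finite set of multi-indices lies in a cube, over which the sum of products is a product of [k]
    one-variable sums. *)
Lemma bd_box (p : nat -> R) B : (forall i, 0 <= p i) -> (forall N, \sum_(i < N) p i <= B) ->
  bd (fun w => \prod_(u < k) p (w 0 u)) (B ^+ k).
Proof.
move=> p0 hB A.
have [N hN] : exists N, forall w, w \in A -> forall u, (w 0%R u < N)%N.
  exists (\sum_(w <- A) mdeg w).+1 => w wA u; rewrite ltnS (big_fsetD1 w) //=.
  by rewrite /mdeg (bigD1 u) //= -addnA leq_addr.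
pose F (g : {ffun 'I_k -> 'I_N}) : 'rV[nat]_k := \row_u (g u : nat).
apply: (@le_trans _ _ (\sum_(g : {ffun 'I_k -> 'I_N}) \prod_u p (g u))); last first.
  rewrite -(bigA_distr_bigA (fun u (i : 'I_N) => p i)) /= -[X in _ ^+ X]card_ord -prodr_const.
  apply: ler_prod => u _; rewrite sumr_ge0 //=; exact: hB.
have Fi : injective F.
  move=> g g' /rowP e; apply/ffunP => u; apply: val_inj.
  by have := e u; rewrite !mxE.
apply: (@le_trans _ _ (\sum_(w <- [fset F g | g in {ffun 'I_k -> 'I_N}]%fset) \prod_(u < k) p (w 0 u))).
  apply: sum_fset_sub; first by move=> w; exact: prodr_ge0.
  apply/fsubsetP => w wA; apply/imfsetP => /=.
  exists [ffun u => Ordinal (hN w wA u)] => //.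
  by apply/rowP => u; rewrite mxE ffunE.
rewrite big_imfset /=; last by move=> g g' _ _; exact: Fi.
rewrite -big_enum /= le_eqVlt; apply/orP; left; apply/eqP.
by apply: eq_bigr => g _; apply: eq_bigr => u _; rewrite mxE.
Qed.

Lemma geom_half N : \sum_(i < N) (2^-1 : R) ^+ i <= 2.
Proof.
suff : \sum_(i < N) (2^-1 : R) ^+ i = 2 - 2 * 2^-1 ^+ N.
  by move=> ->; rewrite gerBl mulr_ge0 // exprn_ge0 // invr_ge0.
elim: N => [|N IH]; first by rewrite big_ord0 expr0; ring.
by rewrite big_ord_recr /= IH exprS; field.
Qed.

Lemma bd_geom : bd (fun w => (2^-1 : R) ^+ mdeg w) (2 ^+ k).
Proof.
have := @bd_box (fun i => 2^-1 ^+ i) 2 _ geom_half.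
move=> H; apply: bd_le (H _) (lexx _) => [w|i]; last by rewrite exprn_ge0 // invr_ge0.
by rewrite /mdeg expr_sum.
Qed.

End Counting.

(** * Series of matrices and contraction with a vector *)

Section Mcb2.
Variables (R : realType) (K : numFieldType) (S : rcs R K) (n k : nat).
Local Notation rcr := (rcr S).
Local Notation nrm := (nrm S).
Local Notation nv := (@nv R K S k).
Local Notation nbound := (@nbound R K S k).
Local Notation J := ('rV[int]_n).
Variable f : 'I_n -> J -> 'I_k -> 'rV[K]_k -> K.
Local Notation h := (hfun f).
Variables (x0 : 'rV[K]_k) (rho0 : R) (c : 'I_n -> R) (q0 K0 : R).
Hypothesis HF : fbound S f x0 rho0 c q0 K0.
Local Notation mcb := (mcb S x0 c).

Let c0 : forall s, 0 < c s. Proof. by case: HF. Qed.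
Let w0 i : 0 < wt c i. Proof. exact: wt_gt0. Qed.
Let q01 : 1 < q0. Proof. by case: HF. Qed.
Let r00 : 0 < rho0. Proof. by case: HF. Qed.

Lemma mcb_scal (I' : choiceType) (om : I' -> R) N N' rho q (A : J -> I' -> 'rV[K]_k -> K) M g B :
  nbound N x0 rho g B -> mcb N' rho q om A M ->
  mcb (N + N') rho q om (fun i j x => g x * A i j x) (B * M).
Proof.
move=> hg [b b1 b2]; exists (fun i j => B * b i j); first by move=> i j; exact: nbM.
move=> i; apply: bd_le (bdZ (nb_ge0 hg) (b2 i)) _ => [j|]; first by rewrite mulrA.
by rewrite !mulrA.
Qed.

Lemma mcb_tsum (I' T : choiceType) (om : I' -> R) N rho q (A : T -> J -> I' -> 'rV[K]_k -> K) M M0 :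
  (forall j, 0 < om j) -> 0 < rho -> 0 <= q ->
  (forall t, mcb N rho q om (A t) (M t)) -> bd M M0 ->
  (forall i j, exists B B0, (forall t, nbound N x0 rho (A t i j) (B t)) /\ bd B B0) /\
  mcb N rho q om (fun i j x => sum_of (fun t => A t i j x)) M0.
Proof.
move=> om0 rp qp hA hM.
have hA0 t : exists b : J -> I' -> R, (forall i j, nbound N x0 rho (A t i j) (b i j)) /\
    forall i, bd (fun j => b i j * om j) (M t * wt c i * q ^+ la i).
  by case: (hA t) => b b1 b2; exists b.
have [b hb] := choice hA0.
have W i : 0 <= wt c i * q ^+ la i by rewrite mulr_ge0 ?exprn_ge0 // ltW.
have hQ i : exists Q : I' -> R, (forall j, bd (fun t => b t i j) (Q j)) /\
   bd (fun j => Q j * om j) (M0 * wt c i * q ^+ la i).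
  have hP : bd (fun t => M t * wt c i * q ^+ la i) (M0 * wt c i * q ^+ la i).
    rewrite -mulrA mulrC; apply: bd_le (bdZ (W i) hM) (lexx _) => t.
    by rewrite -mulrA mulrC.
  have [||Q Q1 Q2] := bd_swap (p := fun t j => b t i j * om j) _ _ hP.
  - by move=> t j; rewrite mulr_ge0 ?(ltW (om0 j)) // (nb_ge0 ((hb t).1 i j)).
  - by move=> t; exact: (hb t).2.
  have oi j : 0 <= (om j)^-1 by rewrite invr_ge0 ltW.
  exists (fun j => Q j / om j); split; last first.
    by apply: bd_le Q2 (lexx _) => j; rewrite divfK // gt_eqF.
  move=> j; rewrite mulrC; apply: bd_le (bdZ (oi j) (Q1 j)) (lexx _) => t.
  by rewrite mulrC mulfK // gt_eqF.
have [Q hQ'] := choice hQ.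
have main i j := nb_tsum rp (fun t => (hb t).1 i j) ((hQ' i).1 j).
split.
  move=> i j; exists (fun t => b t i j), (Q i j); split; last exact: (hQ' i).1.
  by move=> t; exact: (hb t).1.
exists Q; first by move=> i j; exact: (main i j).2.
by move=> i; exact: (hQ' i).2.
Qed.

(** [l] stands for the family [C^j]: bounded by the column weights, it contracts a matrix to a
    column, and the contraction commutes with [D_u]. *)
Lemma mcb_col rho q (A : J -> J -> 'rV[K]_k -> K) M (l : J -> K) u :
  mcb 0 rho q (wt c) A M -> (forall j, nrm (l j) <= wt c j) -> 0 <= M ->
  0 < rho -> rho <= rho0 -> 1 <= q -> q < q0 ->
  let a := fun i x => sum_of (fun j => A i j x * l j) in
  [/\ forall i, nbound 0 x0 rho (a i) (M * wt c i * q ^+ la i),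
      forall i x, nv (x - x0) < rho -> bd (fun j => nrm (A i j x * l j)) (M * wt c i * q ^+ la i) &
      forall i x, nv (x - x0) < rho ->
        pderiv u (a i) x + sum_of (fun t => h i t u x * a t x) =
        sum_of (fun j => Dop f u A i j x * l j)].
Proof.
move=> hA hl M0 rp rr q1 qq a; have [b b1 b2] := hA.
have bp i j : 0 <= b i j by exact: nb_ge0 (b1 i j).
have n1 i j : nbound 0 x0 rho (fun x => A i j x * l j) (b i j * wt c j).
  have := nbM (b1 i j) (nb_cst S x0 (l j) rp) => H.
  by apply: nb_le H _; rewrite ler_wpM2l.
have ts i := nb_tsum rp (n1 i) (b2 i).
have rowb i x : nv (x - x0) < rho -> bd (fun j => nrm (A i j x * l j)) (M * wt c i * q ^+ la i).
  by move=> hx; apply: bd_le (b2 i) (lexx _) => j; exact: nb_bound (n1 i j) hx.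
split=> //; first by move=> i; exact: (ts i).2.
move=> i x hx; have hx0 := lt_le_trans hx rr.
have [s1 ->] := nb_tsum_deriv u (n1 i) (b2 i) hx.
have P t : 0 <= M * wt c t * q ^+ la t by exact: le_trans (bd_ge0 (rowb t x hx)).
have row2 t : bd (fun j => nrm (h i t u x * (A t j x * l j))) (nrm (h i t u x) * (M * wt c t * q ^+ la t)).
  by apply: bd_le (bdZ (nrm_ge0 S (h i t u x)) (rowb t x hx)) (lexx _) => j; rewrite nrmM.
have [PB hP] : exists PB, bd (fun t => nrm (h i t u x) * (M * wt c t * q ^+ la t)) PB.
  have H := @h_num _ _ S _ _ _ _ _ _ _ _ HF u i x (fun t => rcr (M * wt c t * q ^+ la t)) q q0 M hx0 q1 (ltW qq) qq M0.
  eexists; apply: bd_le (H _) (lexx _) => t; last by rewrite nrm_rcr ger0_norm.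
  by rewrite nrmM nrm_rcr ger0_norm.
case: (fubini row2 hP) => f1 f2 f3 f4 f5 f6 f7.
have -> : sum_of (fun t => h i t u x * a t x) =
    sum_of (fun t => sum_of (fun j => h i t u x * (A t j x * l j))).
  by apply: sum_of_ext => t; rewrite (@sum_ofZ _ _ S) //; eexists; exact: rowb.
rewrite f6 -f7 -(@sum_ofD _ _ S) //; apply: sum_of_ext => j.
rewrite /Dop mulrDl; congr (_ + _).
  have d1 : differentiable (A i j : 'rV[K]_k -> K^o) x by exact: nb_diff (b1 i j) hx.
  have c1 : differentiable ((fun=> l j) : 'rV[K]_k -> K^o) x by exact: differentiable_cst.
  rewrite (pderivM u d1 c1).2 [X in _ * X](_ : _ = 0) ?mulr0 ?add0r //; exact: derive_cst.
rewrite /hmul mulrC; have [l0|l0] := eqVneq (l j) 0.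
  by rewrite l0 mul0r; apply: (is_sumE S); apply: is_sum_ext (is_sum0 S _) => t; rewrite !mulr0.
rewrite -(@sum_ofZ _ _ S); first by apply: sum_of_ext => t; ring.
have := summZ (l j)^-1 (f3 j); apply: summ_ext => t.
by field.
Qed.
End Mcb2.

(** * Words in the operators *)

Section Words.
Variable k : nat.
Implicit Types (w : 'rV[nat]_k).

(* P^<w> is D_1^{w_1} ... D_k^{w_k} applied to the identity matrix. *)
Definition word w : seq 'I_k := flatten [seq nseq (w 0 u) u | u <- enum 'I_k].

Lemma size_word w : size (word w) = mdeg w.
Proof.
rewrite /word size_flatten /shape -map_comp sumnE big_map /mdeg big_enum.
by apply: eq_bigr => u _; rewrite /= size_nseq.
Qed.

Lemma word0 : word 0 = [::].
Proof. by apply: size0nil; rewrite size_word mdeg0. Qed.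

(** [l1] consists of the letters below [u] in [word w]; the new letter [u] enters right behind them,
    and at the very front if there are none. *)
Lemma word_unit w (u : 'I_k) : exists l1 l2,
  [/\ word w = l1 ++ l2, word (w + unit_tuple nat u) = l1 ++ u :: l2 &
      (forall v : 'I_k, (v < u)%N -> w 0 v = 0%N) -> l1 = [::]].
Proof.
have uin : u \in enum 'I_k by rewrite mem_enum.
have srt : sorted ltn [seq val v | v <- enum 'I_k].
  by rewrite val_enum_ord iota_ltn_sorted.
have unq : uniq (enum 'I_k) by exact: enum_uniq.
rewrite /word; case/splitPr: uin srt unq => s1 s2 srt unq.
have [us1 us2] : u \notin s1 /\ u \notin s2.
  move: unq; rewrite cat_uniq /= => /and3P[_ + /andP[]].
  by rewrite negb_or => /andP[].
have off (s : seq 'I_k) : u \notin s ->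
    [seq nseq ((w + unit_tuple nat u)%R 0 v) v | v <- s] = [seq nseq (w 0 v) v | v <- s].
  move=> us; apply/eq_in_map => v vs; rewrite mxE unit_tupleE.
  by case: eqP vs us => [-> ->|] //; rewrite addr0.
exists (flatten [seq nseq (w 0 v) v | v <- s1]).
exists (nseq (w 0 u) u ++ flatten [seq nseq (w 0 v) v | v <- s2]).
rewrite !map_cat !flatten_cat /= !off //; split=> //.
  by rewrite mxE unit_tupleE eqxx -[(_ + _)%R]/(_ + 1)%N addn1.
move=> h; have lt1 v : v \in s1 -> (v < u)%N.
  move=> vs1; move: srt; rewrite map_cat /=.
  rewrite sorted_pairwise; last exact: ltn_trans.
  rewrite pairwise_cat => /and3P[+ _ _] => /allrelP; apply; last by rewrite inE eqxx.
  exact: map_f.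
elim: s1 lt1 {srt unq us1} => // v s1 IH lt1 /=.
by rewrite h ?lt1 ?inE ?eqxx //= IH // => v' v's; apply: lt1; rewrite inE v's orbT.
Qed.

End Words.

(** * Convergence and flatness of Z *)

Section Transport.
Variables (R : realType) (K : numFieldType) (S : rcs R K) (n k : nat).
Local Notation rcr := (rcr S).
Local Notation nrm := (nrm S).
Local Notation nv := (@nv R K S k).
Local Notation summ := (summ S).
Local Notation nbound := (@nbound R K S k).
Local Notation J := ('rV[int]_n).
Variable f : 'I_n -> J -> 'I_k -> 'rV[K]_k -> K.
Local Notation h := (hfun f).
Implicit Types (w : 'rV[nat]_k) (u : 'I_k) (x : 'rV[K]_k) (i j : J).

(** The product of Kronecker deltas is kept in the form in which [P_recurrence] asks for it. *)
Definition idmat (i j : J) (x : 'rV[K]_k) : K := \prod_(s < n) (i 0 s == j 0 s)%:R.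

Lemma idmatE i j x : idmat i j x = (i == j)%:R.
Proof.
rewrite /idmat; case: eqP => [->|ij]; first by rewrite big1 // => s _; rewrite eqxx.
have [s hs] : exists s, i 0 s != j 0 s.
  apply/existsP; apply: contra_notT ij; rewrite negb_exists => /forallP e.
  by apply/rowP => s; have := e s; rewrite negbK => /eqP.
by rewrite (bigD1 s) //= (negbTE hs) mul0r.
Qed.

Definition Pm (w : 'rV[nat]_k) : J -> J -> 'rV[K]_k -> K := Dword f (word w) idmat.

Definition Zm (i j : J) (x : 'rV[K]_k) : K :=
  sum_of (fun w => taylor_factor w x * Pm w i j x).

Lemma Pm0 : Pm 0 = idmat.
Proof. by rewrite /Pm word0. Qed.

Lemma Pm_semi w u : (forall v : 'I_k, (v < u)%N -> w 0 v = 0%N) ->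
  Pm (w + unit_tuple nat u) = Dop f u (Pm w).
Proof.
move=> h; rewrite /Pm; have [l1 [l2 [-> -> /(_ h) ->]]] := word_unit w u.
by [].
Qed.

Definition tcoef (w : 'rV[nat]_k) : K := \prod_u ((-1) ^+ w 0 u / (w 0 u)`!%:R).

Lemma taylorE w x : taylor_factor w x = tcoef w * monom x w.
Proof.
rewrite /taylor_factor /tcoef /monom -big_split; apply: eq_bigr => u _ /=.
by rewrite [in LHS]exprNn mulrAC.
Qed.

Lemma nrm_tcoef w : nrm (tcoef w) = (wfact w)%:R^-1.
Proof.
rewrite /tcoef nrm_prod /wfact natr_prod -prodfV; apply: eq_bigr => u _.
by rewrite nrmM nrmX nrmN nrm1 expr1n mul1r nrmV nrm_nat.
Qed.

Lemma tcoefS w u : (w 0 u).+1%:R * tcoef (w + unit_tuple nat u) = - tcoef w.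
Proof.
rewrite /tcoef (bigD1 u) //= [in RHS](bigD1 u) //=.
have -> : (w + unit_tuple nat u) 0 u = (w 0 u).+1.
  by rewrite mxE unit_tupleE eqxx -[(_ + _)%R]/(_ + 1)%N addn1.
rewrite factS natrM exprS -mulNr mulrA; congr (_ * _).
  have a0 : (w 0 u).+1%:R != 0 :> K by rewrite pnatr_eq0.
  have b0 : (w 0 u)`!%:R != 0 :> K by rewrite pnatr_eq0 -lt0n fact_gt0.
  move: ((w 0 u).+1%:R) ((w 0 u)`!%:R) a0 b0 => a b a0 b0.
  by field; rewrite a0 b0.
by apply: eq_bigr => v vu; rewrite mxE unit_tupleE (negbTE vu) addr0.
Qed.

Lemma taylor_nb w rho : 0 < rho ->
  nbound (mdeg w) 0 rho (taylor_factor w) (rho ^+ mdeg w / (wfact w)%:R).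
Proof.
move=> r0; exists (fun m => if m == w then tcoef w else 0); last first.
  by move=> m; case: eqP => // ->; rewrite ltnn.
split=> //.
  apply: (bd_single (i0 := w)); rewrite ?eqxx.
  - by move=> m /negbTE ->; rewrite nrm0 mul0r.
  - by rewrite mulr_ge0 ?nrm_ge0 // exprn_ge0 // ltW.
  - by rewrite nrm_tcoef mulrC.
move=> x _; rewrite taylorE subr0.
have := @is_sum_single R K S _ (fun m => (if m == w then tcoef w else 0) * monom x m) w.
by rewrite eqxx; apply=> m /negbTE ->; rewrite mul0r.
Qed.

Lemma pderiv_taylorS w u x :
  pderiv u (taylor_factor (w + unit_tuple nat u)) x = - taylor_factor w x.
Proof.
have -> : taylor_factor (w + unit_tuple nat u) =
    (fun y => tcoef (w + unit_tuple nat u) * monom (y - 0) (w + unit_tuple nat u)) :> (_ -> K).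
  by apply/funext => y; rewrite subr0 taylorE.
have [p1 _] := pderiv_monom S (0 : 'rV[K]_k) x u (w + unit_tuple nat u).
have c1 : differentiable ((fun=> tcoef (w + unit_tuple nat u)) : 'rV[K]_k -> K^o) x.
  exact: differentiable_cst.
rewrite (pderivM u c1 p1).2 [X in _ + X * _](_ : _ = 0) ?mul0r ?addr0; last exact: derive_cst.
by rewrite (pderiv_monomS S) subr0 mulrA [_ * (w 0 u).+1%:R]mulrC tcoefS mulNr -taylorE.
Qed.

Lemma pderiv_taylor0 w u x : w 0 u = 0%N -> pderiv u (taylor_factor w) x = 0.
Proof.
move=> wu.
have -> : taylor_factor w = (fun y => tcoef w * monom (y - 0) w) :> (_ -> K).
  by apply/funext => y; rewrite subr0 taylorE.
have [p1 p2] := pderiv_monom S (0 : 'rV[K]_k) x u w.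
have c1 : differentiable ((fun=> tcoef w) : 'rV[K]_k -> K^o) x.
  exact: differentiable_cst.
rewrite (pderivM u c1 p1).2 [X in _ + X * _](_ : _ = 0) ?mul0r ?addr0; last exact: derive_cst.
by rewrite p2 wu !mul0r mulr0.
Qed.

Lemma taylor_semi w u (x : 'rV[K]_k) : (forall v : 'I_k, (v < u)%N -> x 0 v = 0) ->
  taylor_factor w x != 0 -> forall v : 'I_k, (v < u)%N -> w 0 v = 0%N.
Proof.
move=> hx + v vu; apply: contraNeq => wv.
rewrite /taylor_factor (bigD1 v) //= hx // oppr0 expr0n (negbTE wv) !mul0r.
by rewrite eqxx.
Qed.

Lemma idmat_mcb x0 (c : 'I_n -> R) (om : J -> R) rho q : 0 < rho ->
  (forall i, 0 <= om i <= wt c i * q ^+ la i) -> mcb S x0 c 0 rho q om idmat 1.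
Proof.
move=> r0 hom; exists (fun i j => (i == j)%:R) => [i j|i].
  have -> : idmat i j = fun=> (i == j)%:R by apply/funext => x; rewrite idmatE.
  by rewrite -[X in nbound _ _ _ _ X](nrm_nat S); apply: nb_cst.
have /andP[om0 om1] := hom i.
apply: (bd_single (i0 := i)); rewrite ?eqxx ?mul1r //.
by move=> j; rewrite eq_sym => /negbTE ->; rewrite mul0r.
Qed.

Lemma idmat_scb x0 rho0 c q0 K0 : fbound S f x0 rho0 c q0 K0 ->
  scb S x0 rho0 c q0 0 0 (wt c) idmat 1.
Proof.
move=> HF; have [_ c0 _ _] := HF; apply: idmat_mcb; first exact: (rs_gt0 HF).
by move=> i; rewrite ltW ?wt_gt0 //= /qs mul0r addr0 expr1n mulr1.
Qed.

Variables (rho0 : R) (c : 'I_n -> R) (q0 K0 : R).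
Hypothesis HF : fbound S f 0 rho0 c q0 K0.
Local Notation mcb := (mcb S 0 c).
Local Notation rs := (rs rho0).
Local Notation qs := (qs q0).
Local Notation Dcost := (Dcost rho0 c q0 K0).

Let c0 : forall s, 0 < c s. Proof. by case: HF. Qed.
Let w0 i : 0 < wt c i. Proof. exact: wt_gt0. Qed.
Let q01 : 1 < q0. Proof. by case: HF. Qed.

(** The bound of [Dword_scb] between the levels 0 and 1/2; the levels from 1/2 to 1 are reserved for
    one more [D_u] in front of [P^<w>]. *)
Definition Pbound (w : 'rV[nat]_k) : R := ((mdeg w)%:R * (Dcost / (2^-1 - 0))) ^+ mdeg w.

Lemma Pm_scb w : scb S 0 rho0 c q0 0 2^-1 (wt c) (Pm w) (Pbound w).
Proof.
have h1 : 0 < 2^-1 :> R by rewrite invr_gt0.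
have h2 : 2^-1 <= 1 :> R by rewrite invf_le1 // ler1n.
have := Dword_scb HF w0 (word w) (idmat_scb HF) (lexx 0) h1 h2 ler01.
by rewrite size_word mul1r.
Qed.

(* 16 = 2 * 4 * 2: the level gap is 1/2, the 4 is that of [pow_fact], and the last
   2 makes the w-th term of Z at most 2^-|w|. *)
Definition zrad : R := Num.min (rs 1) (16 * (k%:R * Dcost) + 1)^-1.

Lemma kDcost_ge0 : 0 <= k%:R * Dcost.
Proof.
case: (posnP k) => [->|]; first by rewrite mul0r.
move=> k0; have u : 'I_k by exact: (Ordinal k0).
by rewrite mulr_ge0 // (Dcost_ge0 HF u).
Qed.

Lemma zrad_gt0 : 0 < zrad.
Proof.
rewrite /zrad lt_min (rs_gt0 HF) //= invr_gt0 ltr_pwDr // mulr_ge0 ?kDcost_ge0 //.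
Qed.

Lemma zrad_rs1 : zrad <= rs 1.
Proof. by rewrite /zrad ge_min lexx. Qed.

Lemma Pbound_ge0 w : 0 <= Pbound w.
Proof.
rewrite /Pbound; have [m0|] := posnP (mdeg w); first by rewrite m0 expr0.
move=> /mdeg_pos [u _]; rewrite exprn_ge0 // mulr_ge0 // subr0 invrK mulr_ge0 //.
exact: (Dcost_ge0 HF u).
Qed.

Lemma taylor_Pbound w : zrad ^+ mdeg w / (wfact w)%:R * Pbound w <= 2^-1 ^+ mdeg w.
Proof.
have [m0|] := posnP (mdeg w).
  rewrite /Pbound m0 !expr0 mulr1 mul1r invf_le1 ?ltr0n ?wfact_gt0 //.
  by rewrite ler1n wfact_gt0.
move=> mp; have [u _] := mdeg_pos mp.
have L0 := Dcost_ge0 HF u.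
have wf : 0 < (wfact w)%:R :> R by rewrite ltr0n wfact_gt0.
rewrite mulrAC ler_pdivrMr // /Pbound subr0 invrK !exprMn.
have pf : (mdeg w)%:R ^+ mdeg w <= (4 * k%:R) ^+ mdeg w * (wfact w)%:R :> R.
  rewrite -natrM -!natrX -natrM ler_nat; apply: leq_trans (pow_fact _) _.
  by rewrite expnMn -mulnA leq_mul2l fact_multi orbT.
have rz0 := zrad_gt0; have lk := kDcost_ge0.
apply: (@le_trans _ _ (zrad ^+ mdeg w * ((4 * k%:R) ^+ mdeg w * (wfact w)%:R * (Dcost ^+ mdeg w * 2 ^+ mdeg w)))).
  rewrite ler_wpM2l ?exprn_ge0 ?(ltW rz0) // ler_wpM2r // mulr_ge0 // exprn_ge0 //.
have -> : zrad ^+ mdeg w * ((4 * k%:R) ^+ mdeg w * (wfact w)%:R * (Dcost ^+ mdeg w * 2 ^+ mdeg w))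
   = (zrad * (8 * (k%:R * Dcost))) ^+ mdeg w * (wfact w)%:R.
  rewrite (_ : 8 = 4 * 2); last by ring.
  rewrite !exprMn.
  by move: (zrad ^+ _) (4 ^+ _) (2 ^+ _) (k%:R ^+ _) (Dcost ^+ _) (wfact w)%:R => *; ring.
rewrite ler_wpM2r ?(ltW wf) // lerXn2r ?nnegrE ?mulr_ge0 ?(ltW rz0) ?invr_ge0 //.
have : zrad <= (16 * (k%:R * Dcost) + 1)^-1 by rewrite /zrad ge_min lexx orbT.
move=> /(ler_wpM2r (_ : 0 <= 8 * (k%:R * Dcost))) H; apply: le_trans (H _) _; first by rewrite mulr_ge0.
rewrite mulrC ler_pdivrMr; lra.
Qed.

Lemma taylor_Pm_mcb w : mcb 0 zrad (qs 2^-1) (wt c) (fun i j x => taylor_factor w x * Pm w i j x) (2^-1 ^+ mdeg w).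
Proof.
have qs1 : 1 <= qs 2^-1 by apply: (qs_ge1 HF); lra.
have r1 : zrad <= rs 2^-1 by apply: le_trans zrad_rs1 _; apply: (rs_anti HF); lra.
have h1 := mcb_mono HF (Pm_scb w) (leqnn _) zrad_gt0 r1 (le_trans ler01 qs1) (lexx _) (Pbound_ge0 w) (lexx _).
have h2 := mcb_scal (taylor_nb w zrad_gt0) h1.
apply: (mcb_mono HF h2); rewrite ?zrad_gt0 ?(le_trans ler01 qs1) //; last exact: taylor_Pbound.
by rewrite mulr_ge0 ?Pbound_ge0 // divr_ge0 // exprn_ge0 // ltW // zrad_gt0.
Qed.

Lemma Zm_mcb : mcb 0 zrad (qs 2^-1) (wt c) Zm (2 ^+ k).
Proof.
have qs1 : 1 <= qs 2^-1 by apply: (qs_ge1 HF); lra.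
by have [_] := mcb_tsum HF w0 zrad_gt0 (le_trans ler01 qs1) taylor_Pm_mcb (@bd_geom R k).
Qed.

Lemma Zm_at0 i j : Zm i j 0 = (i == j)%:R.
Proof.
rewrite /Zm (sum_of_single S (i0 := 0)).
  by rewrite Pm0 idmatE taylorE monom0 mulr1 /tcoef big1 ?mul1r // => u _; rewrite mxE expr0 fact0 divr1.
by move=> w w0'; rewrite taylorE monom_0 // mulr0 mul0r.
Qed.

(** Write [T_w] for the Taylor factor. By the product rule the term [w] contributes
    [(d_u T_w) P^<w> + T_w D_u P^<w>]. The second part is [T_w P^<w + {u}>], and the first part of
    the term [w + {u}] is its opposite, so the series telescopes. The hypothesis is asked only where
    [T_w] is nonzero at [x], which on a coordinate subspace restricts [w]. *)
Lemma Z_flat u i j x : nv x < zrad ->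
  (forall w, taylor_factor w x != 0 -> Dop f u (Pm w) i j x = Pm (w + unit_tuple nat u) i j x) ->
  Dop f u Zm i j x = 0.
Proof.
move=> hx hP.
have hx0 : nv (x - 0) < zrad by rewrite subr0.
have hxr : nv (x - 0) < rho0.
  by apply: lt_le_trans hx0 _; apply: le_trans zrad_rs1 _; rewrite -[leRHS](rs0 rho0) (rs_anti HF).
have qh1 : 1 <= qs 2^-1 by apply: (qs_ge1 HF); lra.
have qh2 : qs 2^-1 < q0 by rewrite /qs; have := q01; lra.
have [hB _] := mcb_tsum HF w0 zrad_gt0 (le_trans ler01 qh1) taylor_Pm_mcb (@bd_geom R k).
have [B [B0 [hB1 hB2]]] := hB i j.
have [s1 e1] := nb_tsum_deriv u hB1 hB2 hx0.
pose T w := taylor_factor w x.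
have TPb w t : nrm (T w * Pm w t j x) <= 2^-1 ^+ mdeg w * (wt c t * qs 2^-1 ^+ la t / wt c j).
  by have := nb_bound (mcb_entry w0 t j (taylor_Pm_mcb w)) hx0; rewrite -!mulrA.
have X0 t : 0 <= wt c t * qs 2^-1 ^+ la t / wt c j.
  by rewrite divr_ge0 ?mulr_ge0 ?(ltW (w0 _)) // exprn_ge0 // (le_trans ler01).
have rowb t : bd (fun w => nrm (T w * Pm w t j x)) ((2 ^+ k / wt c j) * wt c t * qs 2^-1 ^+ la t).
  rewrite (_ : _ * qs 2^-1 ^+ la t = (wt c t * qs 2^-1 ^+ la t / wt c j) * 2 ^+ k); last by ring.
  by apply: bd_le (bdZ (X0 t) (@bd_geom R k)) (lexx _) => w; rewrite [leRHS]mulrC.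
have M0 : 0 <= 2 ^+ k / wt c j by rewrite divr_ge0 ?exprn_ge0 // ltW.
have Y0 t : 0 <= (2 ^+ k / wt c j) * wt c t * qs 2^-1 ^+ la t by exact: bd_ge0 (rowb t).
have row2 t : bd (fun w => nrm (h i t u x * (T w * Pm w t j x)))
    (nrm (h i t u x) * ((2 ^+ k / wt c j) * wt c t * qs 2^-1 ^+ la t)).
  by apply: bd_le (bdZ (nrm_ge0 S (h i t u x)) (rowb t)) (lexx _) => w; rewrite nrmM.
have [PB hPB] : exists PB, bd (fun t => nrm (h i t u x) * ((2 ^+ k / wt c j) * wt c t * qs 2^-1 ^+ la t)) PB.
  have H := @h_num _ _ S _ _ _ _ _ _ _ _ HF u i x
    (fun t => rcr ((2 ^+ k / wt c j) * wt c t * qs 2^-1 ^+ la t)) (qs 2^-1) q0 _ hxr qh1 (ltW qh2) qh2 M0.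
  eexists; apply: bd_le (H _) (lexx _) => t; last by rewrite nrm_rcr ger0_norm.
  by rewrite nrmM nrm_rcr ger0_norm.
case: (fubini row2 hPB) => f1 f2 f3 f4 f5 f6 f7.
pose F w := T w * Pm (w + unit_tuple nat u) i j x.
have rs12 : rs 1 <= rs 2^-1 by apply: (rs_anti HF); lra.
have hx1 : nv (x - 0) < rs 1 by apply: lt_le_trans zrad_rs1.
have hx2 : nv (x - 0) < rs 2^-1 by apply: lt_le_trans rs12.
have Pnb w t := mcb_entry w0 t j (Pm_scb w).
have hmulE w : sum_of (fun t => h i t u x * (T w * Pm w t j x)) = T w * hmul f u (Pm w) i j x.
  rewrite /hmul -(@sum_ofZ _ _ S); first by apply: sum_of_ext => t; ring.
  have Mw0 : 0 <= Pbound w / wt c j by rewrite divr_ge0 ?Pbound_ge0 // ltW.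
  eexists; apply: (h_num HF u i hxr qh1 (ltW qh2) qh2 Mw0) => t.
  by apply: le_trans (nb_bound (Pnb w t) hx2) _; apply: le_of_eq; ring.
have dT w : differentiable (taylor_factor w : 'rV[K]_k -> K^o) x.
  exact: nb_diff (taylor_nb w zrad_gt0) hx0.
have dP w : differentiable (Pm w i j : 'rV[K]_k -> K^o) x by exact: nb_diff (Pnb w i) hx2.
have pE w : pderiv u (fun y => taylor_factor w y * Pm w i j y) x =
    T w * pderiv u (Pm w i j) x + pderiv u (taylor_factor w) x * Pm w i j x.
  by case: (pderivM u (dT w) (dP w)).
pose G w := pderiv u (taylor_factor w) x * Pm w i j x.
have FE w : T w * Dop f u (Pm w) i j x = F w.
  have [T0|T0] := eqVneq (T w) 0; first by rewrite /F T0 !mul0r.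
  by rewrite hP.
(* One more [D_u] in front of [P^<w>] goes from level 1/2 to level 1 at the cost of a constant
   factor, so the shifted series converges like [Z]. *)
have sF : summ F.
  have L0 := Dcost_ge0 HF u.
  pose CC := Dcost / (1 - 2^-1) * (wt c i * qs 1 ^+ la i / wt c j).
  have C0 : 0 <= CC.
    rewrite mulr_ge0 ?divr_ge0 ?mulr_ge0 ?(ltW (w0 _)) // ?exprn_ge0 //; first lra.
    by rewrite (le_trans ler01) // (qs_ge1 HF).
  exists (CC * 2 ^+ k); apply: bd_le (bdZ C0 (@bd_geom R k)) (lexx _) => w.
  rewrite -FE nrmM.
  have hD := Dop_scb HF w0 u (Pm_scb w) _ _ (lexx 1) (Pbound_ge0 w).
  have {}hD : scb S 0 rho0 c q0 0 1 (wt c) (Dop f u (Pm w)) (Pbound w * (Dcost / (1 - 2^-1))).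
    by apply: hD; lra.
  have a1 := nb_bound (mcb_entry w0 i j hD) hx1.
  have a2 := nb_bound (taylor_nb w zrad_gt0) hx0.
  apply: le_trans (ler_pM (nrm_ge0 S _) (nrm_ge0 S _) a2 a1) _.
  rewrite [leLHS](_ : _ = CC * (zrad ^+ mdeg w / (wfact w)%:R * Pbound w)); last first.
    rewrite /CC; move: (Dcost / (1 - 2^-1)) (wfact w)%:R^-1 (wt c j)^-1 (qs 1 ^+ la i) => a b d e; ring.
  by rewrite ler_wpM2l // taylor_Pbound.
have tot w : pderiv u (fun y => taylor_factor w y * Pm w i j y) x + sum_of (fun t => h i t u x * (T w * Pm w t j x))
   = G w + F w.
  by rewrite pE hmulE -FE /G /Dop; ring.
have stot := summD s1 f5.
have sG : summ G.
  have := summD stot (summN sF); apply: summ_ext => w.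
  by rewrite tot addrK.
have inj : injective (fun w : 'rV[nat]_k => w + unit_tuple nat u).
  move=> m m' /rowP e; apply/rowP => v; have := e v; rewrite !mxE.
  by move=> /eqP; rewrite eqn_add2r => /eqP.
have [|sG' eG] := sum_of_inj inj _ sG.
  move=> w hw; have [wu|wu] := posnP (w 0%R u); first by rewrite /G pderiv_taylor0 // mul0r.
  by have [w' hw'] := rV_pos wu; move: (hw w'); rewrite hw' eqxx.
rewrite /Dop [X in X + _]e1 /hmul [X in _ + X](_ : _ = sum_of (fun w => sum_of (fun t => h i t u x * (T w * Pm w t j x)))).
  rewrite -(sum_ofD s1 f5) (sum_of_ext tot) (sum_ofD sG sF) -eG.
  rewrite [X in X + _](_ : _ = - sum_of F) ?addNr // -(sum_ofN sF).
  by apply: sum_of_ext => w; rewrite /G pderiv_taylorS mulNr.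
rewrite f7 -f6; apply: sum_of_ext => t; rewrite (@sum_ofZ _ _ S) //.
by eexists; exact: rowb.
Qed.

End Transport.

(** * Multiplicativity of Z *)

Section SemiFlat.
Variables (R : realType) (K : numFieldType) (S : rcs R K) (k : nat).
Local Notation nv := (@nv R K S k).
Local Notation nbound := (@nbound R K S k).
Local Notation powser := (@powser R K S k).
Implicit Types (u v : 'I_k) (m : 'rV[nat]_k) (x : 'rV[K]_k).

Definition cut u x : 'rV[K]_k := \row_v (if (v < u)%N then 0 else x 0 v).
Definition tail_supp u m := [forall v : 'I_k, (v < u)%N ==> (m 0%R v == 0%N)].

Lemma nv_cut u x : nv (cut u x) <= nv x.
Proof.
apply: nv_le => [|v]; first exact: nv_ge0.
by rewrite mxE; case: ifP => _; rewrite ?nrm0 ?nv_ge0 ?nv_coord.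
Qed.

Lemma monom_cut u x m : monom (cut u x) m = if tail_supp u m then monom x m else 0.
Proof.
rewrite /tail_supp; case: forallP => [h|h].
  apply: eq_bigr => v _; rewrite mxE; case: ifP => // vu.
  by have := h v; rewrite vu /= => /eqP ->; rewrite !expr0.
have [v hv] : exists v : 'I_k, (v < u)%N && (m 0%R v != 0%N).
  apply/existsP; apply: contra_notT h; rewrite negb_exists => /forallP h v.
  by apply/implyP => vu; have := h v; rewrite vu /= negbK.
move: hv => /andP[vu mv].
by rewrite /monom (bigD1 v) //= mxE vu expr0n (negbTE mv) mul0r.
Qed.

Lemma powser_cut u rho g a B : powser 0 rho g a B ->
  powser 0 rho (g \o cut u) (fun m => if tail_supp u m then a m else 0) B.
Proof.
move=> [r0 h1 h2]; split=> //.
  apply: bd_le h1 (lexx _) => m; case: ifP => // _.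
  by rewrite nrm0 mul0r mulr_ge0 ?nrm_ge0 // exprn_ge0 // ltW.
move=> x; rewrite subr0 => hx; have := h2 (cut u x); rewrite subr0 => /(_ _) H.
apply: is_sum_ext (H _) => [m|]; last by apply: le_lt_trans (nv_cut _ _) hx.
by rewrite monom_cut; case: ifP => // _; rewrite mulr0 mul0r.
Qed.

(* Along {x_v = 0 for v < u} only the monomials free of x_v for v < u survive, and
   every monomial other than 1 is seen by the derivative in its first variable. *)
Lemma nb_semi N rho g B (r : 'I_k -> 'rV[K]_k -> K) (Br : 'I_k -> R) :
  nbound 0 0 rho g B -> g 0 = 0 -> (forall u, nbound N 0 rho (r u) (Br u)) ->
  (forall u x, nv x < rho -> (forall v, (v < u)%N -> x 0 v = 0) -> pderiv u g x = r u x) ->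
  nbound N.+1 0 rho g B.
Proof.
move=> [a ha _] g0 hr hg; exists a => // m; have [r0 _ ha2] := ha.
have a0 : a 0 = 0 by rewrite (powser_at0 ha).
have [->//|m0] := eqVneq m 0.
have mpos : exists u : 'I_k, (0 < m 0%R u)%N.
  by apply: mdeg_pos; rewrite lt0n; apply: contra_neq m0 => /mdeg_eq0.
case: mpos => u0 hu0.
(* With [u] the first variable in [m], also [m - {u}] is free of the variables before [u], hence
   survives the restriction by [cut u]. *)
have [u mu hmin] := arg_minnP (fun u : 'I_k => (u : nat)) (P := fun u : 'I_k => (0 < m 0%R u)%N) hu0.
have [m' hm'] := rV_pos mu; rewrite hm' mdegD mdeg_unit addn1 ltnS => m'N.
have rr1 : 0 < rho / 2 by lra.
have rr2 : rho / 2 < rho by lra.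
have [_ da _] := powser_deriv u ha rr1 rr2.
have [b hb hbN] := hr u.
have := powser_uniq (powser_cut u da) (powser_cut u hb).
have ts : tail_supp u m'.
  apply/forallP => v; apply/implyP => vu; rewrite -leqn0 leqNgt; apply/negP => mv.
  have : (0 < m 0%R v)%N by rewrite hm' mxE ltn_addr.
  by move=> /hmin; rewrite leqNgt vu.
move=> /(_ _) H; have := congr1 (fun F => F m') (H _); rewrite ts hbN // /dpowser.
move=> {}H; have /eqP : (m' 0 u).+1%:R * a (m' + unit_tuple nat u) = 0.
  apply: H; apply/(near_nv S); exists rho => // y; rewrite subr0 => hy /=.
  apply: hg; first by apply: le_lt_trans (nv_cut _ _) hy.
  by move=> v vu; rewrite mxE vu.
by rewrite mulf_eq0 pnatr_eq0 => /eqP.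
Qed.

End SemiFlat.

(** * Multiplicative families indexed by exponents *)

Section Algebra.
Variables (K : numFieldType) (n : nat) (zs : pred 'I_n).
Implicit Types (i j t : 'rV[int]_n).

(* [zs] marks the coordinates at which C vanishes, where no negative exponent may
   occur. *)
Definition allowed i := [forall s, zs s ==> (0 <= i 0 s)].

Lemma allowedD i j : allowed i -> allowed j -> allowed (i + j).
Proof.
move=> /forallP hi /forallP hj; apply/forallP => s; apply/implyP => zss.
by have := hi s; have := hj s; rewrite zss mxE /= => ? ?; exact: addr_ge0.
Qed.

Lemma allowed0 : allowed 0.
Proof. by apply/forallP => s; rewrite mxE lexx implybT. Qed.

Lemma allowed_scale s (z : int) : (zs s -> 0 <= z) -> allowed (z *: unit_tuple int s).
Proof.
move=> h; apply/forallP => s'; apply/implyP => zs'; rewrite mxE unit_tupleE.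
by case: eqP zs' => [->|_] zs'; rewrite ?mulr1 ?mulr0 // h.
Qed.

Lemma allowed_unit s : allowed (unit_tuple int s).
Proof. by rewrite -[unit_tuple _ _]scale1r; apply: allowed_scale. Qed.

(** An allowed [i] is a sum of allowed multiples of unit vectors, and on the multiples of one unit
    vector [phi] is a power. *)
Lemma monoid_lmonom (phi : 'rV[int]_n -> K) (i : 'rV[int]_n) :
  phi 0 = 1 -> (forall i j, allowed i -> allowed j -> phi (i + j) = phi i * phi j) ->
  allowed i -> phi i = lmonom (\row_s phi (unit_tuple int s)) i.
Proof.
move=> phi0 phiD hi.
have nat_pow s (m : nat) : phi ((m : int) *: unit_tuple int s) = phi (unit_tuple int s) ^+ m.
  elim: m => [|m IH]; first by rewrite scale0r phi0 expr0.
  rewrite (_ : Posz m.+1 = Posz m + 1); last by rewrite -addn1.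
  by rewrite scalerDl scale1r phiD ?allowed_unit ?allowed_scale // IH exprSr.
have int_pow s (z : int) : (zs s -> 0 <= z) ->
    phi (z *: unit_tuple int s) = phi (unit_tuple int s) ^ z.
  case: z => m hz; first exact: nat_pow.
  have nz : ~~ zs s by apply/negP => /hz.
  (* A negative multiple is allowed only where its opposite is too; this makes the value of [phi] at
     the unit vector invertible. *)
  have H : phi (Negz m *: unit_tuple int s) * phi ((m.+1 : int) *: unit_tuple int s) = 1.
    rewrite -phiD; [|exact: allowed_scale|exact: allowed_scale].
    rewrite -scalerDl (_ : Negz m + Posz m.+1 = 0) ?scale0r //.
    by rewrite NegzE addNr.
  rewrite nat_pow in H; rewrite NegzE -exprnN -NegzE.
  have y0 : phi (unit_tuple int s) ^+ m.+1 != 0.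
    by apply: contra_eq_neq H => ->; rewrite mulr0 eq_sym oner_neq0.
  by apply: (mulIf y0); rewrite H mulVf.
have iE : i = \sum_s (i 0 s *: unit_tuple int s) by rewrite [LHS]row_sum_delta.
rewrite /lmonom.
have -> : \prod_(s < n) (\row_s0 phi (unit_tuple int s0)) 0 s ^ i 0 s =
   \prod_(s < n) phi (i 0 s *: unit_tuple int s).
  apply: eq_bigr => s _; rewrite mxE int_pow // => zss.
  by move/forallP: hi => /(_ s); rewrite zss.
rewrite {1}iE.
suff [] : allowed (\sum_s (i 0 s *: unit_tuple int s)) /\
   phi (\sum_s (i 0 s *: unit_tuple int s)) = \prod_(s < n) phi (i 0 s *: unit_tuple int s) by [].
elim: (index_enum _) => [|s r [IH1 IH2]]; first by rewrite !big_nil phi0 allowed0.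
have as_ : allowed (i 0 s *: unit_tuple int s).
  by apply: allowed_scale => zss; move/forallP: hi => /(_ s); rewrite zss.
by rewrite !big_cons allowedD // phiD // IH2.
Qed.

End Algebra.

(** * The contracted rows of Z and their multiplicativity *)

Section Columns.
Variables (R : realType) (K : numFieldType) (S : rcs R K) (n k : nat).
Local Notation nrm := (nrm S).
Local Notation nv := (@nv R K S k).
Local Notation summ := (summ S).
Local Notation nbound := (@nbound R K S k).
Local Notation J := ('rV[int]_n).
Variable f : 'I_n -> J -> 'I_k -> 'rV[K]_k -> K.
Local Notation h := (hfun f).
Implicit Types (w : 'rV[nat]_k) (u : 'I_k) (x : 'rV[K]_k) (i j t : J).

Definition Dcol u (b : J -> 'rV[K]_k -> K) i x : K :=
  pderiv u (b i) x + sum_of (fun t => h i t u x * b t x).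

(** The exponent of [f] in [h_{i t}] depends on [t - i] only and the coefficient [i_s] is additive;
    this is the derivation property of [D_u]. *)
Lemma hfunD i j t u x : h (i + j) t u x = h i (t - j) u x + h j (t - i) u x.
Proof.
rewrite /hfun -big_split; apply: eq_bigr => s _ /=.
rewrite mxE rmorphD mulrDl; congr (_ * f _ _ _ _ + _ * f _ _ _ _).
  by rewrite opprD addrA addrAC.
by rewrite opprD addrA.
Qed.

(** If [t_s < 0 <= i_s], the exponent [t - i + {s'}] is still negative at [s], except possibly for
    [s' = s] and [i_s = 0], when the coefficient [i_s] vanishes. *)
Lemma hfun_not_allowed (zs : pred 'I_n) x i t u :
  (forall s m, ~~ allowed zs m -> f s m u x = 0) ->
  allowed zs i -> ~~ allowed zs t -> h i t u x = 0.
Proof.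
move=> hz hi; rewrite negb_forall => /existsP [s]; rewrite negb_imply -ltNge => /andP[zss ts].
have is0 : 0 <= i 0 s by move/forallP: hi => /(_ s); rewrite zss.
rewrite /hfun big1 // => s' _.
have [|i1] := eqVneq ((i 0 s')%:~R : K) 0; first by move=> ->; rewrite mul0r.
rewrite hz ?mulr0 //; rewrite negb_forall; apply/existsP; exists s.
rewrite negb_imply zss /= -ltNge !mxE eqxx /=.
have [ss|ss] := eqVneq s s'; last by rewrite addr0; lia.
move: i1; rewrite -ss intr_eq0 /= => i1; lia.
Qed.

Variables (rho0 : R) (c : 'I_n -> R) (q0 K0 : R).
Hypothesis HF : fbound S f 0 rho0 c q0 K0.
Local Notation qs := (qs q0).
Local Notation zrad := (zrad k rho0 c q0 K0).
Local Notation qh := (qs 2^-1).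

Let c0 : forall s, 0 < c s. Proof. by case: HF. Qed.
Let w0 i : 0 < wt c i. Proof. exact: wt_gt0. Qed.
Let q01 : 1 < q0. Proof. by case: HF. Qed.
Let r00 : 0 < rho0. Proof. by case: HF. Qed.

Lemma qh_ge1 : 1 <= qh. Proof. by apply: (qs_ge1 HF); lra. Qed.
Lemma qh_lt : qh < q0. Proof. rewrite /qs; have := q01; lra. Qed.

Lemma zrad_rho0 : zrad <= rho0.
Proof. by apply: le_trans (zrad_rs1 _ _ _ _ _) _; rewrite -[leRHS](rs0 rho0) (rs_anti HF). Qed.

Lemma zrad_lt_rho0 x : nv x < zrad -> nv (x - 0) < rho0.
Proof. by rewrite subr0 => hx; apply: lt_le_trans zrad_rho0. Qed.

Lemma wtqD i j : wt c (i + j) * qh ^+ la (i + j) <= (wt c i * qh ^+ la i) * (wt c j * qh ^+ la j).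
Proof.
rewrite wtD // mulrACA; apply: ler_wpM2l; first by rewrite mulr_ge0 // ltW.
by rewrite -exprD ler_weXn2l ?qh_ge1 ?laD.
Qed.

Lemma wtq_gt0 i : 0 < wt c i * qh ^+ la i.
Proof. by rewrite mulr_gt0 // exprn_gt0 // (lt_le_trans ltr01) // qh_ge1. Qed.

Lemma h_summ u i x (b : J -> K) M : nv x < zrad -> 0 <= M ->
  (forall t, nrm (b t) <= M * wt c t * qh ^+ la t) -> summ (fun t => h i t u x * b t).
Proof.
move=> hx M0 hb; eexists.
exact: (h_num HF u i (zrad_lt_rho0 hx) qh_ge1 (ltW qh_lt) qh_lt M0 hb).
Qed.

Lemma h_split u i j x (b : J -> K) M : nv x < zrad -> 0 <= M ->
  (forall t, nrm (b t) <= M * wt c t * qh ^+ la t) ->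
  [/\ summ (fun t => h i t u x * b (t + j)), summ (fun t => h j t u x * b (t + i)) &
  sum_of (fun t => h (i + j) t u x * b t) =
  sum_of (fun t => h i t u x * b (t + j)) + sum_of (fun t => h j t u x * b (t + i))].
Proof.
move=> hx M0 hb.
have sh i' j' : summ (fun t => h i' t u x * b (t + j')).
  apply: (h_summ (M := M * (wt c j' * qh ^+ la j')) _ _ hx).
    by rewrite mulr_ge0 // ltW // wtq_gt0.
  move=> t; apply: le_trans (hb _) _; rewrite -!mulrA; apply: ler_wpM2l => //.
  by apply: le_trans (wtqD t j') _; rewrite mulrC !mulrA.
split=> //.
have re i' j' : summ (fun t => h i' (t - j') u x * b t) /\
   sum_of (fun t => h i' (t - j') u x * b t) = sum_of (fun t => h i' t u x * b (t + j')).
  have [||s1 s2] := @sum_of_bij R K S _ _ (fun t : J => t - j') (fun t => t + j') _ _ _ (sh i' j').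
  - by move=> t; rewrite subrK.
  - by move=> t; rewrite addrK.
  split; last by rewrite -s2; apply: sum_of_ext => t; rewrite subrK.
  by move: s1; apply: summ_ext => t; rewrite subrK.
have [r1 <-] := re i j; have [r2 <-] := re j i.
rewrite -(sum_ofD r1 r2); apply: sum_of_ext => t.
by rewrite hfunD mulrDl.
Qed.

Section Lin.
Variables (l : J -> K).
Hypothesis hl : forall j, nrm (l j) <= wt c j.

Definition Zl i x := sum_of (fun j => Zm f i j x * l j).

Let M0 : R := 2 ^+ k.
Let M00 : 0 <= M0. Proof. exact: exprn_ge0. Qed.

Lemma Zl_nb i : nbound 0 0 zrad (Zl i) (2 ^+ k * wt c i * qh ^+ la i).
Proof.
(* [mcb_col] asks for an index [u], and there is none for [k = 0]. *)
case: (posnP k) => [k0|kp].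
  have [b b1 b2] := Zm_mcb HF.
  have n1 j : nbound 0 0 zrad (fun x => Zm f i j x * l j) (b i j * wt c j).
    have H := nbM (b1 i j) (nb_cst S 0 (l j) (zrad_gt0 HF)).
    by apply: nb_le H _; rewrite ler_wpM2l // (nb_ge0 (b1 i j)).
  exact: (nb_tsum (zrad_gt0 HF) n1 (b2 i)).2.
have [] := mcb_col HF (Ordinal kp) (Zm_mcb HF) hl M00 (zrad_gt0 HF) zrad_rho0 qh_ge1 qh_lt.
by move=> + _ _; exact.
Qed.

Lemma Zl_le i x : nv x < zrad -> nrm (Zl i x) <= 2 ^+ k * wt c i * qh ^+ la i.
Proof. by move=> hx; apply: nb_bound (Zl_nb i) _; rewrite subr0. Qed.

Lemma Zl_at0 i : Zl i 0 = l i.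
Proof.
rewrite /Zl (sum_of_single S (i0 := i)); first by rewrite (Zm_at0 S) eqxx mul1r.
by move=> j; rewrite (Zm_at0 S) eq_sym => /negbTE ->; rewrite mul0r.
Qed.

Lemma Zl_D u i x : nv x < zrad -> Dcol u Zl i x = sum_of (fun j => Dop f u (Zm f) i j x * l j).
Proof.
move=> hx; have [_ _] := mcb_col HF u (Zm_mcb HF) hl M00 (zrad_gt0 HF) zrad_rho0 qh_ge1 qh_lt.
by apply; rewrite subr0.
Qed.

Lemma Zl_flat u i x : nv x < zrad ->
  (forall w i j, taylor_factor w x != 0 -> Dop f u (Pm f w) i j x = Pm f (w + unit_tuple nat u) i j x) ->
  Dcol u Zl i x = 0.
Proof.
move=> hx hP; rewrite Zl_D //; apply: (is_sumE S).
apply: is_sum_ext (is_sum0 S _) => j; rewrite (Z_flat HF hx) ?mul0r // => w; exact: hP.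
Qed.

(* On {x_v = 0 for v < u} the terms that survive in the series have w_v = 0 for
   v < u, and for those P^<w + {u}> = D_u P^<w> without any commutation. *)
Lemma Zl_semi u i x : nv x < zrad -> (forall v : 'I_k, (v < u)%N -> x 0 v = 0) ->
  Dcol u Zl i x = 0.
Proof.
move=> hx xv; apply: Zl_flat => // w i' j tw.
by rewrite Pm_semi // => v; exact: taylor_semi xv tw v.
Qed.

Lemma Zl_diff i x : nv x < zrad -> differentiable (Zl i : 'rV[K]_k -> K^o) x.
Proof. by move=> hx; apply: nb_diff (Zl_nb i) _; rewrite subr0. Qed.

Variable zs : pred 'I_n.
Hypothesis l0 : l 0 = 1.
Hypothesis lD : forall i j, allowed zs i -> allowed zs j -> l (i + j) = l i * l j.
Hypothesis fz : forall s m u x, nv x < rho0 -> ~~ allowed zs m -> f s m u x = 0.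

(** Row 0 of [h] is zero, so [Z_0 - 1] has derivative zero in [x_u] on [{x_v = 0 for v < u}], and
    [nb_semi] raises its order of vanishing indefinitely. *)
Lemma Zl0 x : nv x < zrad -> Zl 0 x = 1.
Proof.
move=> hx; apply/eqP; rewrite -subr_eq0; apply/eqP.
have rp := zrad_gt0 HF.
have n1 := nbB (Zl_nb 0) (nb_cst S 0 (1 : K) rp).
apply: (nb_eq0 n1); last by rewrite subr0.
case=> [|N]; first by eexists; eexists; exact: n1.
exists zrad; eexists; apply: (nb_semi n1 (r := fun _ _ => 0) (Br := fun=> 0)).
- by rewrite Zl_at0 l0 subrr.
- by move=> u; exact: nb_zero.
move=> u y hy yv; have := Zl_semi 0 hy yv; rewrite /Dcol.
rewrite [X in _ + X](_ : _ = 0) ?addr0; last first.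
  apply: (is_sumE S); apply: is_sum_ext (is_sum0 S _) => t.
  by rewrite /hfun big1 ?mul0r // => s _; rewrite mxE mul0r.
move=> <-; rewrite /pderiv (deriveB (f := Zl 0 : _ -> K^o) (g := (fun=> 1) : _ -> K^o)).
- by rewrite [X in _ - X](_ : _ = 0) ?subr0 //; exact: derive_cst.
- by apply: diff_derivable; exact: Zl_diff.
- by apply: diff_derivable; exact: differentiable_cst.
Qed.

(* The difference of the two sides is annihilated by D_u on {x_v = 0 for v < u}, so
   [nb_semi] raises its order of vanishing at 0 indefinitely. *)
Lemma Zl_mul i j x : allowed zs i -> allowed zs j -> nv x < zrad ->
  Zl (i + j) x = Zl i x * Zl j x.
Proof.
move=> ai aj hx; apply/eqP; rewrite -subr_eq0; apply/eqP.
have rp := zrad_gt0 HF.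
pose b i j y := Zl (i + j) y - Zl i y * Zl j y.
pose MM : R := 2 ^+ k + 2 ^+ k * 2 ^+ k.
have MM0 : 0 <= MM by rewrite addr_ge0 ?mulr_ge0 ?exprn_ge0.
pose bb i j : R := MM * (wt c i * qh ^+ la i) * (wt c j * qh ^+ la j).
have bnb i' j' : nbound 0 0 zrad (b i' j') (bb i' j').
  apply: nb_le (nbB (Zl_nb (i' + j')) (nbM (Zl_nb i') (Zl_nb j'))) _.
  rewrite /bb /MM mulrDl mulrDl; apply: lerD.
    by rewrite -!mulrA ler_wpM2l ?exprn_ge0 //; apply: le_trans (wtqD i' j') _; rewrite !mulrA.
  by apply: le_of_eq; ring.
have claim N : forall i' j', allowed zs i' -> allowed zs j' -> nbound N 0 zrad (b i' j') (bb i' j').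
  elim: N => [|N IH] i' j' ai' aj'; first exact: bnb.
  (* The induction hypothesis covers allowed indices only; elsewhere [h] vanishes, and [b] may be
     replaced by 0. *)
  pose bt i' j' : 'rV[K]_k -> K := if allowed zs i' && allowed zs j' then b i' j' else fun=> 0.
  have btnb i1 j1 : nbound N 0 zrad (bt i1 j1) (bb i1 j1).
    rewrite /bt; case: andP => [[a1 a2]|_]; first exact: IH.
    by apply: nb_le (nb_zero S N 0 rp) _; exact: nb_ge0 (bnb i1 j1).
  (* On [{x_v = 0 for v < u}] the derivative of [b i' j'] is minus the sum of this series and the
     next, and both vanish to order [N] by induction. *)
  have r1 u : exists B0, nbound N 0 zrad (fun y => sum_of (fun t => h i' t u y * bt t j' y)) B0.
    have [|t|B [B0 [hB hB0]]] := @h_mul_nb R K S n k f 0 rho0 c q0 K0 HF N zrad qh u i'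
       (fun t => bt t j') (MM * (wt c j' * qh ^+ la j')) rp zrad_rho0 qh_ge1 (ltW qh_lt).
    - by rewrite mulr_ge0 // ltW // wtq_gt0.
    - by apply: nb_le (btnb t j') _; rewrite /bb le_eqVlt; apply/orP; left; apply/eqP; ring.
    by exists B0; exact: (nb_tsum rp hB hB0).2.
  have r2 u : exists B0, nbound N 0 zrad (fun y => sum_of (fun t => h j' t u y * bt i' t y)) B0.
    have [|t|B [B0 [hB hB0]]] := @h_mul_nb R K S n k f 0 rho0 c q0 K0 HF N zrad qh u j'
       (fun t => bt i' t) (MM * (wt c i' * qh ^+ la i')) rp zrad_rho0 qh_ge1 (ltW qh_lt).
    - by rewrite mulr_ge0 // ltW // wtq_gt0.
    - by apply: nb_le (btnb i' t) _; rewrite /bb le_eqVlt; apply/orP; left; apply/eqP; ring.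
    by exists B0; exact: (nb_tsum rp hB hB0).2.
  have [B1 hB1] := choice r1; have [B2 hB2] := choice r2.
  apply: (nb_semi (bnb i' j') _ (fun u => nbN (nbD (hB1 u) (hB2 u)))).
    by rewrite /b !Zl_at0 lD // subrr.
  move=> u y hy yv; have hy0 : nv (y - 0) < zrad by rewrite subr0.
  have d1 := Zl_diff (i' + j') hy; have d2 := Zl_diff i' hy; have d3 := Zl_diff j' hy.
  have [d4 e4] := pderivM u d2 d3.
  have -> : pderiv u (b i' j') y = pderiv u (Zl (i' + j')) y -
      (Zl i' y * pderiv u (Zl j') y + pderiv u (Zl i') y * Zl j' y).
    rewrite -e4 /pderiv (deriveB (f := Zl (i' + j') : _ -> K^o) (g := (fun y => Zl i' y * Zl j' y) : _ -> K^o)) //.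
    - exact: diff_derivable.
    - exact: diff_derivable.
  have s1 := Zl_semi (i' + j') hy yv; have s2 := Zl_semi i' hy yv; have s3 := Zl_semi j' hy yv.
  have Zle t := Zl_le t hy.
  have [u1 u2 u3] := h_split u i' j' hy M00 Zle.
  move: s1 s2 s3; rewrite /Dcol u3.
  move=> /eqP; rewrite addr_eq0 => /eqP -> /eqP; rewrite addr_eq0 => /eqP -> /eqP.
  rewrite addr_eq0 => /eqP ->.
  have Zs i1 : summ (fun t => h i1 t u y * Zl t y) by exact: h_summ hy M00 Zle.
  have E1 : sum_of (fun t => h i' t u y * bt t j' y) =
     sum_of (fun t => h i' t u y * Zl (t + j') y) - sum_of (fun t => h i' t u y * Zl t y) * Zl j' y.
    rewrite mulrC -(sum_ofZ _ (Zs i')) -(@sum_ofB _ _ S) //; last exact: summZ.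
    apply: sum_of_ext => t; rewrite /bt aj' andbT; case: ifP => at_; first by rewrite /b; ring.
    rewrite (hfun_not_allowed (zs := zs)) ?at_ ?mul0r ?mulr0 ?subr0 // => s m.
    by apply: fz; have := zrad_lt_rho0 hy; rewrite subr0.
  have E2 : sum_of (fun t => h j' t u y * bt i' t y) =
     sum_of (fun t => h j' t u y * Zl (t + i') y) - sum_of (fun t => h j' t u y * Zl t y) * Zl i' y.
    rewrite mulrC -(sum_ofZ _ (Zs j')) -(@sum_ofB _ _ S) //; last exact: summZ.
    apply: sum_of_ext => t; rewrite /bt ai' /=; case: ifP => at_; first by rewrite /b [i' + t]addrC; ring.
    rewrite (hfun_not_allowed (zs := zs)) ?at_ ?mul0r ?mulr0 ?subr0 // => s m.
    by apply: fz; have := zrad_lt_rho0 hy; rewrite subr0.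
  rewrite E1 E2.
  move: (sum_of (fun t => h i' t u y * Zl (t + j') y)) (sum_of (fun t => h j' t u y * Zl (t + i') y))
    (sum_of (fun t => h i' t u y * Zl t y)) (sum_of (fun t => h j' t u y * Zl t y))
    (Zl i' y) (Zl j' y) => A1 A2 S2 S3 Zi Zj; ring.
apply: (nb_eq0 (bnb i j)); last by rewrite subr0.
by move=> N; exists zrad, (bb i j); exact: claim.
Qed.

Lemma Zl_lmonom i x : allowed zs i -> nv x < zrad ->
  Zl i x = lmonom (\row_s Zl (unit_tuple int s) x) i.
Proof.
move=> ai hx; apply: (monoid_lmonom (zs := zs) (phi := fun i => Zl i x)) => //.
  exact: Zl0.
by move=> i' j' a1 a2; exact: Zl_mul.
Qed.

(** Here [D_u Z] need not vanish: the rule follows by differentiating [Z_{i + j} = Z_i Z_j], known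
    near [x]. It serves the converse direction. *)
Lemma Dcol_mul u i j x : allowed zs i -> allowed zs j -> nv x < zrad ->
  Dcol u Zl (i + j) x = Dcol u Zl i x * Zl j x + Zl i x * Dcol u Zl j x.
Proof.
move=> ai aj hx; have Zle t := Zl_le t hx.
have [u1 u2 u3] := h_split u i j hx M00 Zle.
have Zs i1 : summ (fun t => h i1 t u x * Zl t x) by exact: h_summ hx M00 Zle.
have d2 := Zl_diff i hx; have d3 := Zl_diff j hx.
have [d4 e4] := pderivM u d2 d3.
rewrite /Dcol u3.
have -> : pderiv u (Zl (i + j)) x = pderiv u (fun y => Zl i y * Zl j y) x.
  apply: pderiv_near; apply: (@near_ball R K S k 0 x zrad); first by rewrite subr0.
  by move=> y; rewrite subr0 => hy; exact: Zl_mul.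
have E i1 j1 : allowed zs i1 -> allowed zs j1 ->
    sum_of (fun t => h i1 t u x * Zl (t + j1) x) = Zl j1 x * sum_of (fun t => h i1 t u x * Zl t x).
  move=> a1 a2; rewrite -(sum_ofZ _ (Zs i1)); apply: sum_of_ext => t.
  have [at_|at_] := boolP (allowed zs t); first by rewrite Zl_mul //; ring.
  rewrite (hfun_not_allowed (zs := zs)) ?mul0r ?mulr0 // => s m.
  by apply: fz; have := zrad_lt_rho0 hx; rewrite subr0.
rewrite E // E // e4.
move: (sum_of (fun t => h i t u x * Zl t x)) (sum_of (fun t => h j t u x * Zl t x))
  (Zl i x) (Zl j x) (pderiv u (Zl i) x) (pderiv u (Zl j) x) => A1 A2 Zi Zj p1 p2; ring.
Qed.

End Lin.
End Columns.

(** * Solutions of the system *)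

Section Local.
Variables (R : realType) (K : numFieldType) (S : rcs R K) (n k : nat).
Local Notation rcr := (rcr S).
Local Notation nrm := (nrm S).
Local Notation nvn := (@nv R K S n).
Local Notation nv := (@nv R K S k).
Local Notation summ := (summ S).
Local Notation nbound := (@nbound R K S k).
Local Notation J := ('rV[int]_n).
Variable f : 'I_n -> J -> 'I_k -> 'rV[K]_k -> K.
Variables (U : set 'rV[K]_k) (W : set 'rV[K]_n).
Hypothesis hU : open U.
Hypothesis hW : open W.
Hypothesis hcvg : forall r u, laurent_cvg U W (fun i => f r i u).

Lemma nrm_lmonom (y : 'rV[K]_n) i : nrm (lmonom y i) = wt (fun s => nrm (y 0 s)) i.
Proof. by rewrite /lmonom nrm_prod; apply: eq_bigr => s _; rewrite nrmXz. Qed.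

Lemma lmonom_le (y : 'rV[K]_n) (c : 'I_n -> R) i : (forall s, 0 < c s) ->
  (forall s, y 0 s != 0 -> c s = nrm (y 0 s)) -> nrm (lmonom y i) <= wt c i.
Proof.
move=> c0 hc; rewrite nrm_lmonom; apply: ler_prod => s _.
have [y0|y0] := eqVneq (y 0 s) 0; last by rewrite hc // lexx exprz_ge0 // nrm_ge0.
(* [0 ^ z] is 1 for [z = 0] and 0 for every other [z], negative ones included, so any positive
   weight will do at a zero coordinate. *)
rewrite y0 nrm0 exp0rz; case: eqP => [->|_]; first by rewrite expr0z ler01 lexx.
by rewrite lexx exprz_ge0 // ltW.
Qed.

Lemma lmonom0 (y : 'rV[K]_n) : lmonom y 0 = 1.
Proof. by rewrite /lmonom big1 // => s _; rewrite mxE expr0z. Qed.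

Lemma lmonom_unit (y : 'rV[K]_n) s : lmonom y (unit_tuple int s) = y 0 s.
Proof.
rewrite /lmonom (bigD1 s) //= unit_tupleE eqxx expr1z big1 ?mulr1 // => w ws.
by rewrite unit_tupleE (negbTE ws) expr0z.
Qed.

Lemma lmonomD (y : 'rV[K]_n) i j : allowed (fun s => y 0 s == 0) i ->
  allowed (fun s => y 0 s == 0) j -> lmonom y (i + j) = lmonom y i * lmonom y j.
Proof.
move=> /forallP hi /forallP hj; rewrite /lmonom -big_split; apply: eq_bigr => s _ /=.
rewrite mxE; have [y0|y0] := eqVneq (y 0 s) 0; last by rewrite expfzDr.
have := hi s; have := hj s; rewrite y0 eqxx /=.
move=> hj0 hi0; case: (i 0 s) hi0 => // a _; case: (j 0 s) hj0 => // b _.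
by rewrite -PoszD -!exprnP exprD.
Qed.

Definition corner (b : 'rV[K]_n) (q : R) (e : {ffun 'I_n -> bool}) : 'rV[K]_n :=
  \row_s (b 0 s * rcr (if e s then q else q^-1)).

Lemma laurent_nb (x0 : 'rV[K]_k) (y : 'rV[K]_n) (g : J -> 'rV[K]_k -> K) :
  (forall s, y 0 s != 0) -> laurent_cvg_at g x0 y ->
  exists rho b B, [/\ 0 < rho, forall i, nbound 0 x0 rho (g i) (b i) &
    bd (fun i => b i * nrm (lmonom y i)) B].
Proof.
move=> y0 [rho [a [r0 he hs]]]; pose r := nrm rho.
have rr : rho = rcr r by exact: pos_rcr.
have rp : 0 < r by rewrite -(rcr_gt0 S) -rr.
have [B hB] : summ (fun im : J * 'rV[nat]_k =>
          `|a im.1 im.2| * rho ^+ (\sum_(u < k) im.2 0%R u)%N * `|lmonom y im.1|).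
  apply: has_sum_bd hs => im; rewrite !mulr_ge0 // exprn_ge0 // ltW //.
have p0 (im : J * 'rV[nat]_k) : 0 <= nrm (a im.1 im.2) * r ^+ mdeg im.2 * nrm (lmonom y im.1).
  by rewrite !mulr_ge0 ?nrm_ge0 // exprn_ge0 // ltW.
have hB' : bd (fun im : J * 'rV[nat]_k => nrm (a im.1 im.2) * r ^+ mdeg im.2 * nrm (lmonom y im.1)) B.
  apply: bd_le hB (lexx _) => im; rewrite !nrmM nrmX.
  rewrite -[X in _ <= X * _ * _](_ : nrm (a im.1 im.2) = _); last first.
    by apply: (@rcr_inj _ _ S); rewrite -!nrm_def normr_id.
  rewrite -[X in _ <= _ * X](_ : nrm (lmonom y im.1) = _) //.
  by apply: (@rcr_inj _ _ S); rewrite -!nrm_def normr_id.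
have [b1 b2] := bd_row p0 hB'.
have L0 i : 0 < nrm (lmonom y i).
  by rewrite nrm_lmonom; apply: wt_gt0 => s; rewrite nrm_gt0.
exists r, (fun i => rsum (fun m => nrm (a i m) * r ^+ mdeg m * nrm (lmonom y i)) / nrm (lmonom y i)), B.
split=> //; last by apply: bd_le b2 (lexx _) => i; rewrite divfK // gt_eqF.
move=> i; exists (a i) => //; split=> //.
  have Li : 0 <= (nrm (lmonom y i))^-1 by rewrite invr_ge0 ltW.
  rewrite mulrC; apply: bd_le (bdZ Li (b1 i)) (lexx _) => m.
  by rewrite [leRHS]mulrC mulfK // gt_eqF.
by move=> x hx; apply: he; rewrite rr; apply/ball_nv; rewrite -nvN opprB.
Qed.

(** The Laurent series converge at the [2^n] corners with coordinates [b_s q] or [b_s / q], all in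
    [W]. For each [i] the corner chosen by the signs of [i] has a monomial of modulus [c^i q^|i|],
    so the sum over the corners gives [K0]. A zero coordinate of [y0] is replaced by a small nonzero
    one, since weights have to be positive. *)
Lemma local_data (x0 : 'rV[K]_k) (y0 : 'rV[K]_n) : U x0 -> W y0 ->
  exists rho0 c q0 K0, [/\ fbound S f x0 rho0 c q0 K0,
    forall x, nv (x - x0) < rho0 -> U x &
    forall s, y0 0 s != 0 -> c s = nrm (y0 0 s)].
Proof.
move=> Ux Wy.
have /(near_nv S) [dU dU0 hdU] : \forall x \near x0, U x by exact: open_nbhs_nbhs.
have /(near_nv S) [d d0 hd] : \forall y \near y0, W y by exact: open_nbhs_nbhs.
have n0 := nv_ge0 S y0.
(* Makes [|y0| (q - 1)] at most [d / 2], so that scaling the nonzero coordinates by [q] or [1 / q]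
   stays inside [W]. *)
pose q := 1 + d / (2 * (nvn y0 + 1)).
have q1 : 1 < q by rewrite ltrDl divr_gt0 // mulr_gt0 // ltr_pwDr.
have q0 : 0 < q by lra.
(* The modulus put in place of a zero coordinate; multiplied by [q] it is [d / 2]. *)
pose eta := d / (2 * q).
have eta0 : 0 < eta by rewrite divr_gt0 // mulr_gt0.
pose b0 : 'rV[K]_n := \row_s (if y0 0 s == 0 then rcr eta else y0 0 s).
pose c s := nrm (b0 0 s).
have b00 s : b0 0 s != 0.
  by rewrite mxE; case: ifPn => // _; rewrite -(nrm_gt0 S) nrm_rcr gtr0_norm.
have c0 s : 0 < c s by rewrite nrm_gt0.
pose Y e := corner b0 q e.
have Y0 e s : Y e 0 s != 0.
  rewrite mxE mulf_neq0 // -(nrm_gt0 S) nrm_rcr normr_gt0.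
  by case: (e s); rewrite gt_eqF // invr_gt0.
have WY e : W (Y e).
  apply: hd; apply/(nv_ltP S _ d0) => s; rewrite !mxE.
  case: eqP => [->|/eqP y0s].
    rewrite subr0 -rcr_mul nrm_rcr ger0_norm; last first.
      by rewrite mulr_ge0 ?(ltW eta0) //; case: (e s); rewrite ?invr_ge0 ltW.
    apply: (@le_lt_trans _ _ (eta * q)).
      apply: ler_wpM2l; first exact: ltW.
      by case: (e s) => //; apply: (@le_trans _ _ 1); rewrite ?invf_le1 // ltW.
    rewrite /eta (_ : d / (2 * q) * q = d / 2); last by field; rewrite gt_eqF.
    lra.
  have -> : y0 0 s * rcr (if e s then q else q^-1) - y0 0 s = y0 0 s * rcr ((if e s then q else q^-1) - 1).
    by rewrite rcrB rcr_one mulrBr mulr1.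
  rewrite nrmM nrm_rcr.
  have h1 : `|(if e s then q else q^-1) - 1| <= q - 1.
    case: (e s); first by rewrite ger0_norm // subr_ge0 ltW.
    rewrite ler0_norm ?subr_le0 ?invf_le1 ?(ltW q1) // opprB.
    rewrite -subr_ge0 (_ : _ - _ = (q - 1) ^+ 2 / q); last by field; rewrite gt_eqF.
    by rewrite divr_ge0 ?sqr_ge0 // ltW.
  have h2 := nv_coord S y0 s.
  apply: (@le_lt_trans _ _ (nvn y0 * (q - 1))); first by rewrite ler_pM ?nrm_ge0.
  rewrite /q addrC addKr mulrCA.
  apply: (@le_lt_trans _ _ (d * 2^-1)); last by lra.
  rewrite ler_wpM2l ?(ltW d0) // ler_pdivrMr; last by rewrite mulr_gt0 // ltr_pwDr.
  by rewrite mulrA mulVf ?mul1r ?lerDl // gt_eqF.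
pose T : finType := ('I_n * 'I_k * {ffun 'I_n -> bool})%type.
have D0 (t : T) : exists p : R * (J -> R) * R,
    [/\ 0 < p.1.1, forall i, nbound 0 x0 p.1.1 (f t.1.1 i t.1.2) (p.1.2 i) &
    bd (fun i => p.1.2 i * nrm (lmonom (Y t.2) i)) p.2].
  have [_ hc] := hcvg t.1.1 t.1.2.
  have [rho [b [B [h1 h2 h3]]]] := laurent_nb (Y0 t.2) (hc x0 (Y t.2) Ux (WY t.2)).
  by exists (rho, b, B).
have [D hD] := choice D0.
have Dp (t : T) : 0 < (D t).1.1 by case: (hD t).
have [r1 r10 hr1] := min_pos (enum T) Dp.
exists (Num.min r1 dU), c, q, (\sum_s \sum_u \sum_e (D (s, u, e)).2).
have rm : 0 < Num.min r1 dU by rewrite lt_min r10.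
split; last 2 first.
- by move=> x; rewrite lt_min => /andP[_]; exact: hdU.
- by move=> s /negbTE y0s; rewrite /c mxE y0s.
split=> // s u.
pose ep (i : J) : {ffun 'I_n -> bool} := [ffun s => 0 <= i 0 s].
exists (fun i => (D (s, u, ep i)).1.2 i).
  move=> i; have [_ h _] := hD (s, u, ep i).
  apply: nb_mono (h i) (leqnn _) rm _ (lexx _).
  by rewrite ge_min hr1 // mem_enum.
have Lq i : nrm (lmonom (Y (ep i)) i) = wt c i * q ^+ la i.
  rewrite nrm_lmonom /wt /la expr_sum -big_split; apply: eq_bigr => s' _ /=.
  have -> : nrm (Y (ep i) 0 s') = c s' * (if 0 <= i 0 s' then q else q^-1).
    rewrite /Y /corner mxE nrmM nrm_rcr ffunE ger0_norm //.
    by case: ifP => _; rewrite ?invr_ge0 ltW.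
  have cn : c s' != 0 by rewrite gt_eqF.
  case: (i 0 s') => m; first by rewrite -!exprnP exprMn.
  by rewrite /= NegzE -!exprnN exprMn exprVn invfM invrK.
have DB (t : T) : bd (fun i => (D t).1.2 i * nrm (lmonom (Y t.2) i)) (D t).2 by case: (hD t).
have D1 (t : T) i : 0 <= (D t).1.2 i by have [_ h _] := hD t; exact: nb_ge0 (h i).
have hs := bd_sum (fun e : {ffun 'I_n -> bool} => DB (s, u, e)).
apply: bd_le hs _ => [i|].
  rewrite -mulrA -Lq (bigD1 (ep i)) //= lerDl sumr_ge0 // => e _.
  by rewrite mulr_ge0 ?nrm_ge0 // D1.
have Bge (t : T) : 0 <= (D t).2 by exact: bd_ge0 (DB t).
rewrite (bigD1 s) //= (bigD1 u) //= -addrA lerDl addr_ge0 //.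
  by rewrite sumr_ge0 // => u' _; exact: sumr_ge0.
by rewrite sumr_ge0 // => s' _; rewrite sumr_ge0 // => u' _; exact: sumr_ge0.
Qed.
End Local.

(** * Lipschitz estimates for Laurent monomials *)

Section Lipschitz.
Variables (R : realType) (K : numFieldType) (S : rcs R K) (n : nat).
Local Notation nrm := (nrm S).
Local Notation J := ('rV[int]_n).
Implicit Types (a b : K) (y z : 'rV[K]_n).

Lemma pow_diff a b r e m : nrm a <= r -> nrm b <= r -> nrm (a - b) <= e ->
  nrm (a ^+ m - b ^+ m) <= m%:R * r ^+ m.-1 * e.
Proof.
move=> ar br abe; case: m => [|m]; first by rewrite !expr0 subrr nrm0 !mul0r.
have r0 := le_trans (nrm_ge0 S a) ar.
rewrite subrXX nrmM mulrC; apply: ler_pM; rewrite ?nrm_ge0 //.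
apply: le_trans (nrm_sum _ _ _ _) _.
have -> : m.+1%:R * r ^+ m.+1.-1 = \sum_(i < m.+1) r ^+ m.
  by rewrite sumr_const card_ord mulr_natl.
apply: ler_sum => i _ /=; rewrite nrmM !nrmX.
have -> : r ^+ m = r ^+ (m - i) * r ^+ i by rewrite -exprD subnK // -ltnS.
by apply: ler_pM; rewrite ?exprn_ge0 ?nrm_ge0 // lerXn2r ?nnegrE ?nrm_ge0.
Qed.

Lemma zpow_bound a c q (m : int) : 0 < c -> 1 <= q -> nrm a <= c * q ->
  (0 <= m \/ c / q <= nrm a) -> nrm (a ^ m) <= c ^ m * q ^+ `|m|%N.
Proof.
move=> c0 q1 aq hm; have q0 : 0 < q by lra.
rewrite nrmXz; case: m hm => m hm.
  by rewrite -!exprnP /= -exprMn lerXn2r ?nnegrE ?nrm_ge0 // mulr_ge0 // ltW.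
case: hm => // hm; have cq : 0 < c / q by rewrite divr_gt0.
rewrite NegzE -!exprnN abszN absz_nat -[q ^+ _]invrK -invfM -[(q ^+ _)^-1]exprVn.
rewrite lef_pV2 ?posrE ?mulr_gt0 ?exprn_gt0 ?invr_gt0 //; last exact: lt_le_trans hm.
by rewrite -exprMn lerXn2r ?nnegrE ?(ltW cq) ?nrm_ge0.
Qed.

(** The relative constant [q / c] is dictated by negative exponents, as inversion has Lipschitz
    constant [(q / c)^2] on the annulus; for nonnegative exponents it leaves a factor [q^2] to
    spare. *)
Lemma zpow_diff a b c q e (m : int) : 0 < c -> 1 <= q -> nrm a <= c * q -> nrm b <= c * q ->
  (0 <= m \/ c / q <= nrm a /\ c / q <= nrm b) -> nrm (a - b) <= e ->
  nrm (a ^ m - b ^ m) <= c ^ m * q ^+ `|m|%N * (`|m|%N%:R * (q / c) * e).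
Proof.
move=> c0 q1 aq bq hm abe; have q0 : 0 < q by lra.
have e0 := le_trans (nrm_ge0 S _) abe.
case: m hm => m hm.
  rewrite -!exprnP /=; apply: le_trans (pow_diff _ aq bq abe) _.
  case: m {hm} => [|m]; first by rewrite !mul0r mulr0.
  rewrite /= (_ : _ * _ * (_ * _ * e) = m.+1%:R * (c * q) ^+ m * (q * q) * e); last first.
    by rewrite exprMn !exprS; field; rewrite gt_eqF.
  rewrite ler_wpM2r // ler_peMr //; last by rewrite -expr2 expr_ge1 // ltW.
  by rewrite mulr_ge0 // exprn_ge0 // mulr_ge0 // ltW.
case: hm => // -[ha hb]; have cq : 0 < c / q by rewrite divr_gt0.
have a0 : 0 < nrm a by exact: lt_le_trans ha.
have b0 : 0 < nrm b by exact: lt_le_trans hb.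
have ai : nrm a^-1 <= q / c by rewrite nrmV -[q / c]invrK invf_div lef_pV2 ?posrE.
have bi : nrm b^-1 <= q / c by rewrite nrmV -[q / c]invrK invf_div lef_pV2 ?posrE.
have abi : nrm (a^-1 - b^-1) <= e * (q / c) ^+ 2.
  have -> : a^-1 - b^-1 = (b - a) * (a^-1 * b^-1).
    by field; rewrite -!(nrm_gt0 S) a0 b0.
  rewrite nrmM nrmM nrmBC expr2; apply: ler_pM; rewrite ?mulr_ge0 ?nrm_ge0 //.
  by apply: ler_pM; rewrite ?nrm_ge0.
rewrite NegzE -!exprnN -!exprVn abszN absz_nat; apply: le_trans (pow_diff _ ai bi abi) _.
rewrite le_eqVlt; apply/orP; left; apply/eqP => /=.
by rewrite exprVn exprMn exprVn !exprS; field; rewrite !gt_eqF // exprn_gt0.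
Qed.

(** Telescoping: measured relative to the sizes [A], the errors of the factors add up. *)
Lemma prod_diff (r : seq 'I_n) (a b : 'I_n -> K) (A E : 'I_n -> R) :
  (forall s, nrm (a s) <= A s) -> (forall s, nrm (b s) <= A s) ->
  (forall s, nrm (a s - b s) <= A s * E s) ->
  nrm (\prod_(s <- r) a s - \prod_(s <- r) b s) <= (\prod_(s <- r) A s) * \sum_(s <- r) E s.
Proof.
move=> ha hb hab; have A0 s : 0 <= A s by exact: le_trans (nrm_ge0 S _) (ha s).
have pA (c : 'I_n -> K) l : (forall s, nrm (c s) <= A s) ->
    nrm (\prod_(s <- l) c s) <= \prod_(s <- l) A s.
  by move=> hc; rewrite nrm_prod; apply: ler_prod => s _; rewrite nrm_ge0 hc.
elim: r => [|s r IH]; first by rewrite !big_nil subrr nrm0 mulr0.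
rewrite !big_cons.
set P := \prod_(s <- r) a s; set Q := \prod_(s <- r) b s.
have -> : a s * P - b s * Q = (a s - b s) * P + b s * (P - Q) by ring.
apply: le_trans (nrmD _ _ _) _; rewrite !nrmM mulrDr; apply: lerD.
  rewrite mulrAC; apply: ler_pM; rewrite ?nrm_ge0 //; exact: pA.
by rewrite -mulrA; apply: ler_pM; rewrite ?nrm_ge0.
Qed.

Lemma lmonom_diff (y z : 'rV[K]_n) (c : 'I_n -> R) q e (i : J) :
  (forall s, 0 < c s) -> 1 <= q -> 0 <= e ->
  (forall s, nrm (y 0 s) <= c s * q) -> (forall s, nrm (z 0 s) <= c s * q) ->
  (forall s, 0 <= i 0 s \/ c s / q <= nrm (y 0 s) /\ c s / q <= nrm (z 0 s)) ->
  (forall s, nrm (y 0 s - z 0 s) <= e) ->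
  nrm (lmonom y i - lmonom z i) <= wt c i * q ^+ la i * ((la i)%:R * (q * (\sum_s (c s)^-1) * e)).
Proof.
move=> c0 q1 e0 hy hz hi hyz; have q0 : 0 < q by lra.
have := @prod_diff (index_enum 'I_n) (fun s => y 0 s ^ i 0 s) (fun s => z 0 s ^ i 0 s)
  (fun s => c s ^ i 0 s * q ^+ `|i 0%R s|%N) (fun s => `|i 0%R s|%N%:R * (q / c s) * e).
rewrite /lmonom => H; apply: le_trans (H _ _ _) _.
- by move=> s; apply: zpow_bound => //; case: (hi s) => [|[]]; [left|right].
- by move=> s; apply: zpow_bound => //; case: (hi s) => [|[]]; [left|right].
- by move=> s; exact: zpow_diff.
rewrite big_split /= -expr_sum -/(wt c i) -/(la i); apply: ler_wpM2l.
  by rewrite mulr_ge0 ?exprn_ge0 ?(ltW q0) // ltW // wt_gt0.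
have Ci s : (c s)^-1 <= \sum_s (c s)^-1.
  rewrite (bigD1 s) //= lerDl sumr_ge0 // => s' _; by rewrite invr_ge0 ltW.
rewrite /la natr_sum mulr_suml; apply: ler_sum => s _.
rewrite -mulrA ler_wpM2l // ler_wpM2r // ler_wpM2l //; exact: ltW.
Qed.

End Lipschitz.

(** * The solution given by Z and its uniqueness *)

Section Solutions.
Variables (R : realType) (K : numFieldType) (S : rcs R K) (n k : nat).
Local Notation rcr := (rcr S).
Local Notation nrm := (nrm S).
Local Notation nvn := (@nv R K S n).
Local Notation nv := (@nv R K S k).
Local Notation summ := (summ S).
Local Notation J := ('rV[int]_n).
Variable f : 'I_n -> J -> 'I_k -> 'rV[K]_k -> K.
Local Notation h := (hfun f).
Variables (U : set 'rV[K]_k) (W : set 'rV[K]_n).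
Hypothesis hW : open W.
Hypothesis hcvg : forall r u, laurent_cvg U W (fun i => f r i u).
Variables (C : 'rV[K]_n) (rho0 : R) (c : 'I_n -> R) (q0 K0 : R).
Hypothesis WC : W C.
Hypothesis HF : fbound S f 0 rho0 c q0 K0.
Hypothesis rhoU : forall x : 'rV[K]_k, nv (x - 0) < rho0 -> U x.
Hypothesis cC : forall s, C 0 s != 0 -> c s = nrm (C 0 s).
Local Notation zrad := (zrad k rho0 c q0 K0).
Local Notation zs := (fun s => C 0 s == 0).
Implicit Types (u : 'I_k) (x : 'rV[K]_k) (i j t : J).

Let c0 : forall s, 0 < c s. Proof. by case: HF. Qed.
Let q01 : 1 < q0. Proof. by case: HF. Qed.
Let rzp : 0 < zrad. Proof. exact: zrad_gt0 HF. Qed.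

Lemma lmonom_le_weight j : nrm (lmonom C j) <= wt c j.
Proof. exact: lmonom_le. Qed.

Lemma f_not_allowed s m u x : nv x < rho0 -> ~~ allowed zs m -> f s m u x = 0.
Proof.
move=> hx; rewrite negb_forall => /existsP [s']; rewrite negb_imply -ltNge => /andP[/eqP Cs ms].
have [h1 _] := hcvg s u; apply: (h1 x C m s') => //.
by apply: rhoU; rewrite subr0.
Qed.

Definition ysol (x : 'rV[K]_k) : 'rV[K]_n :=
  \row_s Zl f (fun j => lmonom C j) (unit_tuple int s) x.
Local Notation Z := (Zl f (fun j => lmonom C j)).

Lemma ysol0 : ysol 0 = C.
Proof. by apply/rowP => s; rewrite mxE (Zl_at0 S) lmonom_unit. Qed.

Lemma hfun_unit r t u x : h (unit_tuple int r) t u x = f r t u x.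
Proof.
rewrite /hfun (bigD1 r) //= unit_tupleE eqxx mul1r subrK big1 ?addr0 // => s sr.
by rewrite unit_tupleE (negbTE sr) mul0r.
Qed.

Lemma Z_lmonom i x : allowed zs i -> nv x < zrad -> Z i x = lmonom (ysol x) i.
Proof.
apply: (Zl_lmonom HF lmonom_le_weight) => //; [exact: lmonom0|by move=> i' j'; exact: lmonomD|].
by move=> s m u y; exact: f_not_allowed.
Qed.

Lemma zrad_le_rho0 x : nv x < zrad -> nv x < rho0.
Proof. by move=> /(zrad_lt_rho0 HF); rewrite subr0. Qed.

Lemma ysol_D u r x : nv x < zrad -> Dcol f u Z (unit_tuple int r) x =
  pderiv u (fun w => ysol w 0 r) x + sum_of (fun i => f r i u x * lmonom (ysol x) i).
Proof.
move=> hx; rewrite /Dcol; congr (_ + _).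
  by congr (pderiv u _ x); apply/funext => w; rewrite mxE.
apply: sum_of_ext => t; rewrite hfun_unit.
have [at_|at_] := boolP (allowed zs t); first by rewrite Z_lmonom.
by rewrite f_not_allowed ?mul0r //; exact: zrad_le_rho0.
Qed.

Lemma row_differentiable (g : 'rV[K]_k -> 'rV[K]_n) x :
  (forall s, differentiable ((fun w => g w 0 s) : 'rV[K]_k -> K^o) x) -> differentiable g x.
Proof.
move=> hg; have -> : g = \sum_s (fun w => g w 0 s *: (delta_mx 0 s : 'rV[K]_n)).
  by apply/funext => w; rewrite fct_sumE; exact: row_sum_delta.
apply: differentiable_sum => s.
exact: (differentiableZl (k := fun w => g w 0 s : K) _ (hg s)).
Qed.

Lemma coord_differentiable (g : 'rV[K]_k -> 'rV[K]_n) x s :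
  differentiable g x -> differentiable ((fun w => g w 0 s) : 'rV[K]_k -> K^o) x.
Proof.
move=> hg; apply: (differentiable_comp (g := fun M : 'rV[K]_n => M 0 s : K^o)) => //.
exact: differentiable_coord.
Qed.

Lemma ysol_diff x : nv x < zrad -> differentiable ysol x.
Proof.
move=> hx; apply: row_differentiable => s.
have -> : (fun w => ysol w 0 s) = Z (unit_tuple int s) by apply/funext => w; rewrite mxE.
exact: (Zl_diff HF lmonom_le_weight).
Qed.

Lemma cont_near (g : 'rV[K]_k -> 'rV[K]_n) (e : R) : 0 < e -> differentiable g 0 ->
  exists2 d : R, 0 < d & forall x, nv x < d -> nvn (g x - g 0) < e.
Proof.
move=> e0 /differentiable_continuous gc.
have H : \forall y \near g 0, nvn (y - g 0) < e by apply/(near_nv S); exists e.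
have /(near_nv S) [d d0 hd] := gc _ H.
by exists d => // x hx; apply: hd; rewrite subr0.
Qed.

(** A ratio strictly between 1 and [q0]: the Lipschitz estimate loses a factor [|i|], which the
    passage from [q1^|i|] to [q0^|i|] absorbs. *)
Definition q1 : R := (1 + q0) / 2.
Lemma q1_gt1 : 1 < q1. Proof. rewrite /q1; have := q01; lra. Qed.
Lemma q1_lt : q1 < q0. Proof. rewrite /q1; have := q01; lra. Qed.

(** Annuli around the moduli of [C], but full discs where [C_s = 0]: no negative power of such a
    [y_s] occurs. *)
Definition region (y : 'rV[K]_n) :=
  forall s, nrm (y 0 s) <= c s * q1 /\ (C 0 s != 0 -> c s / q1 <= nrm (y 0 s)).

Lemma region_near : exists2 e : R, 0 < e & forall y, nvn (y - C) < e -> region y /\ W y.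
Proof.
have /(near_nv S) [d d0 hd] : \forall y \near C, W y by exact: open_nbhs_nbhs.
have Q := q1_gt1; have qp : 0 < q1 by lra.
have qi : q1^-1 < 1 by rewrite invf_lt1.
have [e1 e10 he1] : exists2 e1 : R, 0 < e1 & forall s, s \in enum 'I_n -> e1 <= c s * (1 - q1^-1).
  by apply: min_pos => s; rewrite mulr_gt0 // subr_gt0.
exists (Num.min d e1); first by rewrite lt_min d0.
move=> y; rewrite lt_min => /andP[/hd Wy hy]; split=> // s.
have h1 : nrm (y 0 s - C 0 s) < c s * (1 - q1^-1).
  apply: lt_le_trans (he1 s _); last by rewrite mem_enum.
  by apply: le_lt_trans hy; have := nv_coord S (y - C) s; rewrite !mxE.
have cs := c0 s.
have q2 : c s * (1 - q1^-1) <= c s * (q1 - 1).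
  rewrite ler_pM2l // -subr_ge0 (_ : _ - _ = (q1 - 1) ^+ 2 / q1); last by field; rewrite gt_eqF.
  by rewrite divr_ge0 ?sqr_ge0 // ltW.
have nC : nrm (C 0 s) <= c s.
  have [->|C0] := eqVneq (C 0 s) 0; first by rewrite nrm0 ltW.
  by rewrite cC.
have e2 : nrm (y 0 s) <= nrm (y 0 s - C 0 s) + nrm (C 0 s).
  by apply: le_trans (nrmD S _ _); rewrite subrK.
split; first by move: h1 q2 nC e2; rewrite !mulrBr !mulr1; lra.
move=> C0; have e3 : nrm (C 0 s) <= nrm (y 0 s - C 0 s) + nrm (y 0 s).
  by rewrite nrmBC; apply: le_trans (nrmD S _ _); rewrite subrK.
move: h1 e3; rewrite -cC // !mulrBr !mulr1; lra.
Qed.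

Lemma region_allowed y z i : region y -> region z -> allowed zs i ->
  forall s, 0 <= i 0 s \/ c s / q1 <= nrm (y 0 s) /\ c s / q1 <= nrm (z 0 s).
Proof.
move=> ry rz' /forallP ai s; have [C0|C0] := eqVneq (C 0 s) 0.
  by left; have := ai s; rewrite C0 eqxx.
by right; split; [apply: (ry s).2|apply: (rz' s).2].
Qed.

Lemma q1_pow i : (la i)%:R * q1 ^+ la i <= q1 / (q0 - q1) * q0 ^+ la i.
Proof.
have Q := q1_gt1; have Q' := q1_lt; have qp : 0 < q1 by lra.
have d0 : 0 < q0 - q1 by rewrite subr_gt0.
have := pow_deriv_bound (la i) (ltW qp) (ltW Q') => H.
rewrite mulrAC ler_pdivlMr //.
apply: (@le_trans _ _ (q1 * ((la i)%:R * q1 ^+ (la i).-1 * (q0 - q1)))); last by rewrite ler_pM2l.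
case: (la i) => [|m]; first by rewrite !mul0r mulr0.
by rewrite /= exprS le_eqVlt; apply/orP; left; apply/eqP; ring.
Qed.

Lemma q1_q0 i : q1 ^+ la i <= q0 ^+ la i.
Proof.
have Q := q1_gt1; have Q' := q1_lt.
by rewrite lerXn2r ?nnegrE //; lra.
Qed.

Lemma lmonom_region y i : region y -> allowed zs i -> nrm (lmonom y i) <= wt c i * q1 ^+ la i.
Proof.
move=> ry ai; rewrite nrm_prod /wt /la expr_sum -big_split /=.
have Q := q1_gt1.
apply: ler_prod => s _; rewrite nrm_ge0 /=; apply: zpow_bound => //; first exact: ltW.
  exact: (ry s).1.
by case: (region_allowed ry ry ai s) => [|[]]; [left|right].
Qed.

Lemma f_region_summ r u x y : nv x < rho0 -> region y -> summ (fun i => f r i u x * lmonom y i).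
Proof.
move=> hx ry; case: HF => _ _ _ /(_ r u) [b b1 b2].
apply: summ_le b2 => i; have hb := nb_bound (b1 i) (_ : nv (x - 0) < rho0).
have {}hb : nrm (f r i u x) <= b i by apply: hb; rewrite subr0.
have bi := le_trans (nrm_ge0 S _) hb.
have [ai|ai] := boolP (allowed zs i); last first.
  rewrite f_not_allowed // mul0r nrm0 mulr_ge0 ?mulr_ge0 ?exprn_ge0 //; first by rewrite ltW // wt_gt0.
  by have := q01; lra.
rewrite nrmM -mulrA; apply: ler_pM; rewrite ?nrm_ge0 //.
apply: le_trans (lmonom_region ry ai) _; apply: ler_wpM2l; first by rewrite ltW // wt_gt0.
exact: q1_q0.
Qed.

Definition lip_cst : R := q1 * (\sum_s (c s)^-1) * (q1 / (q0 - q1)) * K0.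

Lemma f_lipschitz r u x y z (e : R) : nv x < rho0 -> region y -> region z -> 0 <= e ->
  (forall s, nrm (y 0 s - z 0 s) <= e) ->
  nrm (sum_of (fun i => f r i u x * lmonom y i) - sum_of (fun i => f r i u x * lmonom z i)) <= lip_cst * e.
Proof.
move=> hx ry rz' e0 hyz.
rewrite -(sum_ofB (f_region_summ r u hx ry) (f_region_summ r u hx rz')).
apply: sum_of_nrm; case: HF => _ _ _ /(_ r u) [b b1 b2].
have Q := q1_gt1; have Q' := q1_lt.
have sc0 : 0 <= \sum_s (c s)^-1 by apply: sumr_ge0 => s _; rewrite invr_ge0 ltW.
pose D := q1 * (\sum_s (c s)^-1) * (q1 / (q0 - q1)) * e.
have D0 : 0 <= D by rewrite /D !mulr_ge0 // ?invr_ge0; lra.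
apply: bd_le (bdZ D0 b2) _ => [i|]; last first.
  by rewrite /D /lip_cst le_eqVlt; apply/orP; left; apply/eqP; ring.
have hb : nrm (f r i u x) <= b i by apply: nb_bound (b1 i) _; rewrite subr0.
have bi := le_trans (nrm_ge0 S _) hb.
have wp : 0 < wt c i by exact: wt_gt0.
have q0p : 0 <= q0 ^+ la i by rewrite exprn_ge0 //; lra.
have [ai|ai] := boolP (allowed zs i); last first.
  rewrite f_not_allowed // !mul0r subrr nrm0.
  exact: mulr_ge0 D0 (mulr_ge0 (mulr_ge0 bi (ltW wp)) q0p).
rewrite -mulrBr nrmM.
have H := lmonom_diff c0 (ltW Q) e0 (fun s => (ry s).1) (fun s => (rz' s).1) (region_allowed ry rz' ai) hyz.
apply: le_trans (ler_pM (nrm_ge0 S _) (nrm_ge0 S _) hb H) _.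
have -> : b i * (wt c i * q1 ^+ la i * ((la i)%:R * (q1 * (\sum_s (c s)^-1) * e))) =
  (b i * wt c i * (q1 * (\sum_s (c s)^-1) * e)) * ((la i)%:R * q1 ^+ la i) by ring.
have Y : 0 <= b i * wt c i * (q1 * (\sum_s (c s)^-1) * e).
  by rewrite !mulr_ge0 // ?(ltW wp) //; lra.
apply: le_trans (ler_wpM2l Y (q1_pow i)) _.
by rewrite /D le_eqVlt; apply/orP; left; apply/eqP; ring.
Qed.

Lemma le_pow2_0 (a B : R) : (forall N, a <= B * 2^-1 ^+ N) -> a <= 0.
Proof.
move=> H; apply/ler_addgt0Pr => e e0; rewrite add0r.
have B0 : 0 <= B \/ B < 0 by case: (leP 0 B); [left|right].
case: B0 => B0; last first.
  by apply: le_trans (H 0%N) _; rewrite expr0 mulr1; lra.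
pose N := (Num.truncn (B / e)).+1.
apply: le_trans (H N) _; rewrite exprVn ler_pdivrMr ?exprn_gt0 // mulrC -ler_pdivrMr //.
apply: (@le_trans _ _ N%:R); first by rewrite ltW // truncnS_gt.
by rewrite -natrX ler_nat ltnW // ltn_expl.
Qed.

Lemma nat_down (P : nat -> Prop) m : P m -> (forall p, (p < m)%N -> P p.+1 -> P p) -> P 0%N.
Proof. by elim: m => // m IH Pm H; apply: IH => [|p pm]; apply: H => //; exact: ltnW. Qed.

(** With [4 * d * l <= 1] the factor [2 * d * l] of the mean value inequality is at most 1/2. *)
Lemma small_radius (l a1 a2 a3 a4 : R) : 0 < a1 -> 0 < a2 -> 0 < a3 -> 0 < a4 ->
  exists d, [/\ 0 < d, d <= a1, d <= a2, d <= a3 & d <= a4 /\ (0 <= l -> 4 * d * l <= 1)].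
Proof.
move=> a10 a20 a30 a40; pose a := (4 * (`|l| + 1))^-1.
have a0 : 0 < a by rewrite invr_gt0 mulr_gt0 // ltr_pwDr.
exists (Num.min a (Num.min (Num.min a1 a2) (Num.min a3 a4))); split.
- by rewrite !lt_min a0 a10 a20 a30 a40.
- by rewrite !ge_min lexx !orbT.
- by rewrite !ge_min lexx !orbT.
- by rewrite !ge_min lexx !orbT.
split; first by rewrite !ge_min lexx !orbT.
move=> l0; set m := Num.min _ _.
have ma : m <= a by rewrite /m ge_min lexx.
apply: (@le_trans _ _ (4 * a * l)); first by rewrite ler_wpM2r // ler_pM2l.
rewrite /a ger0_norm // invfM mulrA divff // mul1r mulrC ler_pdivrMr; lra.
Qed.

(* The point x is joined to 0 by a path along the coordinate axes; on each leg
   the difference of the two solutions is halved by the Lipschitz bound. *)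
Lemma solution_unique (z : 'rV[K]_k -> 'rV[K]_n) : solution_near0 f U W z -> z 0 = C ->
  \forall x \near (0 : 'rV[K]_k), z x = ysol x.
Proof.
move=> /(near_nv S) [d1 d10 hd1] z0.
have [e e0 he] := region_near.
have n00 : nv (0 - 0 : 'rV[K]_k) = 0 by rewrite subr0 nv0.
have dz0 : differentiable z 0.
  by have [|_ _ ? _] := hd1 0; first by rewrite n00.
have [d2 d20 hd2] := cont_near e0 dz0.
have nz : nv 0 < zrad by rewrite -[X in nv X]subr0 n00.
have [d3 d30 hd3] := cont_near e0 (ysol_diff nz).
have {}hd3 x : nv x < d3 -> nvn (ysol x - C) < e.
  by move=> hx; rewrite -ysol0; apply: hd3.
pose L := lip_cst + 1.
(* [K0 >= 0] is read off a bound for some [f s m u], which requires an index [s] and an index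
   [u]. *)
have L0 : 0 <= lip_cst \/ n = 0%N \/ k = 0%N.
  case: (posnP n) => [->|np]; first by right; left.
  case: (posnP k) => [->|kp]; first by right; right.
  left; rewrite /lip_cst mulr_ge0 ?(K0_ge0 HF (Ordinal np) (Ordinal kp)) //.
  have Q := q1_gt1; have Q' := q1_lt.
  rewrite !mulr_ge0 ?invr_ge0 ?subr_ge0 //; try lra.
  by apply: sumr_ge0 => s _; rewrite invr_ge0 ltW.
have [d [d0 dd1 dd2 dd3 [dr dL]]] := small_radius lip_cst d10 d20 d30 rzp.
have solz x : nv x < d -> [/\ region (z x), differentiable z x &
    forall r u, pderiv u (fun w => z w 0 r) x + sum_of (fun i => f r i u x * lmonom (z x) i) = 0].
  move=> hx; have [|_ _ h1 h2] := hd1 x; first by rewrite subr0; exact: lt_le_trans dd1.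
  split=> //; apply: (he _ _).1; rewrite -z0; apply: hd2; exact: lt_le_trans dd2.
have soly x : nv x < d -> region (ysol x).
  by move=> hx; apply: (he _ _).1; apply: hd3; exact: lt_le_trans dd3.
suff P : forall x, nv x < d -> (forall v : 'I_k, (v < 0)%N -> x 0 v = 0) -> z x = ysol x.
  by apply/(near_nv S); exists d => // x; rewrite subr0 => hx; exact: P.
(* Descending induction on [p]: for [p = k] only the origin is left, and for [p = 0] there is no
   restriction. *)
apply: (@nat_down (fun p => forall x, nv x < d ->
    (forall v : 'I_k, (v < p)%N -> x 0 v = 0) -> z x = ysol x) k).
  move=> x _ xv; have -> : x = 0 by apply/rowP => v; rewrite mxE xv.
  by rewrite z0 ysol0.
move=> p pk' IHp x hx xv.
pose u := Ordinal pk'.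
have Lc0 : 0 <= lip_cst.
  case: L0 => // -[n0|k0]; last by have := leq_ltn_trans (leq0n p) pk'; rewrite k0.
  rewrite /lip_cst big_pred0 ?mulr0 ?mul0r // => s; by have := ltn_ord s; rewrite {2}n0.
pose B : R := 2 * q1 * \sum_s c s.
have Q := q1_gt1.
(* The bound at stage [N] holds at all these points, hence on the whole segment parallel to the axis
   [u]; this is what allows it to be halved again. *)
have main N : forall x, nv x < d -> (forall v : 'I_k, (v < p)%N -> x 0 v = 0) ->
    forall s, nrm (ysol x 0 s - z x 0 s) <= B * 2^-1 ^+ N.
  elim: N => [|N IHN] y hy yv s.
    rewrite expr0 mulr1; have [ry _ _] := solz y hy; have ry' := soly y hy.
    apply: le_trans (nrmB S _ _) _; have := (ry s).1; have := (ry' s).1.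
    have : c s * q1 <= q1 * \sum_s c s.
      rewrite mulrC; apply: ler_wpM2l; first lra.
      by rewrite (bigD1 s) //= lerDl sumr_ge0 // => s' _; exact: ltW.
    rewrite /B; lra.
  (* The projection of [y] along the axis [u], where the two solutions agree by the induction on
     [p]. *)
  pose y' : 'rV[K]_k := \row_v (if v == u then 0 else y 0 v).
  pose hh : 'rV[K]_k := y 0 u *: unit_tuple K u.
  have yE : y = y' + hh.
    apply/rowP => v; rewrite !mxE eqxx /=; case: eqP => [->|_]; rewrite ?mulr1 ?mulr0 ?add0r ?addr0 //.
  have seg (t : R) : 0 <= t <= 1 -> nv (y' + rcr t *: hh) < d /\
      forall v : 'I_k, (v < p)%N -> (y' + rcr t *: hh) 0 v = 0.
    move=> /andP[t0 t1]; split.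
      apply: le_lt_trans hy; apply: nv_le => [|v]; first exact: nv_ge0.
      rewrite !mxE eqxx /=; case: eqP => [_|_].
        rewrite mulr1 add0r nrmM nrm_rcr ger0_norm //.
        by apply: le_trans (nv_coord S y u); rewrite ler_piMl ?nrm_ge0.
      by rewrite !mulr0 addr0; exact: nv_coord.
    move=> v vp; have vu : (v == u) = false by apply/negP => /eqP e1; move: vp; rewrite e1 ltnn.
    by rewrite !mxE vu andbF !mulr0 addr0 yv.
  pose g w := ysol w 0 s - z w 0 s.
  have gy' : g y' = 0.
    have [|h1 h2] := seg 0; first by rewrite lexx ler01.
    rewrite /g IHp ?subrr //.
      by move: h1; rewrite rcr0 scale0r addr0.
    move=> v vp; rewrite mxE; case: eqP => // vu; apply: yv.
    rewrite ltn_neqAle -ltnS vp andbT; apply/eqP => e1; apply: vu; exact: val_inj.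
  have E0 : 0 <= B * 2^-1 ^+ N.
    have s0 : 0 <= \sum_s c s by apply: sumr_ge0 => s' _; exact: ltW.
    have B0 : 0 <= B := mulr_ge0 (mulr_ge0 (ler0n R 2) (le_trans ler01 (ltW Q))) s0.
    by rewrite mulr_ge0 // exprn_ge0 // invr_ge0.
  have -> : ysol y 0 s - z y 0 s = g (y' + hh) - g y' by rewrite gy' subr0 -yE.
  apply: le_trans (mean_value (M := d * (lip_cst * (B * 2^-1 ^+ N))) _) _; last first.
    rewrite exprS; have := ler_wpM2r E0 (dL Lc0); lra.
  move=> t ht; have [sd sv] := seg t ht.
  have [rz' dz hz] := solz _ sd; have ry' := soly _ sd.
  have sdz : nv (y' + rcr t *: hh) < zrad by apply: lt_le_trans dr.
  have dy := coord_differentiable s (ysol_diff sdz).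
  have dz' := coord_differentiable s dz.
  split; first exact: (differentiableB (f := (fun w => ysol w 0 s) : _ -> K^o) (g := (fun w => z w 0 s) : _ -> K^o) dy dz').
  rewrite /hh lin_formZ lin_form_unit nrmM; apply: ler_pM; rewrite ?nrm_ge0 //.
    by apply: ltW; apply: le_lt_trans hy; exact: nv_coord.
  have -> : pderiv u g (y' + rcr t *: hh) = pderiv u (fun w => ysol w 0 s) (y' + rcr t *: hh) -
     pderiv u (fun w => z w 0 s) (y' + rcr t *: hh).
    rewrite /pderiv (deriveB (f := (fun w => ysol w 0 s) : _ -> K^o) (g := (fun w => z w 0 s) : _ -> K^o)) //.
    - exact: diff_derivable.
    - exact: diff_derivable.
  have := hz s u => /eqP; rewrite addr_eq0 => /eqP ->.
  have := ysol_D u s sdz; rewrite (Zl_semi HF lmonom_le_weight) // => /esym/eqP; rewrite addr_eq0 => /eqP ->.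
  rewrite opprK -nrmN opprD opprK.
  apply: f_lipschitz => //; first exact: zrad_le_rho0.
  by move=> s'; apply: IHN.
apply/rowP => s; apply/esym/eqP; rewrite -subr_eq0 -(nrm_eq0 S) eq_le nrm_ge0 andbT.
by apply: (@le_pow2_0 _ B) => N; exact: main.
Qed.

End Solutions.

(** * Uniqueness of Laurent coefficients *)

Section EntireSeries.
Variable R : realType.
Local Notation Sr := (rcs_real R).
Local Notation is_sum := (@is_sum R).
Implicit Types (x th : R).

Lemma fset_iota (A : {fset nat}) : exists N, (A `<=` [fset i | i in iota 0 N])%fset.
Proof.
exists (\max_(i <- A) i).+1; apply/fsubsetP => i iA.
apply/imfsetP; exists i => //=; move: (mem_iota 0 (\max_(i <- A) i).+1 i); rewrite /= add0n ltnS => ->.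
exact: (@leq_bigmax_seq _ (enum_fset A) xpredT id).
Qed.

Lemma is_sum_series (a : nat -> R) B s : bd (fun i => `|a i|) B ->
  series a @ \oo --> s -> is_sum a s.
Proof.
move=> aB hs; have h := @summ_is_sum R R Sr _ a (ex_intro _ B aB).
suff ht : series a @ \oo --> (sum_of a : R) by rewrite (cvg_unique _ hs ht).
apply/cvgrPdist_lt => e e0; have [A hA] := (is_sumP Sr _ _).1 h _ e0.
have [N AN] := fset_iota A; exists N => // m /= Nm.
have := hA [fset i | i in iota 0 m]%fset; rewrite big_imfset /= ?/series /=; last by [].
rewrite /index_iota subn0 undup_id ?iota_uniq //; apply; apply: fsubset_trans AN _.
apply/fsubsetP => i /imfsetP[j /= jN ->]; move: jN; rewrite -[(_ \in _)]/(j \in iota 0 N) mem_iota /= add0n => jN.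
by apply/imfsetP; exists j => //=; rewrite -[(_ \in _)]/(j \in iota 0 m) mem_iota /= add0n (leq_trans jN).
Qed.

Lemma bd_series (p : nat -> R) s : (forall i, 0 <= p i) ->
  series p @ \oo --> s -> bd p s.
Proof.
move=> p0 hs A; have [N AN] := fset_iota A.
apply: le_trans (sum_fset_sub p0 AN) _; rewrite big_imfset //= undup_id ?iota_uniq //.
have -> : s = limn (series p) by rewrite (cvg_lim _ hs).
have := nondecreasing_cvgn_le (u_ := series p) _ (cvgP _ hs) N.
rewrite /series /= /index_iota subn0; apply.
by apply/nondecreasing_seqP => m; rewrite -subr_ge0 seriesSB.
Qed.

Lemma exp_bd x : 0 <= x -> bd (fun m => x ^+ m / m`!%:R) (expR x).
Proof.
move=> x0; apply: bd_series => [m|]; first by rewrite divr_ge0 ?exprn_ge0.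
exact: (is_cvg_series_exp_coeff x).
Qed.

Lemma exp_bd_nrm x (y : R) : `|x| <= y -> bd (fun m => `|x ^+ m / m`!%:R|) (expR y).
Proof.
move=> xy; apply: bd_le (exp_bd (le_trans (normr_ge0 x) xy)) (lexx _) => m.
rewrite normrM normrX normfV normr_nat ler_pM2r ?invr_gt0 ?ltr0n ?fact_gt0 //.
by rewrite lerXn2r ?nnegrE //; apply: le_trans xy.
Qed.

Lemma exp_sum x : is_sum (fun m => x ^+ m / m`!%:R) (expR x).
Proof.
apply: is_sum_series (exp_bd_nrm (lexx _)) _; exact: (is_cvg_series_exp_coeff x).
Qed.

(** [sin x / x] is the sum of [(-1)^(m/2) x^m / (m+1)!] over even [m]; against [x^m / m!] its
    coefficients are at most 1 in modulus. *)
Definition sinc_coeff (m : nat) : R := (~~ odd m)%:R * (-1) ^+ m./2 / m.+1%:R.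
Definition sinc x : R := if x == 0 then 1 else sin x / x.

Lemma sinc_coeff_le m : `|sinc_coeff m| <= 1.
Proof.
rewrite /sinc_coeff !normrM normrX normrN1 expr1n mulr1 normfV !normr_nat.
by rewrite ler_pdivrMr ?ltr0n // mul1r ler_nat; case: odd.
Qed.

Lemma sinc_sum x : is_sum (fun m => sinc_coeff m * (x ^+ m / m`!%:R)) (sinc x).
Proof.
rewrite /sinc; have [->|x0] := eqVneq x 0.
  have := @is_sum_single R R Sr _ (fun m => sinc_coeff m * (0 ^+ m / m`!%:R)) 0%N.
  rewrite /= /sinc_coeff /= fact0 !expr0 !(mul1r, divr1); apply.
  by move=> m m0; rewrite expr0n (negPf m0) !(mul0r, mulr0).
have hb : bd (fun m => `|sinc_coeff m * (x ^+ m / m`!%:R)|) (expR `|x|).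
  apply: bd_le (exp_bd_nrm (lexx _)) (lexx _) => m.
  by rewrite normrM ler_piMl ?sinc_coeff_le.
apply: is_sum_series hb _.
have hs : series (sin_coeff x) @ \oo --> sin x.
  by rewrite unlock; exact: is_cvg_series_sin_coeff.
have hs1 : (fun m => series (sin_coeff x) m.+1 / x) @ \oo --> sin x / x.
  by apply: cvgM; [rewrite (cvg_shiftS (series (sin_coeff x))) | exact: cvg_cst].
apply: cvg_trans hs1; apply: near_eq_cvg; near=> m.
rewrite /series /= big_nat_recl //= mulrDl /sin_coeff /= !mul0r add0r mulr_suml.
apply: eq_bigr => i _; rewrite /sinc_coeff exprS factS natrM.
have := ltr0n R i.+1; have := fact_gt0 i; rewrite -(ltr0n R).
move: (~~ odd i)%:R ((-1) ^+ i./2) (x ^+ i) (i`!%:R) (i.+1%:R) => a b c d e d0 e0.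
by field; rewrite x0 !gt_eqF.
Unshelve. all: by end_near.
Qed.

Lemma sin_le_norm x : `|sin x| <= `|x|.
Proof.
wlog x0 : x / 0 <= x => [hw|].
  have [/hw //|xn] := lerP 0 x; rewrite -normrN -sinN -[leRHS]normrN; apply: hw; lra.
have hd (y : R) : y \in `]0, x[%R -> is_derive y 1 (@sin R) (cos y).
  by move=> _; exact: is_derive_sin.
have hc : {within `[0, x], continuous (@sin R)}.
  by apply: continuous_subspaceT => y; exact: continuous_sin.
have [c _] := MVT_segment x0 hd hc.
rewrite sin0 !subr0 => ->; rewrite normrM ler_piMl //; exact: cos_max.
Qed.

(** [sin x = 2 sin (x/2) cos (x/2)] with [|sin (x/2)| <= |x/2|], and [|cos (x/2)| < 1] unless
    [sin (x/2) = 0]. *)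
Lemma sinc_lt1 x : x != 0 -> `|sinc x| < 1.
Proof.
move=> x0; rewrite /sinc (negPf x0) normrM normfV ltr_pdivrMr ?normr_gt0 // mul1r.
rewrite (_ : x = (x / 2) *+ 2); last by rewrite -mulr_natr mulfVK.
rewrite sin_mulr2n !normrMn ltrMn2r /= normrM.
have y0 : x / 2 != 0 by rewrite mulf_neq0 ?invr_eq0 //.
have [s0|s0] := eqVneq (sin (x / 2)) 0; first by rewrite s0 normr0 mulr0 normr_gt0.
apply: lt_le_trans (sin_le_norm _); rewrite gtr_pMl ?normr_gt0 //.
rewrite -(ltr_pXn2r (n := 2)) ?nnegrE // expr1n real_normK ?num_real //.
have := cos2Dsin2 (x / 2); have : 0 < sin (x / 2) ^+ 2 by rewrite exprn_even_gt0.
lra.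
Qed.

Lemma sinc0 : sinc 0 = 1. Proof. by rewrite /sinc eqxx. Qed.

Lemma sinc_le1 x : `|sinc x| <= 1.
Proof.
have [->|/sinc_lt1/ltW //] := eqVneq x 0; by rewrite sinc0 normr1.
Qed.

End EntireSeries.

(** * Moments of exponential sums *)

Section ExponentialSums.
Variable R : realType.
Local Notation Sr := (rcs_real R).
Local Notation sum_of := (@sum_of R).

Lemma exp_family_bd (I : choiceType) (be p : I -> R) (eta ta : R) : `|ta| <= eta ->
  forall i, bd (fun m => `|be i * ((ta * p i) ^+ m / m`!%:R)|) (`|be i| * expR (eta * `|p i|)).
Proof.
move=> hta i A; under eq_bigr do rewrite normrM.
rewrite -mulr_sumr ler_wpM2l //; apply: exp_bd_nrm.
by rewrite normrM ler_wpM2r.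
Qed.

(** The sum is a power series in [ta] whose coefficients are the moments, and it vanishes near 0. *)
Lemma exp_moment (I : choiceType) (be p : I -> R) (eta eta' B : R) :
  bd (fun i => `|be i| * expR (eta * `|p i|)) B -> 0 < eta' -> eta' <= eta ->
  (forall ta, `|ta| < eta' -> sum_of (fun i => be i * expR (ta * p i)) = 0) ->
  forall m, sum_of (fun i => be i * (p i ^+ m / m`!%:R)) = 0.
Proof.
move=> hB e0 ee h m0; pose mu m := sum_of (fun i => be i * (p i ^+ m / m`!%:R)).
have key ta : `|ta| < eta' -> is_sum (fun m => mu m * ta ^+ m) 0.
  move=> hta; have ht : `|ta| <= eta by apply: le_trans ee; exact: ltW.
  have [_ _ f3 _ f5 f6 f7] := fubini (S := Sr) (exp_family_bd be p ht) hB.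
  have -> : (fun m => mu m * ta ^+ m) =
      (fun m => sum_of (fun i => be i * ((ta * p i) ^+ m / m`!%:R))).
    apply/funext => m.
    have [t0|t0] := eqVneq (ta ^+ m) 0.
      rewrite t0 mulr0 (sum_of_ext (b := fun=> 0)) ?(is_sumE Sr (is_sum0 Sr _)) //.
      by move=> i; rewrite exprMn t0 !mul0r mulr0.
    have hs : summ Sr (fun i => be i * (p i ^+ m / m`!%:R)).
      have := summZ (ta ^+ m)^-1 (f3 m); apply: summ_ext => i.
      rewrite exprMn; move: (p i ^+ m) (m`!%:R^-1) (be i) (ta ^+ m) t0 => a b c d d0.
      by field.
    rewrite mulrC -(@sum_ofZ _ _ Sr) //; apply: sum_of_ext => i.
    rewrite exprMn; move: (p i ^+ m) (m`!%:R^-1) (be i) (ta ^+ m) => a b c d; ring.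
  have -> : 0 = sum_of (fun m => sum_of (fun i => be i * ((ta * p i) ^+ m / m`!%:R))).
    rewrite f7 -f6 -(h _ hta); apply: sum_of_ext => i; apply/esym.
    by apply: (is_sumE Sr); apply: (is_sumZ Sr); exact: exp_sum.
  exact: (summ_is_sum f5).
have [Q hQ QB] := bd_swap (p := fun i m => `|be i * ((eta' * p i) ^+ m / m`!%:R)|)
   (fun _ _ => normr_ge0 _) (exp_family_bd be p (le_trans (le_of_eq (gtr0_norm e0)) ee)) hB.
have hmu m : `|mu m| * eta' ^+ m <= Q m.
  rewrite -[eta' ^+ m]gtr0_norm ?exprn_gt0 // -normrM.
  have := sum_of_nrm (S := Sr) (hQ m); congr (_ <= _).
  have hs : summ Sr (fun i => be i * (p i ^+ m / m`!%:R)).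
    have h2 : summ Sr (fun i => be i * ((eta' * p i) ^+ m / m`!%:R)) by exists (Q m); exact: hQ.
    have := summZ (eta' ^+ m)^-1 h2; apply: summ_ext => i.
    have : eta' ^+ m != 0 by rewrite expf_neq0 // gt_eqF.
    rewrite exprMn; move: (p i ^+ m) (m`!%:R^-1) (be i) (eta' ^+ m) => a b c d d0.
    by field.
  rewrite /= mulrC -(@sum_ofZ _ _ Sr) //; congr `|_|; apply: sum_of_ext => i.
  rewrite exprMn; move: (p i ^+ m) (m`!%:R^-1) (be i) (eta' ^+ m) => a b c d; ring.
(* The series in [ta] is rewritten over ['rV_1], so that [powser_uniq] applies. *)
have mdeg1 (M : 'rV[nat]_1) : mdeg M = M 0 0 by rewrite /mdeg big_ord1.
have A1 : powser Sr (0 : 'rV[R]_1) eta' (fun=> 0) (fun M => mu (M 0 0)) B.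
  split=> //.
    have := @bd_inj R nat 'rV[nat]_1 (fun M => M 0 0) _ _ _ (bd_le hmu QB (lexx _)).
    under [X in _ -> bd X _]eq_fun do rewrite mdeg1.
    by apply=> M M' e; apply/rowP => z; rewrite ord1.
  move=> x; rewrite subr0 => hx.
  have c1 : cancel (fun M : 'rV[nat]_1 => M 0 0) (fun i => \row_(_ < 1) i).
    by move=> M; apply/rowP => z; rewrite mxE ord1.
  have c2 : cancel (fun i : nat => \row_(_ < 1) i) (fun M : 'rV[nat]_1 => M 0 0).
    by move=> i; rewrite mxE.
  have h1 := is_sum_bij Sr c1 c2 (key (x 0 0) (le_lt_trans (nv_coord Sr x 0) hx)).
  apply: is_sum_ext h1 => M /=.
  by rewrite /monom big_ord1.
have A2 : powser Sr (0 : 'rV[R]_1) eta' (fun=> 0) (fun=> 0) 0.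
  split=> // [D|x _]; first by rewrite big1 // => M _; rewrite nrm0 mul0r.
  by have := is_sum0 Sr 'rV[nat]_1; apply: is_sum_ext => M; rewrite mul0r.
have nr : \forall y \near (0 : 'rV[R]_1), (0 : R) = 0 by near=> y.
have := powser_uniq A1 A2 nr.
by move=> /(congr1 (fun a => a (\row_(_ < 1) m0))); rewrite mxE.
Unshelve. all: by end_near.
Qed.

(* All the moments of [be] vanish, hence so does the sum of [be] against an entire
   function of exponential type at most [eta]. *)
Lemma exp_sinc (I : choiceType) (be p : I -> R) (eta eta' B : R) :
  bd (fun i => `|be i| * expR (eta * `|p i|)) B -> 0 < eta' -> eta' <= eta ->
  (forall ta, `|ta| < eta' -> sum_of (fun i => be i * expR (ta * p i)) = 0) ->
  sum_of (fun i => be i * sinc (eta * p i)) = 0.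
Proof.
move=> hB e0 ee h; have mom := exp_moment hB e0 ee h.
have h1 i : bd (fun m => `|be i * (sinc_coeff R m * ((eta * p i) ^+ m / m`!%:R))|)
    (`|be i| * expR (eta * `|p i|)).
  apply: bd_le (exp_family_bd be p (le_of_eq (gtr0_norm (lt_le_trans e0 ee))) i) (lexx _) => m.
  by rewrite !normrM ler_wpM2l // -!normrM normrM ler_piMl ?sinc_coeff_le.
have [_ _ f3 _ f5 f6 f7] := fubini (S := Sr) h1 hB.
rewrite (sum_of_ext (b := fun i => sum_of (fun m => be i * (sinc_coeff R m * ((eta * p i) ^+ m / m`!%:R))))).
  rewrite f6 -f7 (sum_of_ext (b := fun=> 0)) ?(is_sumE Sr (is_sum0 Sr _)) // => m.
  have [c0|c0] := eqVneq (sinc_coeff R m * eta ^+ m) 0.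
    rewrite (sum_of_ext (b := fun=> 0)) ?(is_sumE Sr (is_sum0 Sr _)) // => i.
    rewrite exprMn -[RHS](mul0r (be i * (p i ^+ m / m`!%:R))) -c0.
    by move: (sinc_coeff R m) (eta ^+ m) (p i ^+ m) (m`!%:R^-1) (be i) => a b c d g; ring.
  have e : sum_of (fun i => (sinc_coeff R m * eta ^+ m)^-1 *
     (be i * (sinc_coeff R m * ((eta * p i) ^+ m / m`!%:R)))) = 0.
    rewrite -[RHS](mom m); apply: sum_of_ext => i; rewrite exprMn.
    move: (sinc_coeff R m) (eta ^+ m) c0 (p i ^+ m) (m`!%:R^-1) (be i).
    move=> a b; rewrite mulf_eq0 negb_or => /andP[a0 b0] c d g.
    by field; rewrite ?a0 ?b0.
  move: e; rewrite (@sum_ofZ _ _ Sr); last exact: f3.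
  by move=> /eqP; rewrite mulf_eq0 invr_eq0 (negPf c0) => /eqP.
move=> i; apply/esym; apply: (is_sumE Sr); apply: (is_sumZ Sr); exact: sinc_sum.
Qed.

End ExponentialSums.

(** * Isolating one exponent by products of cardinal sines *)

Section MultiExponential.
Variables (R : realType) (n : nat) (I : choiceType) (be : I -> R) (p : I -> 'I_n -> R).
Variables (eta B : R).
Local Notation Sr := (rcs_real R).
Local Notation sum_of := (@sum_of R).
Local Notation expo t i := (expR (\sum_s t s * p i s)).
Hypothesis eta0 : 0 < eta.
Hypothesis hB : bd (fun i => `|be i| * expR (2 * eta * \sum_s `|p i s|)) B.

(* The constant 1 vanishes in this sense when the exponential sum does; as the
   set of vanishing [phi] is stable under products with [sinc (eta * p_s)], it
   contains functions concentrated at the zeros of p. *)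
Definition vanishing (phi : I -> R) :=
  (forall i, `|phi i| <= 1) /\
  forall t : 'I_n -> R, (forall s, `|t s| < eta) -> sum_of (fun i => be i * phi i * expo t i) = 0.

(** For fixed [t], moving [t_s] by [ta] keeps the sum zero as long as [|ta| < eta - |t_s|], and
    [exp_sinc] turns this into the factor [sinc]. The [2 * eta] in [hB] pays once for [t] and once
    for the exponential type [eta] of [sinc]. *)
Lemma vanishing_sinc phi s : vanishing phi -> vanishing (fun i => phi i * sinc (eta * p i s)).
Proof.
move=> [p1 hphi]; split=> [i|t ht].
  by rewrite normrM mulr_ile1 // sinc_le1.
pose be' i := be i * phi i * expo t i.
have hB' : bd (fun i => `|be' i| * expR (eta * `|p i s|)) B.
  apply: bd_le hB (lexx _) => i; rewrite /be' !normrM (gtr0_norm (expR_gt0 _)) -!mulrA -expRD mulrA.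
  apply: ler_pM => //; rewrite ?expR_ge0 ?mulr_ge0 ?ler_piMr //.
  rewrite ler_expR mulr_natl mulr2n.
  apply: lerD.
    rewrite mulr_sumr ler_sum // => s' _.
    apply: le_trans (ler_norm _) _; rewrite normrM ler_wpM2r // ltW //.
  rewrite ler_wpM2l ?(ltW eta0) // (bigD1 s) //= lerDl sumr_ge0 //.
have t1 : 0 < eta - `|t s| by rewrite subr_gt0.
have t2 : eta - `|t s| <= eta by rewrite gerBl.
have h : forall ta, `|ta| < eta - `|t s| -> sum_of (fun i => be' i * expR (ta * p i s)) = 0.
  move=> ta hta; rewrite -[RHS](hphi (fun s' => t s' + (s' == s)%:R * ta)).
    apply: sum_of_ext => i; rewrite /be' -[LHS]mulrA -expRD; congr (_ * expR _).
    under [in RHS]eq_bigr do rewrite mulrDl.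
    rewrite big_split /=; congr (_ + _); rewrite (bigD1 s) //= eqxx mul1r big1 ?addr0 //.
    by move=> s' /negPf ->; rewrite !mul0r.
  move=> s'; case: eqP => [->|_]; last by rewrite mul0r addr0.
  by rewrite mul1r; apply: le_lt_trans (ler_normD _ _) _; rewrite -ltrBrDl.
rewrite -[RHS](exp_sinc hB' t1 t2 h); apply: sum_of_ext => i.
rewrite /be'; move: (be i) (phi i) (expo t i) (sinc _) => a b c d; ring.
Qed.

Definition sincs (i : I) := \prod_s sinc (eta * p i s).

Lemma vanishing_sincs phi m : vanishing phi -> vanishing (fun i => phi i * sincs i ^+ m).
Proof.
move=> hphi; elim: m => [|m IH].
  by rewrite (_ : (fun i => _) = phi) //; apply/funext => i; rewrite expr0 mulr1.
have step (r : seq 'I_n) psi : vanishing psi ->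
    vanishing (fun i => psi i * \prod_(s <- r) sinc (eta * p i s)).
  elim: r psi => [|s r IHr] psi hpsi.
    by rewrite (_ : (fun i => _) = psi) //; apply/funext => i; rewrite big_nil mulr1.
  under eq_fun do rewrite big_cons mulrA; apply: IHr; exact: vanishing_sinc.
under eq_fun do rewrite exprSr mulrA; exact: step.
Qed.

Hypothesis one : vanishing (fun=> 1).
Variable i0 : I.
Hypothesis p0 : forall s, p i0 s = 0.
Hypothesis pn0 : forall i, i != i0 -> exists s, p i s != 0.

(** The powers of [sincs] tend to the indicator of [i0]: the product is 1 there and less than 1 in
    modulus elsewhere. Dominated convergence leaves the single term [be i0]. *)
Lemma vanishing_coef : be i0 = 0.
Proof.
have c1 i : `|sincs i| <= 1.
  by rewrite /sincs normr_prod; apply: prodr_ile1 => s _; rewrite normr_ge0 sinc_le1.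
have c0 : sincs i0 = 1 by rewrite /sincs big1 // => s _; rewrite p0 mulr0 sinc0.
have clt i : i != i0 -> `|sincs i| < 1.
  move=> /pn0[s ps]; rewrite /sincs (bigD1 s) //= normrM.
  apply: le_lt_trans (_ : `|sinc (eta * p i s)| < 1).
    rewrite ler_piMr // normr_prod; apply: prodr_ile1 => s' _.
    by rewrite normr_ge0 sinc_le1.
  by apply: sinc_lt1; rewrite mulf_neq0 // gt_eqF.
have hM m : sum_of (fun i => be i * sincs i ^+ m) = 0.
  have [_ h] := vanishing_sincs m one.
  rewrite -[RHS](h (fun=> 0)) => [|s]; last by rewrite normr0.
  apply: sum_of_ext => i; rewrite big1 ?expR0 ?mulr1 ?mul1r // => s _; exact: mul0r.
have bB : bd (fun i => `|be i|) B.
  apply: bd_le hB (lexx _) => i; rewrite ler_peMr // -expR0 ler_expR.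
  by rewrite mulr_ge0 ?sumr_ge0 // mulr_ge0 // ltW.
apply/eqP; rewrite -normr_le0; apply/ler_addgt0Pr => e e0; rewrite add0r.
have e20 : 0 < e / 2 by rewrite divr_gt0.
have [A hA] := bd_tail (fun i => normr_ge0 _) bB e20.
(* As [A] is finite, one [d > 0] separates from 1 all the [|sincs i|] with [i] in [A] other than
   [i0]; [Num.min d 1] keeps the base of the power nonnegative. *)
have g0 i : 0 < if i == i0 then 1 else 1 - `|sincs i|.
  by case: eqP => // /eqP /clt; rewrite subr_gt0.
have [d d0 hd] := min_pos A g0.
have [m hm] : exists m, B * (1 - Num.min d 1) ^+ m < e / 2.
  have r0 : 0 <= 1 - Num.min d 1 by rewrite subr_ge0 ge_min lexx orbT.
  have r1 : 1 - Num.min d 1 < 1 by rewrite gtrBl lt_min d0 ltr01.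
  have B0 : 0 <= B := bd_ge0 bB.
  have cv := @cvg_geometric R B (1 - Num.min d 1).
  have : `|1 - Num.min d 1| < 1 by rewrite ger0_norm.
  move=> /cv /cvgrPdist_lt /(_ _ e20) [m _ /(_ m (leqnn _))] /=.
  rewrite sub0r normrN ger0_norm; last by rewrite mulr_ge0 ?exprn_ge0.
  by exists m.
pose b i := if i == i0 then 0 else be i * sincs i ^+ m.
have bb i : `|b i| <= `|be i|.
  rewrite /b; case: eqP => _; first by rewrite normr0.
  by rewrite normrM ler_piMr // normrX exprn_ile1.
have bA i : i \in A -> `|b i| <= `|be i| * (1 - Num.min d 1) ^+ m.
  move=> iA; have := hd i iA; rewrite /b; case: eqP => [_ _|_ dle].
    by rewrite normr0 mulr_ge0 ?exprn_ge0 // subr_ge0 ge_min lexx orbT.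
  rewrite normrM normrX ler_wpM2l // lerXn2r ?nnegrE //.
    by rewrite subr_ge0 ge_min lexx orbT.
  rewrite lerBrDl -lerBrDr ge_min dle //.
have hb : bd (fun i => `|b i|) e.
  move=> D; rewrite (big_fsetID _ (mem A)) /=.
  have -> : e = e / 2 + e / 2 by lra.
  apply: lerD; last first.
    apply: ltW; apply: le_lt_trans (hA [fset x in D | x \notin A]%fset _).
      exact: ler_sum.
    by apply/fdisjointP => x xA; rewrite !inE xA /= andbF.
  apply: le_trans (ltW hm).
  apply: (@le_trans _ _ (\sum_(i <- [fset x in D | x \in A]%fset) `|be i| * (1 - Num.min d 1) ^+ m)).
    rewrite big_seq [leRHS]big_seq; apply: ler_sum => i; rewrite !inE => /andP[_ iA].
    exact: bA.
  by rewrite -mulr_suml ler_wpM2r // exprn_ge0 // subr_ge0 ge_min lexx orbT.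
have hs1 : summ Sr (fun i => be i * sincs i ^+ m).
  by apply: summ_le bB => i; rewrite /= normrM ler_piMr // normrX exprn_ile1.
have := sum_of_nrm (S := Sr) (a := b) hb.
have h2 : is_sum (fun i => if i == i0 then be i else 0) (be i0).
  have := @is_sum_single R R Sr _ (fun i => if i == i0 then be i else 0) i0.
  by rewrite eqxx; apply => i /negPf ->.
have h3 := is_sumD Sr (is_sumZ Sr (c := -1) h2) (summ_is_sum hs1).
have -> : sum_of b = - be i0.
  apply: (is_sumE Sr); move: h3; rewrite hM addr0 mulN1r; apply: is_sum_ext => i.
  rewrite /b; case: eqP => [->|_]; last by rewrite mulr0 add0r.
  by rewrite c0 expr1n mulr1 mulN1r addNr.
by rewrite /= normrN.
Qed.
End MultiExponential.

(** * Laurent series vanishing on a cube of dilations *)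

Section LaurentUniqueness.
Variables (R : realType) (K : numFieldType) (S : rcs R K) (n : nat).
Local Notation rcr := (rcr S).
Local Notation nrm := (nrm S).
Local Notation Sr := (rcs_real R).
Local Notation J := ('rV[int]_n).
Local Notation pair t j := (\sum_s t s * (j 0%R s)%:~R).
Implicit Types (t : 'I_n -> R) (j : J).

Definition scaled (y : 'rV[K]_n) (t : 'I_n -> R) : 'rV[K]_n := \row_s (y 0 s * rcr (expR (t s))).

Lemma lmonom_scaled y t j : lmonom (scaled y t) j = rcr (expR (pair t j)) * lmonom y j.
Proof.
rewrite /lmonom expR_sum.
have -> : rcr (\prod_s expR (t s * (j 0 s)%:~R)) = \prod_s rcr (expR (t s * (j 0 s)%:~R)).
  by elim/big_rec2: _ => [|s a b _ <-]; rewrite ?rcr_one ?rcr_mul.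
rewrite -big_split; apply: eq_bigr => s _ /=; rewrite mxE mulrC.
case: (j 0 s) => m; rewrite ?NegzE -?exprnN -?exprnP exprMn.
  by rewrite -pmulrn expRM_natr rcrX.
by rewrite invfM mulrNz mulrN -pmulrn expRN expRM_natr rcrV rcrX.
Qed.

Lemma real_laurent_uniq (be : J -> R) (eta : R) : 0 < eta ->
  (forall t, (forall s, `|t s| <= eta) -> summ Sr (fun j => be j * expR (pair t j)) /\
     sum_of (fun j => be j * expR (pair t j)) = 0) ->
  forall j, be j = 0.
Proof.
move=> e0 h j0.
pose p (j : J) s := ((j - j0) 0 s)%:~R : R.
have sp t j : pair t j = \sum_s t s * p j s + pair t j0.
  rewrite -big_split; apply: eq_bigr => s _ /=; rewrite /p !mxE intrD mulrDr intrN.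
  by rewrite mulrN subrK.
have hp t : (forall s, `|t s| <= eta) -> summ Sr (fun j => be j * expR (\sum_s t s * p j s)) /\
     sum_of (fun j => be j * expR (\sum_s t s * p j s)) = 0.
  move=> ht; have [h1 h2] := h t ht.
  have -> : (fun j => be j * expR (\sum_s t s * p j s)) =
      (fun j => (expR (pair t j0))^-1 * (be j * expR (pair t j))).
    apply/funext => j; rewrite (sp t j) expRD.
    have := expR_gt0 (pair t j0); move: (expR _) (expR _) => a b b0.
    by field; rewrite gt_eqF.
  by split; [exact: (summZ _ h1) | rewrite (@sum_ofZ _ _ Sr) // h2 mulr0].
(* For each [j] one choice of signs gives the exponent [eta \sum_s |p j s|], so finitely many
   corners [t] yield the exponential weight required of [be]. *)
pose tc (e : {ffun 'I_n -> bool}) s : R := if e s then eta else - eta.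
have tcE e s : `|tc e s| <= eta by rewrite /tc; case: (e s); rewrite ?normrN gtr0_norm.
have [Bc hBc] := choice (fun e => (hp _ (tcE e)).1).
have hB : bd (fun j => `|be j| * expR (2 * (eta / 2) * \sum_s `|p j s|)) (\sum_e Bc e).
  apply: bd_le (bd_sum hBc) (lexx _) => j.
  pose ep := [ffun s => 0 <= p j s].
  rewrite (bigD1 ep) //= normrM (gtr0_norm (expR_gt0 _)).
  have -> : 2 * (eta / 2) * \sum_s `|p j s| = \sum_s tc ep s * p j s.
    rewrite [2 * _](mulrC 2) mulfVK // mulr_sumr; apply: eq_bigr => s _; rewrite /tc ffunE.
    case: ifP => [/ger0_norm -> //|/negbT]; rewrite -ltNge => /ltr0_norm ->.
    by rewrite mulrN mulNr.
  by rewrite lerDl sumr_ge0.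
apply: (vanishing_coef (eta := eta / 2) _ hB).
- by rewrite divr_gt0.
- split=> [i|t ht]; first by rewrite normr1.
  under eq_fun do rewrite mulr1; apply: (hp _ _).2 => s.
  by apply: le_trans (ltW (ht s)) _; rewrite ler_pdivrMr // ler_peMr ?(ltW e0) // ler1n.
- by move=> s; rewrite /p subrr mxE.
move=> j jj0; have : j - j0 != 0 by rewrite subr_eq0.
move=> hj; apply: contrapT => hn; case/negP: hj; apply/eqP/rowP => s; rewrite [RHS]mxE.
by apply/eqP; apply: contrapT => /negP hs; apply: hn; exists s; rewrite /p intr_eq0.
Qed.

Lemma is_sum_part (phi : K -> R) (I : choiceType) (a : I -> K) s :
  (forall x y, phi (x + y) = phi x + phi y) -> (forall x, `|phi x| <= nrm x) ->
  is_sum a s -> is_sum (fun i => phi (a i)) (phi s).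
Proof.
move=> phiD phin /(is_sumP S) h; apply/(is_sumP Sr) => e e0; have [A hA] := h _ e0.
exists A => D /hA; apply: le_lt_trans => /=.
have phi0 : phi 0 = 0 by apply: (addIr (phi 0)); rewrite -phiD !add0r.
have -> : phi s - \sum_(i <- D) phi (a i) = phi (s - \sum_(i <- D) a i).
  have -> : \sum_(i <- D) phi (a i) = phi (\sum_(i <- D) a i).
    by elim/big_rec2: _ => [|i x y _ ->]; rewrite ?phi0 ?phiD.
  by apply: (addIr (phi (\sum_(i <- D) a i))); rewrite subrK -phiD subrK.
exact: phin.
Qed.

(** Only positive dilations of [y] enter. They multiply each term by a positive real, so the real
    and imaginary parts of the terms are the coefficients of real exponential sums. *)
Lemma laurent_uniq (d : J -> K) (y : 'rV[K]_n) (eta : R) : 0 < eta ->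
  (forall t, (forall s, `|t s| <= eta) -> summ S (fun j => d j * lmonom (scaled y t) j) /\
     sum_of (fun j => d j * lmonom (scaled y t) j) = 0) ->
  forall j, d j * lmonom y j = 0.
Proof.
move=> e0 h.
have part (phi : K -> R) : (forall x y, phi (x + y) = phi x + phi y) ->
   (forall r a, phi (rcr r * a) = r * phi a) -> (forall x, `|phi x| <= nrm x) ->
   forall j, phi (d j * lmonom y j) = 0.
  move=> phiD phiZ phin; apply: (real_laurent_uniq e0) => t ht.
  have E j : phi (d j * lmonom y j) * expR (pair t j) = phi (d j * lmonom (scaled y t) j).
    by rewrite lmonom_scaled mulrCA phiZ mulrC.
  rewrite (_ : (fun j => _) = (fun j => phi (d j * lmonom (scaled y t) j))); last exact/funext.
  have [h1 h2] := h t ht; split.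
    by have [B hB] := h1; apply: summ_le hB => j; exact: phin.
  have -> : 0 = phi 0 by apply: (addIr (phi 0)); rewrite -phiD !add0r.
  by rewrite -h2; apply: (is_sumE Sr); exact: (is_sum_part phiD phin (summ_is_sum h1)).
move=> j; rewrite [LHS](reim S).
rewrite (part _ (re_add S) (re_scale S) (re_nrm S)) (part _ (im_add S) (im_scale S) (im_nrm S)).
by rewrite rcr0 mul0r addr0.
Qed.
End LaurentUniqueness.

(** * Integrability conditions *)

Section Curvature.
Variables (R : realType) (K : numFieldType) (S : rcs R K) (n k : nat).
Local Notation nv := (@nv R K S k).
Local Notation nbound := (@nbound R K S k).
Local Notation J := ('rV[int]_n).
Variable f : 'I_n -> J -> 'I_k -> 'rV[K]_k -> K.
Implicit Types (u v : 'I_k) (x : 'rV[K]_k) (i j t : J).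
Variables (x0 : 'rV[K]_k) (rho0 : R) (c : 'I_n -> R) (q0 K0 : R).
Hypothesis HF : fbound S f x0 rho0 c q0 K0.
Local Notation rs := (rs rho0).
Local Notation qs := (qs q0).
Local Notation scb := (scb S x0 rho0 c q0).
Let c0 : forall s, 0 < c s. Proof. by case: HF. Qed.
Let w0 i : 0 < wt c i. Proof. exact: wt_gt0. Qed.
Let q01 : 1 < q0. Proof. by case: HF. Qed.
Let r00 : 0 < rho0. Proof. by case: HF. Qed.

Lemma idcol_nb j t : nbound 0 x0 rho0 (idmat t j) ((wt c j)^-1 * wt c t * 1 ^+ la t).
Proof.
have -> : @idmat K n k t j = (fun=> (t == j)%:R) by apply/funext => x; rewrite idmatE.
apply: nb_le (nb_cst S _ _ r00) _; rewrite nrm_nat expr1n mulr1.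
by case: eqP => [->|_]; rewrite ?mulVf ?gt_eqF // mulr_ge0 ?invr_ge0 ?ltW.
Qed.

(** [commutator] with a column of the identity matrix for [a]. *)
Lemma curvatureE i j u v x : nv (x - x0) < rho0 ->
  Rfun f i j u v x = Dop f u (Dop f v (@idmat K n k)) i j x - Dop f v (Dop f u (@idmat K n k)) i j x.
Proof.
move=> hx; have wj : 0 <= (wt c j)^-1 by rewrite invr_ge0 ltW.
have [_] := commutator HF u v i r00 (lexx _) (lexx 1) q01 wj (idcol_nb j) hx.
rewrite /Dop /hmul => ->.
rewrite (@sum_of_single _ _ S _ _ j); first by rewrite idmatE eqxx mulr1.
by move=> t /negPf tj; rewrite idmatE tj mulr0.
Qed.

Lemma Dop_near (I' : Type) (A B : J -> I' -> 'rV[K]_k -> K) rho u i (j : I') x : nv (x - x0) < rho ->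
  (forall y t, nv (y - x0) < rho -> A t j y = B t j y) -> Dop f u A i j x = Dop f u B i j x.
Proof.
move=> hx AB; rewrite /Dop /hmul; congr (_ + _); last by apply: sum_of_ext => t; rewrite AB.
by apply: pderiv_near; apply: (near_ball (S := S) hx) => y; exact: AB.
Qed.

Let half0 : (0 : R) < 2^-1. Proof. by rewrite invr_gt0. Qed.
Let half1 : (2^-1 : R) <= 1. Proof. by rewrite invf_le1 // ler1n. Qed.

Lemma Dword_idmat_scb l : exists2 M, 0 <= M & scb 0 2^-1 (wt c) (Dword f l (@idmat K n k)) M.
Proof.
have := Dword_scb HF w0 l (idmat_scb HF) (lexx 0) half0 half1 ler01.
set M := _ * _; exists M => //; rewrite /M mul1r.
case: l {M H} => [|u l]; first by rewrite expr0.
by rewrite exprn_ge0 // mulr_ge0 // divr_ge0 ?(Dcost_ge0 HF u) // subr0 ltW.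
Qed.

(* When the curvature vanishes, D_u may be moved to its place in the word. *)
Lemma flat_words : (forall i j u v x, nv (x - x0) < rs 1 -> Rfun f i j u v x = 0) ->
  forall l1 l2 u i j x, nv (x - x0) < rs 1 ->
  Dop f u (Dword f (l1 ++ l2) (@idmat K n k)) i j x = Dword f (l1 ++ u :: l2) (@idmat K n k) i j x.
Proof.
move=> R0; elim=> [//|v l1 IH] l2 u i j x hx /=.
have [M M0 hM] := Dword_idmat_scb (l1 ++ l2).
have hx' : nv (x - x0) < rs 2^-1 by apply: lt_le_trans hx _; exact: (rs_anti HF).
have r1 : 0 < rs 2^-1 by exact: (rs_gt0 HF).
have r2 : rs 2^-1 <= rho0 by rewrite -[leRHS](rs0 rho0); apply: (rs_anti HF); exact: ltW.
have k1 : 1 <= qs 2^-1 by apply: (qs_ge1 HF); exact: ltW.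
have k2 : qs 2^-1 < q0 by have := q01; rewrite /qs; lra.
have M1 : 0 <= M / wt c j by rewrite divr_ge0 // ltW.
have hA t : nbound 0 x0 (rs 2^-1) (Dword f (l1 ++ l2) (@idmat K n k) t j)
    (M / wt c j * wt c t * qs 2^-1 ^+ la t).
  apply: nb_le (mcb_entry w0 t j hM) _.
  by apply: le_of_eq; ring.
have Z0 : sum_of (fun t => Rfun f i t u v x * Dword f (l1 ++ l2) (@idmat K n k) t j x) = 0.
  by rewrite (sum_of_ext (b := fun=> 0)) ?(is_sumE S (is_sum0 S _)) // => t; rewrite R0 ?mul0r.
have [_] := commutator HF u v i r1 r2 k1 k2 M1 hA hx'; rewrite Z0.
move=> /eqP; rewrite subr_eq0 => /eqP e; transitivity (Dop f v (Dop f u (Dword f (l1 ++ l2) (@idmat K n k))) i j x); first exact: e.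
by apply: (Dop_near (rho := rs 1)) => // y t hy; rewrite -IH.
Qed.
End Curvature.

(** * Sufficiency and the series for the solution *)

Section Sufficiency.
Variables (R : realType) (K : numFieldType) (S : rcs R K) (n k : nat).
Local Notation nrm := (nrm S).
Local Notation nv := (@nv R K S k).
Local Notation summ := (summ S).
Local Notation J := ('rV[int]_n).
Variable f : 'I_n -> J -> 'I_k -> 'rV[K]_k -> K.
Implicit Types (u v : 'I_k) (x : 'rV[K]_k) (i j t : J).
Variables (rho0 : R) (c : 'I_n -> R) (q0 K0 : R).
Hypothesis HF : fbound S f 0 rho0 c q0 K0.
Local Notation rs := (rs rho0).
Local Notation qs := (qs q0).
Local Notation zrad := (zrad k rho0 c q0 K0).
Let c0 : forall s, 0 < c s. Proof. by case: HF. Qed.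
Let w0 i : 0 < wt c i. Proof. exact: wt_gt0. Qed.
Let q01 : 1 < q0. Proof. by case: HF. Qed.
Hypothesis R0 : forall i j u v x, nv x < rs 1 -> Rfun f i j u v x = 0.

Lemma Pm_flat w u i j x : nv x < rs 1 ->
  Dop f u (Pm f w) i j x = Pm f (w + unit_tuple nat u) i j x.
Proof.
move=> hx; rewrite /Pm; have [l1 [l2 [-> -> _]]] := word_unit w u.
by apply: (flat_words HF) => [i' j' u' v' y|]; rewrite subr0 //; exact: R0.
Qed.

Lemma Pm_recurrence : P_recurrence f [set x | nv x < rs 1] (Pm f).
Proof.
move=> i j x /= hx; split=> [|w u]; first by rewrite Pm0.
have r1 : 0 < rs 2^-1 by apply: (rs_gt0 HF); lra.
have r2 : rs 2^-1 <= rho0 by rewrite -[leRHS](rs0 rho0); apply: (rs_anti HF); lra.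
have hx' : nv (x - 0) < rs 2^-1.
  by rewrite subr0; apply: lt_le_trans hx _; apply: (rs_anti HF); lra.
have hP := Pm_scb HF w.
split.
- exact: nb_diff (mcb_entry w0 i j hP) hx'.
- have [hs _] := mcb_hmul HF w0 u hP (Pbound_ge0 HF w) r1 r2 (qh_ge1 HF) (ltW (qh_lt HF)) (qh_lt HF).
  exact: summ_has_sum (hs i j x hx').
- by rewrite -Pm_flat.
Qed.

Variables (U : set 'rV[K]_k) (W : set 'rV[K]_n).
Hypothesis hW : open W.
Hypothesis hcvg : forall r u, laurent_cvg U W (fun i => f r i u).
Variable C : 'rV[K]_n.
Hypothesis WC : W C.
Hypothesis rhoU : forall x : 'rV[K]_k, nv (x - 0) < rho0 -> U x.
Hypothesis cC : forall s, C 0 s != 0 -> c s = nrm (C 0 s).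

Lemma ysol_solution : solution_near0 f U W (ysol f C).
Proof.
have rzp := zrad_gt0 HF.
have [e e0 he] := region_near hW WC HF cC.
have d0 : differentiable (ysol f C) (0 : 'rV[K]_k).
  by apply: (ysol_diff HF cC); rewrite nv0.
have [d dp hd] := cont_near S e0 d0.
apply/(near_nv S); exists (Num.min d zrad) => [|x]; first by rewrite lt_min dp rzp.
rewrite subr0 lt_min => /andP[xd xr]; split.
- by apply: rhoU; rewrite subr0; apply: (zrad_le_rho0 HF).
- by have [] := he (ysol f C x); first by rewrite -[X in _ - X](ysol0 S f C); exact: hd.
- exact: (ysol_diff HF cC).
move=> r u; rewrite -(ysol_D hcvg WC HF rhoU cC) //.
apply: (Zl_flat HF) => // [|w i j _]; first exact: (lmonom_le_weight HF cC).
by apply: Pm_flat; apply: lt_le_trans xr _; exact: zrad_rs1.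
Qed.

(** [ysol] sums over [w] inside and over [j] outside, the required series the other way round; the
    geometric decay in [|w|] justifies the exchange. *)
Lemma ysol_series x r : nv x < zrad -> given_by_series (Pm f) C r x (ysol f C x 0 r).
Proof.
move=> hx; pose i := unit_tuple int r; pose l j := lmonom C j.
have hl j : nrm (l j) <= wt c j by exact: (lmonom_le_weight HF cC).
have r1 : nv (x - 0) < rs 2^-1.
  rewrite subr0; apply: lt_le_trans hx _; apply: le_trans (zrad_rs1 _ _ _ _ _) _.
  by apply: (rs_anti HF); lra.
have row w : summ (fun j => Pm f w i j x * l j).
  have [b b1 b2] := Pm_scb HF w; apply: summ_le (b2 i) => j.
  by rewrite nrmM ler_pM ?nrm_ge0 //; exact: nb_bound (b1 i j) r1.
split=> [w|]; first by apply: summ_has_sum (row w).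
have hx0 : nv (x - 0) < zrad by rewrite subr0.
pose a w j := taylor_factor w x * Pm f w i j x * l j.
have ha w : bd (fun j => nrm (a w j)) (wt c i * qs 2^-1 ^+ la i * 2^-1 ^+ mdeg w).
  have [b b1 b2] := taylor_Pm_mcb HF w; rewrite mulrC mulrA; apply: bd_le (b2 i) (lexx _) => j.
  by rewrite nrmM ler_pM ?nrm_ge0 //; exact: nb_bound (b1 i j) hx0.
have hb := bdZ (_ : 0 <= wt c i * qs 2^-1 ^+ la i) (@bd_geom R k).
have [] := fubini (S := S) ha (hb _).
  by rewrite mulr_ge0 ?ltW // exprn_gt0 // (lt_le_trans ltr01 (qh_ge1 HF)).
move=> _ f2 f3 f4 f5 f6 f7.
have -> : ysol f C x 0 r = sum_of (fun w => sum_of (a w)).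
  rewrite /ysol mxE f6 -f7; apply: sum_of_ext => j.
  rewrite /Zm mulrC -(@sum_ofZ _ _ S); first by apply: sum_of_ext => w; rewrite mulrC.
  have g0 : 0 <= wt c i * qs 2^-1 ^+ la i / wt c j.
    by rewrite divr_ge0 ?ltW // mulr_gt0 // exprn_gt0 // (lt_le_trans ltr01 (qh_ge1 HF)).
  apply: summ_le (bdZ g0 (@bd_geom R k)) => w.
  apply: le_trans (nb_bound (mcb_entry w0 i j (taylor_Pm_mcb HF w)) hx0) _.
  by apply: le_of_eq; ring.
apply: is_sum_ext (summ_is_sum f4) => w; rewrite -(@sum_ofZ _ _ S) //.
by apply: sum_of_ext => j; rewrite mulrA.
Qed.
End Sufficiency.

(** * Reduction of the conditions to the unit rows *)

Section Reduction.
Variables (R : realType) (K : numFieldType) (S : rcs R K) (n k : nat).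
Local Notation nrm := (nrm S).
Local Notation nv := (@nv R K S k).
Local Notation summ := (summ S).
Local Notation J := ('rV[int]_n).
Variable f : 'I_n -> J -> 'I_k -> 'rV[K]_k -> K.
Local Notation h := (hfun f).
Implicit Types (u v : 'I_k) (x : 'rV[K]_k) (i j t m : J) (s : 'I_n).
Variables (x0 : 'rV[K]_k) (rho0 : R) (c : 'I_n -> R) (q0 K0 : R).
Hypothesis HF : fbound S f x0 rho0 c q0 K0.
Local Notation e := (unit_tuple int).
Let c0 : forall s, 0 < c s. Proof. by case: HF. Qed.
Let w0 i : 0 < wt c i. Proof. exact: wt_gt0. Qed.
Let q01 : 1 < q0. Proof. by case: HF. Qed.
Let r00 : 0 < rho0. Proof. by case: HF. Qed.
Let x00 : nv (x0 - x0) < rho0.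
Proof. by rewrite subrr nv0. Qed.

Lemma hh_summ u v i j : summ (fun t => h t j v x0 * h i t u x0).
Proof.
have M0 : 0 <= (wt c j)^-1 by rewrite invr_ge0 ltW.
by have [_ _ hs _ _] := Dop_Dop HF u v i r00 (lexx _) (lexx 1) q01 M0 (idcol_nb HF j) x00.
Qed.

(** The weight of [L] is the product of those of [L - m] and [m], so a bound for one factor and
    summability of the other suffice. *)
Lemma ff_summ s s' u v (L : J) : summ (fun m => f s' (L - m) v x0 * f s m u x0).
Proof.
have [_ _ _ hf] := HF.
have [b b1 b2] := hf s u; have [b' b1' b2'] := hf s' v.
have q1 : 1 <= q0 by exact: ltW.
have bw m : b' m * wt c m <= K0.
  apply: le_trans (bd_term m b2'); rewrite ler_peMr ?exprn_ege1 //.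
  by rewrite mulr_ge0 ?(ltW (w0 _)) // (nb_ge0 (b1' m)).
have K00 : 0 <= K0 / wt c L by rewrite divr_ge0 ?(ltW (w0 _)) // (bd_ge0 b2).
apply: (summ_le (p := fun m => K0 / wt c L * (b m * wt c m * q0 ^+ la m))); last exact: bdZ b2.
move=> m; rewrite nrmM.
have f1 : nrm (f s' (L - m) v x0) <= K0 / wt c L * wt c m.
  apply: le_trans (nb_bound (b1' (L - m)) x00) _.
  rewrite mulrAC ler_pdivlMr //; 
  rewrite (_ : wt c L = wt c (L - m) * wt c m); last by rewrite -wtD // subrK.
  rewrite mulrA.
  by rewrite ler_wpM2r // ltW.
have f2 : nrm (f s m u x0) <= b m * q0 ^+ la m.
  apply: le_trans (nb_bound (b1 m) x00) _.
  by rewrite ler_peMr ?exprn_ege1 // (nb_ge0 (b1 m)).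
apply: le_trans (ler_pM _ _ f1 f2) _; rewrite ?nrm_ge0 //.
by apply: le_of_eq; ring.
Qed.

Let Q u v i j := sum_of (fun t => h t j v x0 * h i t u x0).
Let G u v s s' (L : J) := sum_of (fun m => f s' (L - m) v x0 * f s m u x0).

Lemma G_sym u v s s' L : G u v s s' L = G v u s' s L.
Proof.
have [_ E] := sum_of_bij (S := S) (f := fun m : J => L - m) (g := fun m : J => L - m)
   (fun m => subKr _ _) (fun m => subKr _ _) (ff_summ s s' u v L).
rewrite /G -E.
by apply: sum_of_ext => m; rewrite subKr mulrC.
Qed.

(* The last double sum is symmetric in u and v, by m |-> L - m. *)
Lemma Q_reduce u v i j : Q u v i j = \sum_s (i 0 s)%:~R * Q u v (e s) (j - i + e s) +
  \sum_s \sum_s' ((i 0 s)%:~R * ((i 0 s')%:~R - (s' == s)%:R)) * G u v s s' (j - i + e s + e s').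
Proof.
(* [m] is the exponent [t - i + {s}] of [f_s]; [hfunD] then separates the part belonging to the unit
   row [s] from that of [i - {s}]. *)
pose T s := fun m => h (m + (i - e s)) j v x0 * f s m u x0.
have ET s m : T s m = h m (j - i + e s) v x0 * h (e s) m u x0 +
   \sum_s' ((i 0 s')%:~R - (s' == s)%:R) * (f s' (j - i + e s + e s' - m) v x0 * f s m u x0).
  rewrite /T hfunD hfun_unit mulrDl opprB addrA -[_ + e s - i]addrA [e s - i]addrC addrA; congr (_ + _).
  rewrite /hfun mulr_suml; apply: eq_bigr => s' _.
  have -> : ((i - e s) 0 s')%:~R = (i 0 s')%:~R - (s' == s)%:R :> K.
    by rewrite mxE [X in _ + X]mxE unit_tupleE intrD; case: eqP => _; rewrite ?oppr0 ?subr0 ?mulrN1z.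
  rewrite mulrA; congr (_ * f _ _ _ _ * _).
  by apply/rowP => z; rewrite !mxE; ring.
have sG s s' : summ (fun m => ((i 0 s')%:~R - (s' == s)%:R) * (f s' (j - i + e s + e s' - m) v x0 * f s m u x0)).
  exact: (summZ _ (ff_summ _ _ _ _ _)).
have sGs s := sum_of_sum xpredT (sG s).
have hT s : summ (T s) /\ sum_of (T s) = Q u v (e s) (j - i + e s) +
    \sum_s' ((i 0 s')%:~R - (s' == s)%:R) * G u v s s' (j - i + e s + e s').
  have [g1 g2] := sGs s; have h1 := hh_summ u v (e s) (j - i + e s).
  rewrite (funext (ET s)); split; first exact: summD.
  rewrite (sum_ofD h1 g1) g2; congr (_ + _); apply: eq_bigr => s' _.
  by rewrite -(@sum_ofZ _ _ S) //; exact: ff_summ.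
have c1 s : cancel (fun t : J => t - i + e s) (fun t => t - e s + i).
  by move=> t; rewrite addrK subrK.
have c2 s : cancel (fun t : J => t - e s + i) (fun t : J => t - i + e s).
  by move=> t; rewrite addrK subrK.
have hU s := sum_of_bij (c1 s) (c2 s) (hT s).1.
have sU s : summ (fun t => (i 0 s)%:~R * T s (t - i + e s)) by apply: summZ; case: (hU s).
have -> : Q u v i j = \sum_s (i 0 s)%:~R * sum_of (T s).
  transitivity (sum_of (fun t => \sum_s (i 0 s)%:~R * T s (t - i + e s))).
    apply: sum_of_ext => t; rewrite /hfun [in LHS]mulr_sumr; apply: eq_bigr => s _.
    by rewrite mulrCA /T (_ : t - i + e s + (i - e s) = t) // addrA addrAC addrK subrK.
  have [_ ->] := sum_of_sum xpredT sU; apply: eq_bigr => s _.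
  by have [hs <-] := hU s; rewrite -(@sum_ofZ _ _ S).
rewrite -big_split; apply: eq_bigr => s _ /=; have [_ ->] := hT s.
rewrite mulrDr mulr_sumr; congr (_ + _); apply: eq_bigr => s' _.
by rewrite mulrA.
Qed.

Lemma pderiv_sum (a : 'I_n -> K) (g : 'I_n -> 'rV[K]_k -> K) u x :
  (forall s, differentiable (g s : 'rV[K]_k -> K^o) x) ->
  pderiv u (fun y => \sum_s a s * g s y) x = \sum_s a s * pderiv u (g s) x.
Proof.
move=> hg; rewrite /pderiv.
have hd s : derivable (g s : 'rV[K]_k -> K^o) x (unit_tuple K u) by exact: diff_derivable.
rewrite (_ : (fun y => _) = \sum_s (a s \*: (g s : 'rV[K]_k -> K^o))); last first.
  by apply/funext => y; rewrite fct_sumE.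
rewrite derive_sum; last by move=> s; exact: derivableZ.
by apply: eq_bigr => s _; rewrite deriveZ.
Qed.

(** The derivatives are combinations of those of the unit rows, and so is each quadratic sum up to
    the last term of [Q_reduce], which cancels between the two orders of [u] and [v]. *)
Lemma curvature_reduce i j u v :
  Rfun f i j u v x0 = \sum_s (i 0 s)%:~R * Rfun f (e s) (j - i + e s) u v x0.
Proof.
have hE u' : h i j u' = fun x => \sum_s (i 0 s)%:~R * h (e s) (j - i + e s) u' x.
  by apply/funext => x; apply: eq_bigr => s _; rewrite hfun_unit.
have hd u' s m : differentiable (h (e s) m u' : 'rV[K]_k -> K^o) x0.
  have [b hb _] := h_bound HF u' (e s); exact: nb_diff (hb m) x00.
(* Exchanging [s] and [s'] compensates the exchange of [u] and [v] in [G_sym], since the coefficient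
   [i_s (i_s' - delta)] is symmetric. *)
have Ds : \sum_s \sum_s' ((i 0 s)%:~R * ((i 0 s')%:~R - (s' == s)%:R)) * G u v s s' (j - i + e s + e s') =
    \sum_s \sum_s' ((i 0 s)%:~R * ((i 0 s')%:~R - (s' == s)%:R)) * G v u s s' (j - i + e s + e s').
  rewrite exchange_big; apply: eq_bigr => s _; apply: eq_bigr => s' _ /=.
  rewrite (G_sym u v) addrAC eq_sym; congr (_ * _).
  by have [->|_] := eqVneq s s'; rewrite ?subr0 1?mulrC.
rewrite /Rfun !{1}hE !pderiv_sum // -/(Q u v i j) -/(Q v u i j) !Q_reduce Ds.
under [in RHS]eq_bigr do rewrite mulrBr mulrDr mulrBr.
by rewrite !sumrB big_split /= sumrB [X in X - _]addrA opprD addrACA subrr addr0.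
Qed.
End Reduction.

(** * The identity theorem *)

Section IdentityTheorem.
Variables (R : realType) (K : numFieldType) (S : rcs R K) (k : nat).
Local Notation nv := (@nv R K S k).
Local Notation nbound := (@nbound R K S k).
Local Notation powser := (@powser R K S k).
Implicit Types (x : 'rV[K]_k) (g : 'rV[K]_k -> K).

Definition zero_near_by g x0 :=
  forall d : R, 0 < d -> exists2 x, nv (x - x0) < d & \forall y \near x, g y = 0.

(** The zeros fill open sets accumulating at [x0], a property that passes to derivatives; hence
    induction on the degree. *)
Lemma powser_zero_near_by N : forall x0 rho g a B m, mdeg m = N -> powser x0 rho g a B ->
  zero_near_by g x0 -> a m = 0.
Proof.
elim: N => [|N IH] x0 rho g a B m mN ha hz; have [r0 a1 a2] := ha.
  have r20 : 0 < rho / 2 by rewrite divr_gt0.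
  have x00 : nv (x0 - x0) < rho by rewrite subrr nv0.
  rewrite (mdeg_eq0 mN) (powser_at0 ha).
  apply: contrapT => /eqP g0.
  have gd : differentiable (g : 'rV[K]_k -> K^o) x0.
    by apply: (nb_diff (S := S) (N := 0) (rho := rho) (B := B) _ x00); exists a.
  have gc : (g x : K^o) @[x --> x0] --> (g x0 : K^o) := differentiable_continuous gd.
  have /(near_nv S)[d d0 hd] : \forall x \near x0, (g x : K^o) != 0.
    exact: cvgr_neq0 gc g0.
  have [x hx /nbhs_singleton gx] := hz d d0.
  by have := hd x hx; rewrite gx eqxx.
have [u mu] : exists u, (0 < m 0%R u)%N by apply: mdeg_pos; rewrite mN.
have [m' em] := rV_pos mu.
have m'N : mdeg m' = N by apply/eqP; rewrite -eqSS -mN em mdegD mdeg_unit addn1.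
have r20 : 0 < rho / 2 by rewrite divr_gt0.
have r21 : rho / 2 < rho by rewrite ltr_pdivrMr // ltr_pMr // ltr1n.
have [_ hda _] := powser_deriv u ha r20 r21.
have := IH _ _ _ _ _ m' m'N hda.
rewrite /dpowser -em => h; have : (m' 0 u).+1%:R * a m = 0.
  apply: h => d d0; have [x hx hgx] := hz d d0; exists x => //.
  near=> y; have -> : pderiv u g y = pderiv u (fun=> 0) y.
    by apply: pderiv_near; near: y; exact: (nbhs_interior hgx).
  by rewrite /pderiv derive_cst.
by move/eqP; rewrite mulf_eq0 pnatr_eq0 /= => /eqP.
Unshelve. all: by end_near.
Qed.

Lemma identity_theorem (U : set 'rV[K]_k) g : open U -> connected U -> U 0 ->
  (forall x0, U x0 -> exists rho B, nbound 0 x0 rho g B) ->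
  (\forall x \near (0 : 'rV[K]_k), g x = 0) -> forall x, U x -> g x = 0.
Proof.
move=> hU hc U0 hg g0.
pose Z := [set x : 'rV[K]_k | \forall y \near x, g y = 0].
have oZ : open Z by rewrite openE => x /nbhs_interior.
have ZU : U `&` Z = U.
  apply: hc; first by exists 0; split.
    by exists Z.
  (* [Z] is closed relative to [U]: at a limit point in [U] all coefficients of the local expansion
     vanish. *)
  exists (closure Z); first exact: closed_closure.
  apply/seteqP; split=> x [Ux hx]; split=> //; first exact: subset_closure.
  have [rho [B [a ha _]]] := hg x Ux; have [r0 _ a2] := ha.
  have a0 m : a m = 0.
    apply: (powser_zero_near_by erefl ha) => d d0.
    have [|y [Zy yd]] := hx [set y | nv (y - x) < d].
      by apply/(near_nv S); exists d.
    by exists y.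
  apply/(near_nv S); exists rho => // y hy.
  apply: (is_sum_uniq S) (a2 y hy) _; apply: is_sum_ext (is_sum0 S _) => m.
  by rewrite a0 mul0r.
by move=> x; rewrite -ZU => -[_ /nbhs_singleton].
Qed.
End IdentityTheorem.

(** * The curvature as an analytic matrix *)

Section CurvatureAnalytic.
Variables (R : realType) (K : numFieldType) (S : rcs R K) (n k : nat).
Local Notation nbound := (@nbound R K S k).
Local Notation J := ('rV[int]_n).
Variable f : 'I_n -> J -> 'I_k -> 'rV[K]_k -> K.
Implicit Types (u v : 'I_k) (i j : J).
Variables (x0 : 'rV[K]_k) (rho0 : R) (c : 'I_n -> R) (q0 K0 : R).
Hypothesis HF : fbound S f x0 rho0 c q0 K0.
Local Notation qs := (qs q0).
Let c0 : forall s, 0 < c s. Proof. by case: HF. Qed.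
Let q01 : 1 < q0. Proof. by case: HF. Qed.
Let h2 : 0 < (2^-1 : R). Proof. by rewrite invr_gt0. Qed.
Let h43 : 2^-1 < (3 / 4 : R). Proof. lra. Qed.
Let h31 : (3 / 4 : R) < 1. Proof. lra. Qed.

(** The row weights of level 1/2, used here for columns: the columns of [Z] are bounded by them, and
    the rows of the curvature must be summable against such columns. *)
Definition half_weight (j : J) : R := wt c j * qs 2^-1 ^+ la j.
Lemma half_weight_gt0 j : 0 < half_weight j.
Proof.
rewrite mulr_gt0 ?wt_gt0 // exprn_gt0 // (lt_le_trans ltr01) // (qs_ge1 HF) //; exact: ltW.
Qed.

Lemma curvature_rows u v : exists M (b : J -> J -> R),
  (forall i j, nbound 0 x0 (rs rho0 1) (Rfun f i j u v) (b i j)) /\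
  forall i, bd (fun j => b i j * half_weight j) (M * wt c i * q0 ^+ la i).
Proof.
(* With these column weights the identity has norm 1 only from level 1/2 on; the two operators then
   use the levels 3/4 and 1. *)
have id0 : scb S x0 rho0 c q0 0 2^-1 half_weight (@idmat K n k) 1.
  apply: idmat_mcb; first by apply: (rs_gt0 HF); apply: ltW; apply: lt_trans h43 _.
  by move=> i; rewrite (ltW (half_weight_gt0 i)) lexx.
have two u' v' : exists2 M, 0 <= M & scb S x0 rho0 c q0 0 1 half_weight (Dop f u' (Dop f v' (@idmat K n k))) M.
  have L0 s s' : s < s' -> 0 <= Dcost rho0 c q0 K0 / (s' - s).
    by move=> ss; rewrite divr_ge0 ?(Dcost_ge0 HF u') // subr_ge0 ltW.
  have h34 : 0 <= (3 / 4 : R) by rewrite ltW // (lt_trans h2).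
  have D1 := Dop_scb HF half_weight_gt0 v' id0 (ltW h2) h43 (ltW h31) ler01.
  have M1 : 0 <= 1 * (Dcost rho0 c q0 K0 / (3 / 4 - 2^-1)) by rewrite mul1r L0.
  have := Dop_scb HF half_weight_gt0 u' D1 h34 h31 (lexx 1) M1.
  by set M := _ * _; exists M => //; rewrite mulr_ge0 // L0.
have [M1 M10 [b1 hb1 hb1']] := two u v; have [M2 M20 [b2 hb2 hb2']] := two v u.
exists (M1 + M2), (fun i j => b1 i j + b2 i j); split=> [i j|i].
  apply: nb_ext (nbB (hb1 i j) (hb2 i j)) => x hx; apply/esym/(curvatureE HF).
  by apply: lt_le_trans hx _; rewrite -[leRHS](rs0 rho0); apply: (rs_anti HF).
have := bdD (hb1' i) (hb2' i); rewrite (qs1 q0) -!mulrDl => hb.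
by apply: bd_le hb (lexx _) => j; rewrite mulrDl.
Qed.
End CurvatureAnalytic.

Section LatticeInduction.
Variable n : nat.
Lemma rV_int_ind (P : 'rV[int]_n -> Prop) : P 0 ->
  (forall i j, P i -> P j -> P (i + j)) ->
  (forall s, P (unit_tuple int s) /\ P (- unit_tuple int s)) -> forall i, P i.
Proof.
move=> P0 PD Pu i; rewrite (row_sum_delta i); elim/big_ind: _ => // s _.
have Pn m : P (m%:Z *: unit_tuple int s) /\ P (- (m%:Z *: unit_tuple int s)).
  elim: m => [|m [IH1 IH2]]; first by rewrite scale0r oppr0.
  have [u1 u2] := Pu s.
  have -> : m.+1%:Z = m%:Z + 1 by rewrite -PoszD addn1.
  by rewrite scalerDl scale1r opprD; split; exact: PD.
by case: (i 0 s) => m; [case: (Pn m) | rewrite NegzE scaleNr; case: (Pn m.+1)].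
Qed.
End LatticeInduction.

(** * From solutions back to the rows of D_u Z *)

Section Transport.
Variables (R : realType) (K : numFieldType) (S : rcs R K) (n k : nat).
Local Notation nrm := (nrm S).
Local Notation nv := (@nv R K S k).
Local Notation summ := (summ S).
Local Notation nbound := (@nbound R K S k).
Local Notation powser := (@powser R K S k).
Local Notation J := ('rV[int]_n).
Variable f : 'I_n -> J -> 'I_k -> 'rV[K]_k -> K.
Implicit Types (u v : 'I_k) (x : 'rV[K]_k) (i j t : J).
Variables (rho0 : R) (c : 'I_n -> R) (q0 K0 : R).
Hypothesis HF : fbound S f 0 rho0 c q0 K0.
Local Notation qs := (qs q0).
Local Notation zrad := (zrad k rho0 c q0 K0).
Let c0 : forall s, 0 < c s. Proof. by case: HF. Qed.
Let w0 i : 0 < wt c i. Proof. exact: wt_gt0. Qed.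
Let q01 : 1 < q0. Proof. by case: HF. Qed.
Let rzp : 0 < zrad. Proof. exact: zrad_gt0 HF. Qed.

Lemma powser_scale x0 rho g a B (l : K) : powser x0 rho g a B ->
  powser x0 rho (fun x => g x * l) (fun m => a m * l) (B * nrm l).
Proof.
move=> [r0 a1 a2]; split=> // [|x hx].
  have hb := bdZ (nrm_ge0 S l) a1; rewrite mulrC; apply: bd_le hb (lexx _) => m.
  by rewrite nrmM mulrAC mulrC.
have := is_sumZ S (c := l) (a2 x hx); rewrite mulrC; apply: is_sum_ext => m.
by rewrite mulrCA mulrA.
Qed.

Lemma Dop_Zm_rows u i : exists b : J -> R, (forall j, nbound 0 0 (zrad / 2) (Dop f u (Zm f) i j) (b j)) /\
  exists B, bd (fun j => b j * wt c j) B.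
Proof.
have r20 : 0 < zrad / 2 by rewrite divr_gt0.
have r21 : zrad / 2 < zrad by rewrite ltr_pdivrMr // ltr_pMr // ltr1n.
have qh0 : 0 <= qs 2^-1 by rewrite (le_trans ler01) // (qh_ge1 HF).
have k0 : (0 : R) <= 2 ^+ k by exact: exprn_ge0.
have [b1 h1 h1'] := mcb_pderiv u (Zm_mcb HF) r20 r21.
have [_ [b2 h2 h2']] := mcb_hmul HF w0 u (Zm_mcb HF) k0 rzp (zrad_rho0 HF) (qh_ge1 HF)
   (ltW (qh_lt HF)) (qh_lt HF).
exists (fun j => b1 i j + b2 i j); split.
  move=> j; apply: nbD (h1 i j) _; exact: nb_mono (h2 i j) (leqnn _) r20 (ltW r21) (lexx _).
exists (2 ^+ k / (zrad - zrad / 2) * wt c i * qs 2^-1 ^+ la i +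
   2 ^+ k * (K1 c q0 K0 / (q0 - qs 2^-1)) * wt c i * q0 ^+ la i).
have hb := bdD (h1' i) (h2' i); apply: bd_le hb (lexx _) => j.
by rewrite mulrDl.
Qed.

Variable l : J -> K.
Hypothesis hl : forall j, nrm (l j) <= wt c j.
Hypothesis l0 : l 0 = 1.
Hypothesis lD : forall i j, l (i + j) = l i * l j.

(** The derivation rule propagates zeros over sums of indices. For [- {s}] it is applied to
    [{s} + (- {s}) = 0]: [Z] at [{s}] is invertible and can be cancelled. *)
Lemma Dcol_flat u x : nv x < zrad ->
  (forall r, Dcol f u (Zl f l) (unit_tuple int r) x = 0) -> forall i, Dcol f u (Zl f l) i x = 0.
Proof.
move=> hx h1; pose zs : pred 'I_n := fun=> false.
have al i : allowed zs i by apply/forallP.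
have fz s m u' y : nv y < rho0 -> ~~ allowed zs m -> f s m u' y = 0 by rewrite al.
have lD' i j : allowed zs i -> allowed zs j -> l (i + j) = l i * l j by [].
have DM i j := Dcol_mul HF hl lD' fz u (al i) (al j) hx.
have Z0 := Zl0 HF hl l0 hx.
have ZM i j := Zl_mul HF hl lD' fz (al i) (al j) hx.
have D0 : Dcol f u (Zl f l) 0 x = 0.
  (* Index 0 gives [D_0 = D_0 + D_0]. *)
  have := DM 0 0; rewrite addr0 Z0 mulr1 mul1r -[LHS]addr0 => /addrI.
  by move=> <-.
apply: rV_int_ind => // [i j hi hj|s]; first by rewrite DM hi hj mul0r mulr0 addr0.
split=> //; have := DM (unit_tuple int s) (- unit_tuple int s).
rewrite subrr D0 h1 mul0r add0r => /esym/eqP; rewrite mulf_eq0 => /orP[/eqP z0|/eqP //].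
by have := ZM (unit_tuple int s) (- unit_tuple int s); rewrite subrr Z0 z0 mul0r => /eqP; rewrite oner_eq0.
Qed.

(** The [al] come from a fixed expansion of [D_u Z], while the weights and the radius in force here
    may belong to another [C]; uniqueness of power series identifies the two expansions. The same
    coefficients thus satisfy one linear relation for every [C]. *)
Lemma coef_sum0 u i (al : J -> 'rV[nat]_k -> K) (rho : R) (b : J -> R) m :
  (forall j, powser 0 rho (Dop f u (Zm f) i j) (al j) (b j)) ->
  (\forall x \near (0 : 'rV[K]_k), Dcol f u (Zl f l) i x = 0) ->
  summ (fun j => al j m * l j) /\ sum_of (fun j => al j m * l j) = 0.
Proof.
move=> hal hz; have [b' [hb' [B hB]]] := Dop_Zm_rows u i.
have r20 : 0 < zrad / 2 by rewrite divr_gt0.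
have hal' j : powser 0 (zrad / 2) (Dop f u (Zm f) i j) (al j) (b' j).
  have [a ha _] := hb' j; suff -> : al j = a by [].
  by apply: powser_uniq (hal j) ha _; near=> y.
have hg j := powser_scale (l j) (hal' j).
have hB' : bd (fun j => b' j * nrm (l j)) B.
  by apply: bd_le hB (lexx _) => j; rewrite ler_wpM2l // (nb_ge0 (hb' j)).
have [h1 h2] := powser_tsum r20 hg hB'; split; first exact: h1.
have hzero : powser 0 (zrad / 2) (fun=> 0) (fun=> 0) 0.
  split=> // [D|x _]; first by rewrite big1 // => M _; rewrite nrm0 mul0r.
  by have := is_sum0 S 'rV[nat]_k; apply: is_sum_ext => M; rewrite mul0r.
suff e : (fun m => sum_of (fun j => al j m * l j)) = (fun=> 0) by exact: (congr1 (fun a => a m) e).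
apply: powser_uniq h2 hzero _.
have hr : \forall x \near (0 : 'rV[K]_k), nv x < zrad.
  by apply/(near_nv S); exists zrad => // y; rewrite subr0.
near=> x; rewrite -(Zl_D HF hl); first by near: x.
by near: x.
Unshelve. all: by end_near.
Qed.
End Transport.

(** * Vanishing of the curvature near the origin *)

Section CurvatureZero.
Variables (R : realType) (K : numFieldType) (S : rcs R K) (n k : nat).
Local Notation nv := (@nv R K S k).
Local Notation summ := (summ S).
Local Notation nbound := (@nbound R K S k).
Local Notation J := ('rV[int]_n).
Variable f : 'I_n -> J -> 'I_k -> 'rV[K]_k -> K.
Implicit Types (u v : 'I_k) (x : 'rV[K]_k) (i j t : J).
Variables (rho0 : R) (c : 'I_n -> R) (q0 K0 : R).
Hypothesis HF : fbound S f 0 rho0 c q0 K0.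
Local Notation qs := (qs q0).
Local Notation zrad := (zrad k rho0 c q0 K0).
Let c0 : forall s, 0 < c s. Proof. by case: HF. Qed.
Let w0 i : 0 < wt c i. Proof. exact: wt_gt0. Qed.

(* The curvature R satisfies R Z = [D_u, D_v] Z = 0 where Z = I + O(x), hence
   R = R (I - Z) vanishes to every order at 0. *)
Lemma curvature_zero r : 0 < r -> r <= zrad ->
  (forall u i j x, nv x < r -> Dop f u (Zm f) i j x = 0) ->
  forall i j u v x, nv x < r -> Rfun f i j u v x = 0.
Proof.
move=> r0 rr hflat i0 j0 u v x hx0.
have rr0 : r <= rho0 by apply: le_trans rr (zrad_rho0 HF).
have qh1 := qh_ge1 HF; have qhlt := qh_lt HF.
have [M [b [hb hb']]] := curvature_rows HF u v.
have k0 : (0 : R) <= 2 ^+ k by exact: exprn_ge0.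
have cj j : 0 <= 2 ^+ k / wt c j by rewrite divr_ge0 // ltW.
have Zn j t : nbound 0 0 r (Zm f t j) (2 ^+ k / wt c j * wt c t * qs 2^-1 ^+ la t).
  have hz := nb_mono (mcb_entry w0 t j (Zm_mcb HF)) (leqnn _) r0 rr (lexx _).
  by apply: nb_le hz _; apply: le_of_eq; ring.
have hcol i j y : nv y < r -> summ (fun t => Rfun f i t u v y * Zm f t j y) /\
    sum_of (fun t => Rfun f i t u v y * Zm f t j y) = 0.
  move=> hy; have hy' : nv (y - 0) < r by rewrite subr0.
  have [h1 h2] := commutator HF u v i r0 rr0 qh1 qhlt (cj j) (Zn j) hy'.
  split=> //; have z0 u' v' : Dop f u' (Dop f v' (Zm f)) i j y = 0.
    transitivity (Dop f u' (fun (_ _ : J) (_ : 'rV[K]_k) => 0) i j y).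
      by apply: (@Dop_near _ _ S _ _ _ 0 _ _ _ r) => // z t; rewrite subr0; exact: hflat.
    rewrite /Dop /hmul /pderiv derive_cst add0r (sum_of_ext (b := fun=> 0)).
      exact: (is_sumE S (is_sum0 S _)).
    by move=> t; rewrite mulr0.
  rewrite -h2; have := z0 u v; have := z0 v u; rewrite /Dop /hmul => -> ->.
  by rewrite subr0.
(* The 1 bounds the identity and the [2^k] bounds [Z], both in column [j] and against the weight for
   which [curvature_rows] sums the rows. *)
pose Bz j t := (1 + 2 ^+ k) / wt c j * half_weight c q0 t.
have hd j t : nbound 1 0 r (fun y => idmat t j y - Zm f t j y) (Bz j t).
  apply: nb_at0; last by rewrite idmatE (Zm_at0 S) subrr.
  have -> : @idmat K n k t j = (fun=> (t == j)%:R) by apply/funext => z; rewrite idmatE.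
  apply: nb_le (nbB (nb_cst S _ _ r0) (Zn j t)) _; rewrite nrm_nat /Bz mulrDl mulrDl.
  apply: lerD; last by rewrite -mulrA.
  rewrite div1r; case: eqP => [->|_]; last by rewrite mulr_ge0 ?invr_ge0 ?ltW // (half_weight_gt0 HF).
  by rewrite mulrA mulVf ?gt_eqF // mul1r exprn_ege1.
have hR N i j : nbound N 0 r (fun y => Rfun f i j u v y) (b i j).
  have h0 i' j' : nbound 0 0 r (fun y => Rfun f i' j' u v y) (b i' j').
    by apply: nb_mono (hb i' j') (leqnn _) r0 _ (lexx _); apply: le_trans rr (zrad_rs1 _ _ _ _ _).
  elim: N i j => [//|N IH] i j.
  have hg t := nbM (IH i t) (hd j t).
  have hB : bd (fun t => b i t * Bz j t) ((1 + 2 ^+ k) / wt c j * (M * wt c i * q0 ^+ la i)).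
    have c1 : 0 <= (1 + 2 ^+ k) / wt c j by rewrite divr_ge0 ?addr_ge0 // ltW.
    by apply: bd_le (bdZ c1 (hb' i)) (lexx _) => t; rewrite /Bz mulrCA.
  have [_ h2] := nb_tsum r0 hg hB.
  (* Only the order of vanishing is taken from the product; radius and bound remain those of the
     curvature, so the next step of the induction finds the same row bounds. *)
  apply: nb_raise (h0 i j) (_ : nbound N.+1 0 r _ ((1 + 2 ^+ k) / wt c j * (M * wt c i * q0 ^+ la i))).
  rewrite -addn1; apply: nb_ext h2 => y; rewrite subr0 => hy.
  have [s1 e1] := hcol i j y hy.
  have s2 : is_sum (fun t => Rfun f i t u v y * idmat t j y) (Rfun f i j u v y).
    have := @is_sum_single R K S _ (fun t => Rfun f i t u v y * idmat t j y) j.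
    rewrite idmatE eqxx mulr1; apply => t /negPf tj; by rewrite idmatE tj mulr0.
  apply: (is_sumE S).
  have := is_sumD S s2 (is_sumZ S (c := -1) (summ_is_sum s1)).
  rewrite e1 mulr0 addr0; apply: is_sum_ext => t.
  by rewrite mulN1r mulrBr.
apply: (nb_eq0 (hR 0 i0 j0)); last by rewrite subr0.
by move=> N; exists r, (b i0 j0); exact: hR.
Qed.
End CurvatureZero.

(** * Necessity of the conditions *)

Section Necessity.
Variables (R : realType) (K : numFieldType) (S : rcs R K) (n k : nat).
Local Notation nrm := (nrm S).
Local Notation nvn := (@nv R K S n).
Local Notation nv := (@nv R K S k).
Local Notation J := ('rV[int]_n).
Variable f : 'I_n -> J -> 'I_k -> 'rV[K]_k -> K.
Variables (U : set 'rV[K]_k) (W : set 'rV[K]_n).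
Hypothesis hU : open U.
Hypothesis hUconn : connected U.
Hypothesis hU0 : U 0.
Hypothesis hW : open W.
Hypothesis hWne : W !=set0.
Hypothesis hcvg : forall r u, laurent_cvg U W (fun i => f r i u).

Lemma nonzero_point : exists2 C, W C & forall s, C 0 s != 0.
Proof.
have [y Wy] := hWne; have /(near_nv S)[d d0 hd] : \forall z \near y, W z.
  exact: open_nbhs_nbhs.
have d20 : 0 < d / 2 by rewrite divr_gt0.
have dn : rcr S (d / 2) != 0 by rewrite -(rcr0 S) (inj_eq (@rcr_inj _ _ S)) gt_eqF.
exists (\row_s (if y 0 s == 0 then rcr S (d / 2) else y 0 s)) => [|s]; last first.
  by rewrite mxE; case: ifPn.
apply: hd; apply/(nv_ltP S _ d0) => s; rewrite !mxE; case: eqP => [->|_].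
  by rewrite subr0 nrm_rcr gtr0_norm // ltr_pdivrMr // ltr_pMr // ltr1n.
by rewrite subrr nrm0.
Qed.

Lemma scaled_in C : W C -> exists2 eta : R, 0 < eta &
  forall t, (forall s, `|t s| <= eta) -> W (scaled S C t).
Proof.
move=> WC; have /(near_nv S)[d d0 hd] : \forall z \near C, W z by exact: open_nbhs_nbhs.
have Cp : 0 < nvn C + 1 by rewrite ltr_wpDl // nv_ge0.
have hc : expR x @[x --> (0 : R)] --> (1 : R) by rewrite -expR0; exact: continuous_expR.
have := (cvgrPdist_lt _ _).1 hc (d / (nvn C + 1)).
rewrite divr_gt0 // => /(_ _ isT) /nbhs_ballP[e /= e0 he].
have e20 : 0 < e / 2 by rewrite divr_gt0.
exists (e / 2) => // t ht; apply: hd; apply/(nv_ltP S _ d0) => s; rewrite !mxE.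
have -> : C 0 s * rcr S (expR (t s)) - C 0 s = C 0 s * rcr S (expR (t s) - 1).
  by rewrite rcrB rcr_one mulrBr mulr1.
rewrite nrmM nrm_rcr distrC.
have hs : `|1 - expR (t s)| < d / (nvn C + 1).
  apply: he; rewrite /ball /= sub0r normrN; apply: le_lt_trans (ht s) _.
  by rewrite ltr_pdivrMr // ltr_pMr // ltr1n.
apply: (@le_lt_trans _ _ ((nvn C + 1) * `|1 - expR (t s)|)).
  by rewrite ler_wpM2r // (le_trans (nv_coord S C s)) // lerDl.
by rewrite mulrC -ltr_pdivlMr.
Qed.

Hypothesis hint : integrable_for_all_initial f U W.

(** Any solution coincides with [ysol] near 0, so [ysol] satisfies the system there. As no
    coordinate of [C] is zero, [Dcol_flat] leads from the unit rows to all rows. *)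
Lemma flat_near C rho0 c q0 K0 u i : W C -> (forall s, C 0 s != 0) ->
  fbound S f 0 rho0 c q0 K0 -> (forall x : 'rV[K]_k, nv (x - 0) < rho0 -> U x) ->
  (forall s, C 0 s != 0 -> c s = nrm (C 0 s)) ->
  \forall x \near (0 : 'rV[K]_k), Dcol f u (Zl f (fun j => lmonom C j)) i x = 0.
Proof.
move=> WC C0 HF rhoU cC; have [z [hz z0]] := hint WC.
have zy := solution_unique hW hcvg WC HF rhoU cC hz z0.
have hzy := nbhs_interior zy.
have hr : \forall x \near (0 : 'rV[K]_k), nv x < zrad k rho0 c q0 K0.
  by apply/(near_nv S); exists (zrad k rho0 c q0 K0) => [|y]; [exact: zrad_gt0 HF | rewrite subr0].
near=> x.
have hx : nv x < zrad k rho0 c q0 K0 by near: x.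
apply: (Dcol_flat HF (lmonom_le_weight HF cC)) => // [|i' j'|r]; first exact: lmonom0.
  by apply: lmonomD; apply/forallP => s; rewrite (negPf (C0 s)).
rewrite (ysol_D hcvg WC HF rhoU cC) //.
have [_ _ _ /(_ r u) <-] : [/\ U x, W (z x), differentiable z x & forall r u,
    pderiv u (fun y => z y 0 r) x + sum_of (fun i => f r i u x * lmonom (z x) i) = 0].
  by near: x.
have -> : z x = ysol f C x by near: x.
congr (_ + _); apply: pderiv_near.
have h1 : \forall y \near x, z y = ysol f C y by near: x; exact: hzy.
by near=> y; congr (_ _ _ _); apply/esym; near: y.
Unshelve. all: by end_near.
Qed.

(** Laurent uniqueness in [C] is applied to each power of [x] separately, which avoids a common
    neighbourhood of 0 for all initial values. *)
Lemma necessity i j u v x : U x -> Rfun f i j u v x = 0.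
Proof.
have [C WC C0] := nonzero_point; have [eta e0 he] := scaled_in WC.
have [rho0 [c [q0 [K0 [HF rhoU cC]]]]] := local_data S hU hW hcvg hU0 WC.
have rzp := zrad_gt0 HF; have r20 : 0 < zrad k rho0 c q0 K0 / 2 by rewrite divr_gt0.
have r21 : zrad k rho0 c q0 K0 / 2 <= zrad k rho0 c q0 K0 by rewrite ler_pdivrMr // ler_peMr ?ltW // ltr1n.
have flat u' i' j' y : nv y < zrad k rho0 c q0 K0 / 2 -> Dop f u' (Zm f) i' j' y = 0.
  move=> hy; have [b [hb _]] := Dop_Zm_rows HF u' i'.
  have hb' t : exists a, powser S 0 (zrad k rho0 c q0 K0 / 2) (Dop f u' (Zm f) i' t) a (b t).
    by have [a ha _] := hb t; exists a.
  have [al hal] := choice hb'.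
  have al0 m t : al t m = 0.
    have : al t m * lmonom C t = 0.
      (* The coefficients [al t m] stay fixed while [C] is dilated; every dilated point brings its
         own weights and radius. *)
      refine (@laurent_uniq _ _ S n (fun t => al t m) C eta e0 _ t) => tt htt.
      have WC' := he tt htt.
      have C0' s : scaled S C tt 0 s != 0.
        rewrite mxE mulf_neq0 // -(rcr0 S) (inj_eq (@rcr_inj _ _ S)) gt_eqF //; exact: expR_gt0.
      have [rho1 [c1 [q1 [K1 [HF1 rhoU1 cC1]]]]] := local_data S hU hW hcvg hU0 WC'.
      apply: (coef_sum0 HF1 (lmonom_le_weight HF1 cC1) m hal).
      exact: (flat_near u' i' WC' C0' HF1 rhoU1 cC1).
    move/eqP; rewrite mulf_eq0 => /orP[/eqP //|]; rewrite prodf_seq_eq0 => /hasP[s _ /=].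
    by rewrite expfz_eq0 (negPf (C0 s)) andbF.
  have [_ _ a2] := hal j'; have hy' : nv (y - 0) < zrad k rho0 c q0 K0 / 2 by rewrite subr0.
  apply: (is_sum_uniq S) (a2 y hy') _; apply: is_sum_ext (is_sum0 S _) => m.
  by rewrite al0 mul0r.
have R0 := curvature_zero HF r20 r21 flat.
apply: (identity_theorem (S := S) hU hUconn hU0) => [x0 Ux0|].
  have [rho1 [c1 [q1 [K1 [HF1 _ _]]]]] := local_data S hU hW hcvg Ux0 WC.
  have [M [b [hb _]]] := curvature_rows HF1 u v.
  by exists (rs rho1 1), (b i j); exact: hb.
by apply/(near_nv S); exists (zrad k rho0 c q0 K0 / 2) => // y; rewrite subr0; exact: R0.
Qed.
End Necessity.

Theorem theorem3p2 (R : realType) (K : numFieldType)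
  (hK : K = (R : numFieldType) \/ K = (R[i]%C : numFieldType))
  (n k : nat) (hn : (1 <= n)%N) (hk : (1 <= k)%N)
  (f : 'I_n -> 'rV[int]_n -> 'I_k -> 'rV[K]_k -> K)
  (U : set 'rV[K]_k) (W : set 'rV[K]_n)
  (hU : open U) (hUconn : connected U) (hU0 : U 0)
  (hW : open W) (hWne : W !=set0)
  (hreg : forall r i u, regular_on U (f r i u))
  (hcvg : forall r u, laurent_cvg U W (fun i => f r i u)) :
  ((integrable_for_all_initial f U W <->
      (forall i j u v x, U x -> Rfun f i j u v x = 0)) /\
   ((forall i j u v x, U x -> Rfun f i j u v x = 0) <->
      (forall r j u v x, U x -> Rfun f (unit_tuple int r) j u v x = 0))) /\
  ((forall i j u v x, U x -> Rfun f i j u v x = 0) ->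
   exists P : 'rV[nat]_k -> 'rV[int]_n -> 'rV[int]_n -> 'rV[K]_k -> K,
     (exists V : set 'rV[K]_k,
        [/\ open V, V 0, V `<=` U & P_recurrence f V P]) /\
     (forall C : 'rV[K]_n, W C ->
        exists y : 'rV[K]_k -> 'rV[K]_n,
          [/\ solution_near0 f U W y, y 0 = C,
              \forall x \near (0 : 'rV[K]_k),
                forall r : 'I_n, given_by_series P C r x (y x 0 r) &
              forall z : 'rV[K]_k -> 'rV[K]_n,
                solution_near0 f U W z -> z 0 = C ->
                \forall x \near (0 : 'rV[K]_k), z x = y x])).
Proof.
have [S] := rcs_exists hK.
(* An arbitrary point of [W], used where only bounds for [f] are needed. *)
have [C1 WC1] := hWne.
(* [P] is [Pm f] for every [C]; only the neighbourhood on which its series represents the solution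
   varies with [C]. *)
have sol (R0 : forall i j u v x, U x -> Rfun f i j u v x = 0) C : W C ->
    exists y : 'rV[K]_k -> 'rV[K]_n,
          [/\ solution_near0 f U W y, y 0 = C,
              \forall x \near (0 : 'rV[K]_k),
                forall r : 'I_n, given_by_series (Pm f) C r x (y x 0 r) &
              forall z : 'rV[K]_k -> 'rV[K]_n,
                solution_near0 f U W z -> z 0 = C ->
                \forall x \near (0 : 'rV[K]_k), z x = y x].
  move=> WC; have [rho0 [c [q0 [K0 [HF rhoU cC]]]]] := local_data S hU hW hcvg hU0 WC.
  have R1 i j u v x : nv S x < rs rho0 1 -> Rfun f i j u v x = 0.
    move=> hx; apply: R0; apply: rhoU; rewrite subr0; apply: lt_le_trans hx _.
    by rewrite -[leRHS](rs0 rho0); apply: (rs_anti HF).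
  exists (ysol f C); split.
  - exact: (ysol_solution HF R1 hW hcvg WC rhoU cC).
  - exact: (ysol0 S).
  - apply/(near_nv S); exists (zrad k rho0 c q0 K0); first exact: zrad_gt0 HF.
    by move=> x; rewrite subr0 => hx r; exact: (ysol_series HF cC).
  - by move=> z hz z0; exact: (solution_unique hW hcvg WC HF rhoU cC).
split; [split; split|].
- by move=> hint i j u v x; exact: (necessity S hU hUconn hU0 hW hWne hcvg hint).
- by move=> R0 C WC; have [y [h1 h2 _ _]] := sol R0 C WC; exists y.
- by move=> R0 r j u v x; exact: R0.
- move=> R0 i j u v x Ux.
  (* The reduction to unit rows is pointwise, so the bounds are taken around [x] itself. *)
  have [rho0 [c [q0 [K0 [HF _ _]]]]] := local_data S hU hW hcvg Ux WC1.
  by rewrite (curvature_reduce HF) big1 // => s _; rewrite R0 ?mulr0.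
move=> R0; exists (Pm f); split; last exact: sol.
have [rho0 [c [q0 [K0 [HF rhoU _]]]]] := local_data S hU hW hcvg hU0 WC1.
have rle : rs rho0 1 <= rho0 by rewrite -[leRHS](rs0 rho0); apply: (rs_anti HF).
have VU : [set x | nv S x < rs rho0 1] `<=` U.
  by move=> x /= hx; apply: rhoU; rewrite subr0; exact: lt_le_trans hx rle.
exists [set x | nv S x < rs rho0 1]; split => //.
- rewrite openE => x /= hx; apply/(near_nv S).
  exists (rs rho0 1 - nv S x) => [|y hy]; first by rewrite subr_gt0.
  by rewrite -(subrK x y); apply: le_lt_trans (nvD _ _ _) _; rewrite -ltrBrDr.
- by rewrite /= nv0; exact: (rs_gt0 HF).
by apply: (Pm_recurrence HF) => i j u v x hx; apply: R0; apply: VU.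
Qed.
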